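(* The Gramian $P_T=\sum_{i=1}^\infty\int_0^TZ_{i,T}(t)\,\mathrm dt$ exists if $$4\int_0^T\mathbb E\|\Phi_w(t)H\|^2\,\mathrm dt\int_0^T\|Z_1(t)\|\,\mathrm dt\le1,$$ where $Z_1:=Z_{1,T}=Z_{1,\infty}$. If $\sigma\big(A\otimes I+I\otimes A+\sum_{k=1}^mN_k\otimes N_k\big)\subset\mathbb C_-$, then the infinite Gramian $P=\sum_{i=1}^\infty\int_0^\infty Z_{i,\infty}(t)\,\mathrm dt$ exists if $$4\int_0^\infty\mathbb E\|\Phi_w(t)H\|^2\,\mathrm dt\int_0^\infty\|Z_1(t)\|\,\mathrm dt\le1.$$
   Context: Setting: $n,m\in\mathbb N$, $T>0$, $A\in\mathbb R^{n\times n}$, $B\in\mathbb R^{n\times m}$, $N=[N_1\ \dots\ N_m]$, $H=[H_1\ \dots\ H_n]$ with $N_k,H_j\in\mathbb R^{n\times n}$; $\|\cdot\|$ is the Euclidean norm for vectors and the induced operator norm for matrices; $\otimes$ is the Kronecker product; $\sigma(\cdot)$ is the spectrum and $\mathbb C_-$ the open left half-plane. Let $\mathcal L(X)=AX+XA^\top+N(I\otimes X)N^\top=AX+XA^\top+\sum_{k=1}^mN_kXN_k^\top$. Let $Z_{1,T}$ solve $\dot Z_{1,T}(t)=\mathcal L(Z_{1,T}(t))$, $t\ge0$, $Z_{1,T}(0)=BB^\top$ (this does not depend on $T$), and for $i\ge2$ let $\dot Z_{i,T}(t)=\mathcal L(Z_{i,T}(t))$, $Z_{i,T}(0)=H\big(\sum_{k=1}^{i-1}\int_0^TZ_{k,T}(s)\,\mathrm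 ds\otimes\int_0^TZ_{i-k,T}(s)\,\mathrm ds\big)H^\top$. $Z_{i,\infty}$ is defined in the same way with $T$ replaced by $\infty$ in the initial values. A Gramian ''exists'' if the defining series (and, for $P$, all improper integrals) converge. $\Phi_w$ is the stochastic fundamental solution: for an $m$-dimensional Wiener process $w$ with independent entries (Itô integral), $\Phi_w(t)=I+\int_0^tA\Phi_w(v)\,\mathrm dv+\int_0^tN(\mathrm dw(v)\otimes\Phi_w(v))$, where $N(\mathrm dw\otimes\Phi_w)=\sum_{k=1}^mN_k\Phi_w\,\mathrm dw_k$. *)

(* Defs.v *)
From HB Require Import structures.
From mathcomp Require Export all_boot all_order all_algebra.
From mathcomp Require Export all_classical all_reals all_analysis.
From mathcomp Require Export measurable_realfun mxtens complex.
Set Implicit Arguments.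
Unset Strict Implicit.
Unset Printing Implicit Defensive.
Export Order.TTheory GRing.Theory Num.Theory.
Export numFieldNormedType.Exports.
Local Open Scope classical_set_scope.
Local Open Scope ring_scope.

(* The norm that MathComp-Analysis puts on matrices is the max norm, hence the
   Euclidean and operator norms below.  The topology on matrices is the
   entrywise one, so library convergence of matrices can be used as is. *)
Definition enorm (R : realType) (p : nat) (x : 'cV[R]_p) : R :=
  Num.sqrt (\sum_i x i 0 ^+ 2).

Definition opnorm (R : realType) (p q : nat) (M : 'M[R]_(p, q)) : R :=
  sup [set enorm (M *m x) | x in [set x : 'cV[R]_q | enorm x <= 1]].

Definition spectrum_in_Cminus (R : realType) (p : nat) (M : 'M[R]_p) : Prop :=
  forall z : R[i], eigenvalue (map_mx (real_complex R) M) z -> complex.Re z < 0.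

Definition mxint (R : realType) (p q : nat) (t : R) (f : R -> 'M[R]_(p, q)) :
    'M[R]_(p, q) :=
  \matrix_(a, b) Rintegral lebesgue_measure `[0, t] (fun s => f s a b).

(* This is a total operator: it is meaningful only if the limit exists, and
   [gramian_exists] below requires that it does. *)
Definition mxint_oo (R : realType) (p q : nat) (f : R -> 'M[R]_(p, q)) :
    'M[R]_(p, q) :=
  lim (mxint t f @[t --> +oo]).

Definition lyap (R : realType) (n m : nat) (A : 'M[R]_n) (N : 'I_m -> 'M[R]_n)
    (X : 'M[R]_n) : 'M[R]_n :=
  A *m X + X *m A^T + \sum_k N k *m X *m (N k)^T.

(* Continuity at 0 together with the equation on (0, +oo) gives the equation
   at 0 for the right derivative; values at negative times are irrelevant. *)
Definition solves_lyap (R : realType) (n m : nat) (A : 'M[R]_n)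
    (N : 'I_m -> 'M[R]_n) (Z0 : 'M[R]_n) (Z : R -> 'M[R]_n) : Prop :=
  [/\ Z 0 = Z0,
      forall a b, {within `[0, +oo[, continuous (fun t => Z t a b)} &
      forall t : R, 0 < t -> forall a b,
        is_derive t (1 : R) (fun s => Z s a b) (lyap A N (Z t) a b)].

(* [J f] stands for the time integral of [f]: [mxint T] for the family
   Z_{i,T} and [mxint_oo] for the family Z_{i,oo}.  The family is indexed
   from 1 and [Z 0] is not used.  The factor H = [H_1 ... H_n] is an
   n x n^2 matrix, with the columns ordered as in the Kronecker product [*t]. *)
Definition gramian_family (R : realType) (n m : nat) (A : 'M[R]_n)
    (B : 'M[R]_(n, m)) (N : 'I_m -> 'M[R]_n) (H : 'M[R]_(n, n * n))
    (J : (R -> 'M[R]_n) -> 'M[R]_n) (Z : nat -> R -> 'M[R]_n) : Prop :=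
  solves_lyap A N (B *m B^T) (Z 1%N) /\
  forall i, (2 <= i)%N ->
    solves_lyap A N
      (H *m (\sum_(1 <= k < i) (J (Z k) *t J (Z (i - k)%N))) *m H^T) (Z i).

Definition gramian_T_exists (R : realType) (n : nat) (T : R)
    (Z : nat -> R -> 'M[R]_n) : Prop :=
  cvg ((\sum_(1 <= i < k) mxint T (Z i)) @[k --> \oo]).

Definition gramian_exists (R : realType) (n : nat)
    (Z : nat -> R -> 'M[R]_n) : Prop :=
  (forall i, (1 <= i)%N -> cvg (mxint t (Z i) @[t --> +oo])) /\
  cvg ((\sum_(1 <= i < k) mxint_oo (Z i)) @[k --> \oo]).

(* Processes are indexed by R, but only times in [0, +oo) matter. *)

Definition filtration (R : realType) (d : measure_display)
    (Omega : measurableType d) (F : R -> set (set Omega)) : Prop :=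
  [/\ forall t : R, 0 <= t -> sigma_algebra setT (F t),
      forall t : R, 0 <= t -> F t `<=` measurable &
      forall s t : R, 0 <= s -> s <= t -> F s `<=` F t].

Definition measurable_wrt (R : realType) (Omega : Type)
    (G : set (set Omega)) (X : Omega -> R) : Prop :=
  forall C : set R, measurable C -> G (X @^-1` C).

Definition adapted (R : realType) (Omega : Type)
    (F : R -> set (set Omega)) (X : R -> Omega -> R) : Prop :=
  forall t : R, 0 <= t -> measurable_wrt (F t) (X t).

(* The product rule in the last clause gives both the independence of the
   entries and the independence of the increments from the past. *)
Definition wiener_process (R : realType) (d : measure_display)
    (Omega : measurableType d) (P : probability Omega R)
    (F : R -> set (set Omega)) (m : nat) (w : 'I_m -> R -> Omega -> R) : Prop :=
  [/\ forall k, adapted F (w k),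
      forall k, {ae P, forall omega, w k 0 omega = 0},
      forall k, {ae P, forall omega,
        {within `[0, +oo[, continuous (fun t => w k t omega)}},
      forall k (s t : R), 0 <= s -> s < t -> forall C : set R, measurable C ->
        P ((fun omega => w k t omega - w k s omega) @^-1` C) =
        normal_prob 0 (Num.sqrt (t - s)) C &
      forall s t : R, 0 <= s -> s < t ->
        forall (E : set Omega) (C : 'I_m -> set R),
        F s E -> (forall k, measurable (C k)) ->
        P (E `&` [set omega | forall k, C k (w k t omega - w k s omega)]) =
        (P E * \prod_k
           P ((fun omega => (w k t omega - w k s omega)%R) @^-1` C k))%E].

Record simple_process (R : realType) (Omega : Type) := SimpleProcess {
  sp_size : nat ;
  sp_time : nat -> R ;
  sp_coef : nat -> Omega -> R }.

Definition sp_wf (R : realType) (Omega : Type) (F : R -> set (set Omega))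
    (t : R) (S : simple_process R Omega) : Prop :=
  [/\ 0 <= sp_time S 0%N,
      forall j, (j < sp_size S)%N -> sp_time S j <= sp_time S j.+1,
      sp_time S (sp_size S) <= t &
      forall j, (j < sp_size S)%N ->
        measurable_wrt (F (sp_time S j)) (sp_coef S j) /\
        exists M : R, forall omega, `|sp_coef S j omega| <= M].

Definition sp_val (R : realType) (Omega : Type) (S : simple_process R Omega)
    (v : R) (omega : Omega) : R :=
  \sum_(j < sp_size S)
    sp_coef S j omega * \1_(`]sp_time S j, sp_time S j.+1]) v.

Definition sp_int (R : realType) (Omega : Type) (w : R -> Omega -> R)
    (S : simple_process R Omega) (omega : Omega) : R :=
  \sum_(j < sp_size S)
    sp_coef S j omega * (w (sp_time S j.+1) omega - w (sp_time S j) omega).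

(* [Y] is (a version of) the Ito integral of [X] with respect to the scalar
   Wiener process [w] over [0, t]: the L^2 limit of the elementary integrals
   of simple adapted processes that approximate [X] in L^2([0, t] x Omega). *)
Definition ito_integral (R : realType) (d : measure_display)
    (Omega : measurableType d) (P : probability Omega R)
    (F : R -> set (set Omega)) (w : R -> Omega -> R) (t : R)
    (X : R -> Omega -> R) (Y : Omega -> R) : Prop :=
  measurable_fun setT Y /\
  exists S : nat -> simple_process R Omega,
    [/\ forall l, sp_wf F t (S l),
        (\int[P]_omega \int[lebesgue_measure]_(v in `[0%R, t])
           ((sp_val (S l) v omega - X v omega) ^+ 2)%R%:E @[l --> \oo] --> 0)%E &
        (\int[P]_omega ((sp_int w (S l) omega - Y omega) ^+ 2)%R%:E
           @[l --> \oo] --> 0)%E].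

(* The entries are required to be admissible L^2 Ito integrands (jointly
   measurable, adapted, square integrable on bounded time intervals); the
   linear equation determines Phi t almost surely for every t >= 0.  The
   matrix-valued random variable [J k] is the integral of Phi dw_k over
   [0, t]. *)
Definition fundamental_solution (R : realType) (n m : nat)
    (d : measure_display) (Omega : measurableType d) (P : probability Omega R)
    (F : R -> set (set Omega)) (w : 'I_m -> R -> Omega -> R)
    (A : 'M[R]_n) (N : 'I_m -> 'M[R]_n) (Phi : R -> Omega -> 'M[R]_n) : Prop :=
  [/\ forall a b : 'I_n, measurable_fun ((`[0, +oo[ : set R) `*` [set: Omega])
        (fun p : R * Omega => Phi p.1 p.2 a b),
      forall a b, adapted F (fun t omega => Phi t omega a b),
      forall a b (t : R), 0 <= t ->
        (\int[P]_omega \int[lebesgue_measure]_(v in `[0%R, t])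
           (Phi v omega a b ^+ 2)%R%:E < +oo)%E &
      forall t : R, 0 <= t -> exists J : 'I_m -> Omega -> 'M[R]_n,
        (forall k a b, ito_integral P F (w k) t
           (fun v omega => Phi v omega a b) (fun omega => J k omega a b)) /\
        {ae P, forall omega, Phi t omega =
           1%:M + mxint t (fun v => A *m Phi v omega)
           + \sum_k N k *m J k omega}].

(* Main.v *)
(* By the Ito isometry, E[Phi_t K Phi_t^T] satisfies the integrated Lyapunov
   equation, hence Z_i(t) = E[Phi_t K_i Phi_t^T] with K_i = H M_i H^T and M_i the
   sum of the Kronecker products.  Testing against vectors,
   |y^T Z_i(t) x| <= E||Phi_t H||^2 ||M_i|| |y| |x|.  Since the operator norm is
   submultiplicative for the Kronecker product, G_i = ||int Z_i|| obeys
   G_i <= f (G_1 G_(i-1) + ... + G_(i-1) G_1) with f = int E||Phi_t H||^2 dt, and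
   G_1 <= int ||Z_1||.  When 4 f G_1 <= 1, the partial sums of the G_i stay below
   2 G_1, so the series converges absolutely.  On the infinite horizon the
   spectral condition makes every Z_i decay and the Kronecker matrix K
   invertible, so that int_0^t Z_i, which K maps to Z_i(t) - Z_i(0), converges. *)
Require Import Defs.
From mathcomp Require Import ring lra.
Set Implicit Arguments.
Unset Strict Implicit.
Unset Printing Implicit Defensive.
Local Open Scope classical_set_scope.
Local Open Scope ring_scope.

(** * Square-integrable functions *)

(** The Ito integral is given only as an L^2 limit of elementary sums, and the linear equation holds
    almost surely at each fixed time, so neither path regularity nor an Ito formula is at hand. The
    Lyapunov equation is therefore derived inside L^2, from inner products of the entries of [Phi]
    at fixed times, martingale identities tested against past variables, and Fubini's theorem.
    Conditional expectation is replaced by one principle: if [Z] integrates to 0 on every event [xi]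
    in [B], then [Z] is orthogonal to [xi]. What results is an integral equation whose integrand is
    merely integrable; continuity and then differentiability are recovered by bootstrapping, and
    uniqueness for linear equations identifies the given solutions with the covariances.

    Measurability of E||Phi_t H||^2 in t is not established, and its integral over the half-line may
    be infinite. The bounds are therefore carried in the extended reals, with a monotonicity of the
    integral valid for arbitrary nonnegative functions, and products of 0 with an infinite integral
    are treated separately. *)

Section square_integrable.
Context (R : realType) (d : measure_display) (T : measurableType d).
Variable mu : {measure set T -> \bar R}.
Implicit Types f g h : T -> R.

Definition sqint f : Prop :=
  measurable_fun setT f /\ mu.-integrable setT (fun x => (f x ^+ 2)%:E).

Definition ip f g : R := Rintegral mu setT (fun x => f x * g x).

Lemma integrable_le_abs f g : measurable_fun setT f ->
  mu.-integrable setT (EFin \o g) -> (forall x, `|f x| <= g x) ->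
  mu.-integrable setT (EFin \o f).
Proof.
move=> mf ig fg; apply: (le_integrable measurableT _ _ ig).
  exact/measurable_EFinP.
move=> x _ /=; rewrite lee_fin; apply: (le_trans (fg x)).
by rewrite ler_norm.
Qed.

Lemma sqint_int f g : sqint f -> sqint g ->
  mu.-integrable setT (EFin \o (fun x => f x * g x)).
Proof.
move=> [mf if2] [mg ig2].
apply: (@integrable_le_abs _ (fun x => f x ^+ 2 + g x ^+ 2)).
- exact: measurable_funM.
- by have := integrableD measurableT if2 ig2.
- move=> x; rewrite normrM; rewrite -(real_normK (num_real (f x))).
  rewrite -(real_normK (num_real (g x))).
  move: `|f x| `|g x| (normr_ge0 (f x)) (normr_ge0 (g x)) => a b a0 b0.
  nra.
Qed.

Lemma sqintP f : measurable_fun setT f ->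
  (\int[mu]_x (f x ^+ 2)%:E < +oo)%E -> sqint f.
Proof.
move=> mf foo; split=> //; apply/integrableP; split.
  by apply/measurable_EFinP; exact: measurable_funX.
apply: le_lt_trans foo; apply: ge0_le_integral => //.
- by apply: measurableT_comp => //; apply/measurable_EFinP; exact: measurable_funX.
- by apply/measurable_EFinP; exact: measurable_funX.
- by move=> x _ /=; rewrite lee_fin ger0_norm ?sqr_ge0.
Qed.

Lemma sqint_le f g : measurable_fun setT f -> sqint g ->
  (forall x, `|f x| <= `|g x|) -> sqint f.
Proof.
move=> mf [mg ig] fg; split=> //.
apply: (@integrable_le_abs (fun x => f x ^+ 2) (fun x => g x ^+ 2)) => //.
  exact: measurable_funX.
move=> x; rewrite ger0_norm ?sqr_ge0// -[leLHS]real_normK ?num_real//.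
by rewrite -[leRHS]real_normK ?num_real// lerXn2r ?nnegrE.
Qed.

Lemma sqintD f g : sqint f -> sqint g -> sqint (fun x => f x + g x).
Proof.
move=> sf sg; have ifg := sqint_int sf sg.
case: sf sg => mf if2 [mg ig2]; split; first exact: measurable_funD.
rewrite (_ : (fun x => _) = ((fun x => (f x ^+ 2)%:E) \+
    ((fun x => 2%:E * (f x * g x)%:E) \+ (fun x => (g x ^+ 2)%:E)))%E).
  by apply: integrableD => //; apply: integrableD => //; apply: integrableZl.
by apply/funext => x /=; rewrite -EFinM -!EFinD; congr EFin; ring.
Qed.

Lemma sqintZ c f : sqint f -> sqint (fun x => c * f x).
Proof.
move=> [mf if2]; split; first exact: measurable_funM.
have := integrableZl measurableT (c ^+ 2) if2.
by apply: eq_integrable => // x _; rewrite exprMn EFinM.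
Qed.

Lemma sqintN f : sqint f -> sqint (fun x => - f x).
Proof.
move=> /(sqintZ (-1)); congr sqint; apply/funext => x; by rewrite mulN1r.
Qed.

Lemma sqintB f g : sqint f -> sqint g -> sqint (fun x => f x - g x).
Proof. by move=> sf /sqintN; exact: sqintD. Qed.

Lemma sqint0 : sqint (fun=> 0).
Proof.
split; first exact: measurable_cst.
rewrite (_ : (fun _ => _) = cst 0%E) ?integrable0//.
by apply/funext => x; rewrite expr0n.
Qed.

Lemma sqint_sum (I : Type) (s : seq I) (F : I -> T -> R) :
  (forall i, sqint (F i)) -> sqint (fun x => \sum_(i <- s) F i x).
Proof.
move=> sF; elim: s => [|i s ih].
  rewrite (_ : (fun _ => _) = fun=> 0); first exact: sqint0.
  by apply/funext => x; rewrite big_nil.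
rewrite (_ : (fun _ => _) = fun x => F i x + \sum_(i <- s) F i x).
  exact: sqintD.
by apply/funext => x; rewrite big_cons.
Qed.

Lemma ipC f g : ip f g = ip g f.
Proof. by apply: eq_Rintegral => x _; rewrite mulrC. Qed.

Lemma ipDl f g h : sqint f -> sqint g -> sqint h ->
  ip (fun x => f x + g x) h = ip f h + ip g h.
Proof.
move=> sf sg sh; rewrite /ip -RintegralD//; last 2 first.
- exact: sqint_int.
- exact: sqint_int.
by apply: eq_Rintegral => x _; rewrite mulrDl.
Qed.

Lemma ipZl c f h : sqint f -> sqint h -> ip (fun x => c * f x) h = c * ip f h.
Proof.
move=> sf sh; rewrite /ip -RintegralZl//; last exact: sqint_int.
by apply: eq_Rintegral => x _; rewrite mulrA.
Qed.

Lemma ipBl f g h : sqint f -> sqint g -> sqint h ->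
  ip (fun x => f x - g x) h = ip f h - ip g h.
Proof.
move=> sf sg sh; rewrite /ip -RintegralB//; last 2 first.
- exact: sqint_int.
- exact: sqint_int.
by apply: eq_Rintegral => x _; rewrite mulrBl.
Qed.

Lemma ip0l h : ip (fun=> 0) h = 0.
Proof.
rewrite /ip /Rintegral integral0_eq// => x _; by rewrite mul0r.
Qed.

Lemma ip_suml (I : Type) (s : seq I) (F : I -> T -> R) h :
  (forall i, sqint (F i)) -> sqint h ->
  ip (fun x => \sum_(i <- s) F i x) h = \sum_(i <- s) ip (F i) h.
Proof.
move=> sF sh; elim: s => [|i s ih].
  rewrite big_nil -[RHS](ip0l h); congr ip; apply/funext => x.
  by rewrite big_nil.
rewrite big_cons -ih -ipDl//; last exact: sqint_sum.
by congr ip; apply/funext => x; rewrite big_cons.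
Qed.

Lemma ipDr f g h : sqint f -> sqint g -> sqint h ->
  ip h (fun x => f x + g x) = ip h f + ip h g.
Proof. by move=> *; rewrite ipC ipDl// ![ip _ h]ipC. Qed.

Lemma ipBr f g h : sqint f -> sqint g -> sqint h ->
  ip h (fun x => f x - g x) = ip h f - ip h g.
Proof. by move=> *; rewrite ipC ipBl// ![ip _ h]ipC. Qed.

Lemma ipZr c f h : sqint f -> sqint h -> ip h (fun x => c * f x) = c * ip h f.
Proof. by move=> *; rewrite ipC ipZl// ipC. Qed.

Lemma ip_sumr (I : Type) (s : seq I) (F : I -> T -> R) h :
  (forall i, sqint (F i)) -> sqint h ->
  ip h (fun x => \sum_(i <- s) F i x) = \sum_(i <- s) ip h (F i).
Proof.
by move=> sF sh; rewrite ipC ip_suml//; apply: eq_bigr => i _; rewrite ipC.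
Qed.

Lemma ip_ge0 f : 0 <= ip f f.
Proof. by apply: Rintegral_ge0 => x _; rewrite -expr2 sqr_ge0. Qed.

Lemma ip_sqrE f : sqint f -> (ip f f)%:E = (\int[mu]_x (f x ^+ 2)%:E)%E.
Proof.
move=> [_ if2]; rewrite /ip /Rintegral.
under eq_integral do rewrite -expr2.
by rewrite fineK//; exact: integrable_fin_num.
Qed.

Lemma ip_cauchy_schwarz f g : sqint f -> sqint g ->
  ip f g ^+ 2 <= ip f f * ip g g.
Proof.
move=> sf sg; set p := ip f g; set F := ip f f; set G := ip g g.
have pos c : 0 <= F + c * p *+ 2 + c ^+ 2 * G.
  have sh := sqintD sf (sqintZ c sg).
  have := ip_ge0 (fun x => f x + c * g x).
  rewrite ipDl ?ipDr ?ipZl ?ipZr//; try exact: sqintZ.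
  rewrite (ipC g f) -/p -/F -/G => h; apply: (le_trans h); rewrite le_eqVlt; apply/orP; left.
  by rewrite mulr2n; apply/eqP; ring.
have F0 : 0 <= F := ip_ge0 f.
have G0 : 0 <= G := ip_ge0 g.
move: G0; rewrite le_eqVlt => /predU1P[G0|G0].
  have [->|p0] := eqVneq p 0; first by rewrite expr0n -G0 mulr0.
  (* If [G] is 0 the quadratic is affine in [c]; this [c] gives it the negative value [- F - 2]. *)
  have := pos (- (F + 1) / p); rewrite -G0 mulr0 addr0 divfK// mulr2n; lra.
(* The minimiser of the quadratic, with value [F - p ^+ 2 / G]. *)
have := pos (- p / G).
rewrite -(ler_pM2r G0) mul0r -subr_ge0 => h; rewrite -subr_ge0.
apply: le_trans h _; rewrite le_eqVlt; apply/orP; left; apply/eqP.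
by rewrite mulr2n subr0; field; rewrite gt_eqF.
Qed.

Definition cvgsq (f_ : nat -> T -> R) f : Prop :=
  ((\int[mu]_x ((f_ l x - f x) ^+ 2)%:E) @[l --> \oo] --> 0)%E.

(** Some [f_ l] lies at finite distance from [f], and then [f = f_ l - (f_ l - f)] is a difference
    of square-integrable functions. This supplies the square integrability of an Ito integral, whose
    definition asks only for measurability and convergence. *)
Lemma cvgsq_sqint (f_ : nat -> T -> R) f : measurable_fun setT f ->
  (forall l, sqint (f_ l)) -> cvgsq f_ f -> sqint f.
Proof.
move=> mf sf cf.
have [l lfoo] : exists l, (\int[mu]_x ((f_ l x - f x) ^+ 2)%:E < 1)%E.
  have /= : \forall l \near \oo, (\int[mu]_x ((f_ l x - f x) ^+ 2)%:E < 1)%E.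
    have : \forall y \near (0 : \bar R)%E, (y < 1)%E.
      exact: (@nbhs_open_ereal_lt _ _ (fun=> 1)).
    by move/cf.
  by case=> N _ /(_ N (leqnn N)) ?; exists N.
have sd : sqint (fun x => f_ l x - f x).
  apply: sqintP; last exact: lt_trans lfoo (ltry _).
  by apply: measurable_funB => //; exact: (sf l).1.
rewrite (_ : f = fun x => f_ l x - (f_ l x - f x)); first exact: sqintB.
by apply/funext => x; rewrite subKr.
Qed.

Lemma cvgsqP (f_ : nat -> T -> R) f : (forall l, sqint (f_ l)) -> sqint f ->
  cvgsq f_ f <->
  ip (fun x => f_ l x - f x) (fun x => f_ l x - f x) @[l --> \oo] --> 0.
Proof.
move=> sf_ sf; rewrite /cvgsq.
rewrite [X in X @ _](_ : _ = EFin \o (fun l =>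
    ip (fun x => f_ l x - f x) (fun x => f_ l x - f x))); last first.
  by apply/funext => l /=; rewrite ip_sqrE//; exact: sqintB.
split; first by move/fine_cvgP => [].
by move=> c; apply/fine_cvgP; split => //; exact: nearW.
Qed.

Lemma ip_cvg0 f (h_ : nat -> T -> R) : sqint f -> (forall l, sqint (h_ l)) ->
  ip (h_ l) (h_ l) @[l --> \oo] --> 0 -> ip f (h_ l) @[l --> \oo] --> 0.
Proof.
move=> sf sh ch; apply/norm_cvg0P.
have : Num.sqrt (ip f f * ip (h_ l) (h_ l)) @[l --> \oo] --> 0.
  rewrite -(@sqrtr0 R); apply: (continuous_cvg _ (@sqrt_continuous R _)).
  by rewrite -(mulr0 (ip f f)); exact: cvgMr.
apply: squeeze_cvgr; last exact: cvg_cst.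
apply: nearW => l; rewrite normr_ge0/= -sqrtr_sqr ler_wsqrtr//.
exact: ip_cauchy_schwarz.
Qed.

Lemma ip_cvgr (f_ : nat -> T -> R) f h :
  (forall l, sqint (f_ l)) -> sqint f -> sqint h -> cvgsq f_ f ->
  ip h (f_ l) @[l --> \oo] --> ip h f.
Proof.
move=> sf_ sf sh /(cvgsqP sf_ sf) cf; apply/subr_cvg0.
under eq_fun do rewrite -ipBr//.
by apply: ip_cvg0 cf => // l; exact: sqintB.
Qed.

Lemma ip_cvg (f_ g_ : nat -> T -> R) f g :
  (forall l, sqint (f_ l)) -> (forall l, sqint (g_ l)) ->
  sqint f -> sqint g -> cvgsq f_ f -> cvgsq g_ g ->
  ip (f_ l) (g_ l) @[l --> \oo] --> ip f g.
Proof.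
move=> sf_ sg_ sf sg cf cg.
have /(cvgsqP sf_ sf) cf' := cf; have /(cvgsqP sg_ sg) cg' := cg.
have sdf l : sqint (fun x => f_ l x - f x) by exact: sqintB.
have sdg l : sqint (fun x => g_ l x - g x) by exact: sqintB.
(* Expansion around the limits: the first two terms converge with one argument fixed, and the last
   is a product of two errors, which vanishes by Cauchy-Schwarz. *)
rewrite (_ : (fun l => _) = fun l => ip g (f_ l) + ip f (g_ l) - ip f g +
    ip (fun x => f_ l x - f x) (fun x => g_ l x - g x)); last first.
  apply/funext => l; rewrite [in RHS]ipBl// !ipBr// (ipC g) ; ring.
rewrite -[X in _ --> X](addr0 (ip f g)); apply: cvgD.
  rewrite [X in _ --> X](_ : ip f g = ip g f + ip f g - ip f g); last first.
    by rewrite addrK ipC.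
  apply: cvgB; last exact: cvg_cst.
  by apply: cvgD; exact: ip_cvgr.
apply/norm_cvg0P.
have : Num.sqrt (ip (fun x => f_ l x - f x) (fun x => f_ l x - f x) *
   ip (fun x => g_ l x - g x) (fun x => g_ l x - g x)) @[l --> \oo] --> 0.
  rewrite -(@sqrtr0 R); apply: (continuous_cvg _ (@sqrt_continuous R _)).
  by rewrite -(mulr0 0); exact: cvgM.
apply: squeeze_cvgr; last exact: cvg_cst.
apply: nearW => l; rewrite normr_ge0/= -sqrtr_sqr ler_wsqrtr//.
exact: ip_cauchy_schwarz.
Qed.

Lemma ae_eq_ip f f' g : measurable_fun setT f -> measurable_fun setT f' ->
  measurable_fun setT g ->
  {ae mu, forall x, f x = f' x} -> ip f g = ip f' g.
Proof.
move=> mf mf' mg ff'; rewrite /ip /Rintegral; congr fine.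
apply: ae_eq_integral => //.
- by apply/measurable_EFinP; exact: measurable_funM.
- by apply/measurable_EFinP; exact: measurable_funM.
- by apply: filterS ff' => x /= -> _.
Qed.

Lemma ae_eq_sqint f f' : measurable_fun setT f' ->
  {ae mu, forall x, f x = f' x} -> sqint f -> sqint f'.
Proof.
move=> mf' ff' [mf if2]; split=> //.
have mf2 : measurable_fun setT (fun x => (f x ^+ 2)%:E).
  by apply/measurable_EFinP; exact: measurable_funX.
have mf'2 : measurable_fun setT (fun x => (f' x ^+ 2)%:E).
  by apply/measurable_EFinP; exact: measurable_funX.
apply/integrableP; split => //.
have /integrableP[_] := if2; congr (_ < _)%E; apply: ae_eq_integral => //.
- exact: measurableT_comp.
- exact: measurableT_comp.
- by apply: filterS ff' => x /= -> _.
Qed.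

End square_integrable.

(* Monotonicity of the integral needs no measurability, because the integral
   of a nonnegative function is a supremum over simple functions below it. *)
Lemma ge0_le_integral_any (R : realType) (d : measure_display)
    (T : measurableType d) (mu : {measure set T -> \bar R}) (D : set T)
    (f g : T -> \bar R) :
  (forall x, D x -> 0 <= f x)%E -> (forall x, D x -> f x <= g x)%E ->
  (\int[mu]_(x in D) f x <= \int[mu]_(x in D) g x)%E.
Proof.
move=> f0 fg; have g0 x : D x -> (0 <= g x)%E.
  by move=> Dx; exact: le_trans (f0 _ Dx) (fg _ Dx).
rewrite !ge0_integralE//; apply: ge_ereal_sup => _ [h/= hf <-].
apply: ereal_sup_ubound; exists h => // x.
apply: (le_trans (hf x)); rewrite !patchE.
by case: ifPn => //; rewrite inE => Dx; exact: fg.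
Qed.

(** * Moments of the normal distribution *)

Section density.
Import HBNNSimple.
Local Open Scope ereal_scope.

(** For indicators this is the hypothesis on [nu]; simple functions follow by linearity, and the
    general case by monotone convergence on both sides. *)
Lemma ge0_integral_density (R : realType) (d : measure_display)
    (T : measurableType d) (mu nu : {measure set T -> \bar R}) (p : T -> R)
    (f : T -> \bar R) :
  measurable_fun setT p -> (forall x, (0 <= p x)%R) ->
  (forall A, measurable A -> nu A = \int[mu]_(x in A) (p x)%:E) ->
  measurable_fun setT f -> (forall x, 0 <= f x) ->
  \int[nu]_x f x = \int[mu]_x (f x * (p x)%:E).
Proof.
move=> mp p0 nuE mf f0.
pose f_ := nnsfun_approx measurableT mf.
have f_cvg x : (f_ n x)%:E @[n --> \oo] --> f x.
  by apply: cvg_nnsfun_approx.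
have mf_ n : measurable_fun setT (EFin \o f_ n).
  by apply/measurable_EFinP; exact: measurable_funP.
transitivity (limn (fun n => \int[nu]_x (f_ n x)%:E)).
  rewrite -monotone_convergence//.
  - by apply: eq_integral => x _; apply/esym/cvg_lim => //; exact: f_cvg.
  - by move=> n x _; rewrite lee_fin.
  - by move=> x _ m n mn; rewrite lee_fin; exact/lefP/nd_nnsfun_approx.
transitivity (limn (fun n => \int[mu]_x ((f_ n x)%:E * (p x)%:E))); last first.
  rewrite -monotone_convergence//.
  - apply: eq_integral => x _; apply: cvg_lim => //.
    by apply: cvgeZr => //; exact: f_cvg.
  - by move=> n; apply: emeasurable_funM => //; exact/measurable_EFinP.
  - by move=> n x _; rewrite mule_ge0// lee_fin.
  - move=> x _ m n mn; rewrite lee_wpmul2r ?lee_fin//.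
    exact/lefP/nd_nnsfun_approx.
congr (limn _); apply/funext => n.
rewrite integralT_nnsfun sintegralE.
transitivity (\int[mu]_x \sum_(y \in range (f_ n))
   (y%:E * (\1_(f_ n @^-1` [set y]) x)%:E * (p x)%:E)); last first.
  apply: eq_integral => x _; rewrite [in RHS]fimfunE -fsumEFin//.
  rewrite ge0_mule_fsuml// => y; rewrite EFinM.
  exact: nnfun_muleindic_ge0.
rewrite ge0_integral_fsum//; last 2 first.
- move=> y; apply: emeasurable_funM; last exact/measurable_EFinP.
  by apply/measurable_EFinP/measurable_funM => //; exact: measurable_indic.
- by move=> y x _; rewrite mule_ge0 ?lee_fin//; exact: nnfun_muleindic_ge0.
apply: eq_fsbigr => y /[!inE] -[x _ yE].
have y0 : (0 <= y)%R by rewrite -yE.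
rewrite nuE// [in LHS]integral_mkcond.
under [in RHS]eq_integral do rewrite -muleA.
rewrite ge0_integralZl//.
- congr (_ * _); apply: eq_integral => z _; rewrite patchE indicE.
  by case: ifPn => _; rewrite ?mul1e ?mul0e.
- apply: emeasurable_funM; last exact/measurable_EFinP.
  by apply/measurable_EFinP; exact: measurable_indic.
- by move=> z _; rewrite mule_ge0// lee_fin.
Qed.
End density.

Section normal_moments.
Context (R : realType) (s : R).
Hypothesis s0 : 0 < s.
Local Notation mu := (@lebesgue_measure R).
Local Notation p := (normal_pdf 0 s).

Let s_neq0 : s != 0. Proof. exact: lt0r_neq0. Qed.

Let pE x : p x = normal_peak s * expR (- x ^+ 2 / (s ^+ 2 *+ 2)).
Proof. by rewrite normal_pdfE// /normal_fun subr0. Qed.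

Let pN x : p (- x) = p x.
Proof. by rewrite !pE sqrrN. Qed.

Let p_ge0 x : 0 <= p x. Proof. exact: normal_pdf_ge0. Qed.

Let cp : continuous p. Proof. exact: continuous_normal_pdf. Qed.

Let mp : measurable_fun setT p. Proof. exact: measurable_normal_pdf. Qed.

Let dp (x : R) : is_derive x 1 p (- (x / s ^+ 2) * p x).
Proof.
rewrite (_ : p = fun x => normal_peak s * expR (- x ^+ 2 / (s ^+ 2 *+ 2))).
  have sq : is_derive x 1 (fun y : R => y ^+ 2) (x *+ 2).
    apply: (is_derive_eq (is_deriveX 2 (is_derive_id x (1 : R)))).
    by rewrite /GRing.scale/= expr1 mulr1 mulr_natl.
  have q : is_derive x 1 (fun y : R => - y ^+ 2 / (s ^+ 2 *+ 2)) (- (x / s ^+ 2)).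
    rewrite (_ : (fun _ => _) = - (s ^+ 2 *+ 2)^-1 \*: (fun y : R => y ^+ 2)).
      apply: (is_derive_eq (is_deriveZ _ sq)).
      rewrite /GRing.scale/= !mulr2n; field.
      by rewrite s_neq0 -mulr2n mulrn_eq0 expf_eq0 (negbTE s_neq0).
    by apply/funext => y /=; rewrite /GRing.scale/=; ring.
  apply: (is_derive_eq (is_deriveZ (normal_peak s) (is_derive1_comp (is_derive_expR _) q))).
  by rewrite /GRing.scale/=; ring.
by apply/funext => y; exact: pE.
Qed.

Let dxp (x : R) : is_derive x 1 (fun x => x * p x) ((1 - x ^+ 2 / s ^+ 2) * p x).
Proof.
apply: (is_derive_eq (is_deriveM (is_derive_id x (1 : R)) (dp x))).
by rewrite /GRing.scale/=; field.
Qed.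

(** From [1 + u <= expR u] with u = x^2 / (2 s^2), the density is at most its peak times 2 s^2 /
    x^2, so [x * p x] is O(1 / x). *)
Let xp_cvg : x * p x @[x --> +oo] --> 0.
Proof.
have bd : \forall x \near +oo, 0 <= x * p x <= normal_peak s * (s ^+ 2 *+ 2) * x^-1.
  near=> x.
  have x0 : 0 < x by near: x; exact: nbhs_pinfty_gt.
  rewrite mulr_ge0 ?(ltW x0)//= pE.
  have c0 : 0 < s ^+ 2 *+ 2 by rewrite pmulrn_lgt0// exprn_gt0.
  rewrite mulrCA -mulrA ler_wpM2l ?normal_peak_ge0//.
  rewrite mulNr expRN ler_pdivlMr// mulrAC ler_pdivrMr ?expR_gt0//.
  have := expR_ge1Dx (x ^+ 2 / (s ^+ 2 *+ 2)).
  rewrite -(ler_pM2l c0) mulrDr mulr1 [_ * (_ / _)]mulrC divfK ?gt_eqF// -expr2.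
  by apply: le_trans; rewrite lerDr ltW.
have xV : (x : R)^-1 @[x --> +oo] --> 0.
  apply/gtr0_cvgV0; last exact: cvg_id.
  by exists 0; split => //.
have ub : normal_peak s * (s ^+ 2 *+ 2) * x^-1 @[x --> +oo] --> 0.
  by rewrite -(mulr0 (normal_peak s * (s ^+ 2 *+ 2))); exact: cvgMr.
by apply: (squeeze_cvgr bd _ ub); exact: cvg_cst.
Unshelve. all: by end_near. Qed.

Let near_ip : (\int[mu]_(x in `[0%R, s]) ((1 - x ^+ 2 / s ^+ 2) * p x)%:E =
  (s * p s)%:E)%E.
Proof.
rewrite (@continuous_FTC2 _ _ (fun x => x * p x)) //.
- by rewrite mul0r sube0.
- apply: continuous_subspaceT => x; apply: cvgM; last exact: cp.
  apply: cvgB; first exact: cvg_cst.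
  by apply: cvgMl; exact: exprn_continuous.
- split.
  + by move=> x _; have [] := dxp x.
  + apply: cvg_at_right_filter; apply: cvgM; [exact: cvg_id|exact: cp].
  + apply: cvg_at_left_filter; apply: cvgM; [exact: cvg_id|exact: cp].
- by move=> x _; rewrite derive1E; have [] := dxp x.
Qed.

Let far_ip : (\int[mu]_(x in `[s, +oo[) ((x ^+ 2 / s ^+ 2 - 1) * p x)%:E =
  (s * p s)%:E)%E.
Proof.
rewrite (@ge0_continuous_FTC2y _ _ (fun x => - (x * p x)) s 0) //.
- by rewrite EFinN sub0e oppeK.
- move=> x sx; rewrite mulr_ge0// subr_ge0 ler_pdivlMr ?exprn_gt0// mul1r.
  by rewrite lerXn2r ?nnegrE ?(ltW s0)// (le_trans (ltW s0)).
- apply: continuous_subspaceT => x; apply: cvgM; last exact: cp.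
  apply: cvgB; last exact: cvg_cst.
  by apply: cvgMl; exact: exprn_continuous.
- by have H := cvgN xp_cvg; have := H _; rewrite oppr0; exact.
- by move=> x _; apply: derivableN; have [] := dxp x.
- apply: cvg_at_right_filter; apply: cvgN; apply: cvgM; [exact: cvg_id|exact: cp].
- move=> x _; rewrite derive1E deriveN; last by have [] := dxp x.
  have [_ ->] := dxp x; ring.
Qed.

Let mpoly_p (f : R -> R) : continuous f -> measurable_fun setT (fun x => f x * p x).
Proof. by move=> cf; apply: measurable_funM => //; exact: continuous_measurable_fun. Qed.

Let m1 (A : set R) : measurable_fun A (fun x => ((x ^+ 2 / s ^+ 2) * p x)%:E).
Proof.
apply/measurable_EFinP; apply: measurable_funTS; apply: mpoly_p => x.
by apply: cvgMl; exact: exprn_continuous.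
Qed.

Let m2 (A : set R) : measurable_fun A (fun x => (p x)%:E).
Proof. exact/measurable_EFinP/measurable_funTS. Qed.

(** The function [x * p x] vanishes at 0 and at infinity and has derivative (1 - x^2 / s^2) p(x), so
    x^2 / s^2 and 1 have the same integral against [p]. The derivative changes sign at [s]; the
    half-line is cut there so that each integrand has a constant sign, and the two boundary terms
    [s * p s] balance. *)
Lemma normal_pdf_second_moment :
  (\int[mu]_x ((x ^+ 2 * p x)%:E) = (s ^+ 2)%:E)%E.
Proof.
have s20 : 0 < s ^+ 2 by rewrite exprn_gt0.
suff H : (\int[mu]_x ((x ^+ 2 / s ^+ 2 * p x)%:E) = 1)%E.
  under eq_integral => x _.
    rewrite (_ : x ^+ 2 * p x = s ^+ 2 * (x ^+ 2 / s ^+ 2 * p x)); last first.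
      by field.
    rewrite EFinM; over.
  rewrite ge0_integralZl//= ?H ?mule1//.
  - exact: m1.
  - by move=> x _; rewrite lee_fin mulr_ge0// mulr_ge0 ?sqr_ge0// invr_ge0 sqr_ge0.
  - by rewrite lee_fin ltW.
rewrite -(integral_normal_pdf 0 s).
have q0 x : 0 <= x ^+ 2 / s ^+ 2 * p x.
  by rewrite mulr_ge0// mulr_ge0 ?sqr_ge0// invr_ge0 sqr_ge0.
rewrite ge0_symfun_integralT//; last 2 first.
- move=> x; apply: cvgM; last exact: cp.
  by apply: cvgMl; exact: exprn_continuous.
- by move=> x /=; rewrite sqrrN pN.
rewrite [in RHS]ge0_symfun_integralT//; last by move=> x /=; rewrite pN.
congr (_ * _)%E; rewrite -set_itvcy.
rewrite (@itv_bndbnd_setU _ _ _ (BLeft s)) ?bnd_simp ?(ltW s0)//.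
have disj : [disjoint [set` `[0, s[] & [set` `[s, +oo[]].
  by apply: lt_disjoint => x y; rewrite !in_itv/= => /andP[_ xs] /andP[sy _]; exact: lt_le_trans sy.
have mU (A : set R) (f : R -> R) : continuous f ->
    measurable_fun A (fun x => (f x)%:E).
  move=> cf; apply/measurable_EFinP; apply: measurable_funTS.
  exact: continuous_measurable_fun.
have cq : continuous (fun x : R => x ^+ 2 / s ^+ 2 * p x).
  move=> x; apply: cvgM; last exact: cp.
  by apply: cvgMl; exact: exprn_continuous.
rewrite ge0_integral_setU//=; first last.
- by move=> x _; rewrite lee_fin.
- exact: (mU _ _ cq).
rewrite [RHS]ge0_integral_setU//=; first last.
- by move=> x _; rewrite lee_fin.
- exact: (mU _ _ cp).
rewrite integral_itv_bndo_bndc; last exact: m1.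
rewrite [in RHS]integral_itv_bndo_bndc; last exact: m2.
set a := (\int[mu]_(x in `[0%R, s]) (x ^+ 2 / _ * p x)%:E)%E.
set b := (\int[mu]_(x in `[0%R, s]) (p x)%:E)%E.
have ab : (b = (s * p s)%:E + a)%E.
  rewrite -near_ip -ge0_integralD//=.
  - apply: eq_integral => x _; rewrite -EFinD; congr EFin; ring.
  - move=> x; rewrite in_itv/= => /andP[x0 xs]; rewrite lee_fin mulr_ge0//.
    rewrite subr_ge0 ler_pdivrMr ?exprn_gt0// mul1r.
    by rewrite lerXn2r ?nnegrE// ltW.
  - apply/measurable_EFinP; apply: measurable_funTS; apply: mpoly_p => x.
    apply: cvgB; first exact: cvg_cst.
    by apply: cvgMl; exact: exprn_continuous.
  - by move=> x _; rewrite lee_fin.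
  - exact: m1.
rewrite ab [LHS]addeC [RHS]addeAC; congr (_ + _)%E.
rewrite -far_ip -ge0_integralD//=.
- by apply: eq_integral => x _; rewrite -EFinD; congr EFin; ring.
- move=> x; rewrite in_itv/= andbT => sx; rewrite lee_fin mulr_ge0//.
  rewrite subr_ge0 ler_pdivlMr ?exprn_gt0// mul1r.
  by rewrite lerXn2r ?nnegrE// ?(le_trans (ltW s0))// ltW.
- apply/measurable_EFinP; apply: measurable_funTS; apply: mpoly_p => x.
  apply: cvgB; last exact: cvg_cst.
  by apply: cvgMl; exact: exprn_continuous.
- by move=> x _; rewrite lee_fin.
- exact: m2.
Qed.

Lemma normal_prob_second_moment :
  (\int[normal_prob 0 s]_x (x ^+ 2)%:E = (s ^+ 2)%:E)%E.
Proof.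
rewrite (@ge0_integral_density _ _ _ mu _ p)//.
- by rewrite -normal_pdf_second_moment; apply: eq_integral => x _; rewrite EFinM.
- by apply/measurable_EFinP; exact: measurable_funX.
- by move=> x; rewrite lee_fin sqr_ge0.
Qed.

(** Applied to a positive part, this shows that both halves of the law have the same first moment,
    which is how increments are seen to be centred. *)
Lemma normal_prob_symmetric (h : R -> R) : measurable_fun setT h ->
  (forall x, 0 <= h x) ->
  (\int[normal_prob 0 s]_x (h (- x))%:E = \int[normal_prob 0 s]_x (h x)%:E)%E.
Proof.
move=> mh h0.
have mhN : measurable_fun setT (fun x : R => h (- x)) by exact: measurableT_comp.
rewrite (@ge0_integral_density _ _ _ mu _ p)//; first last.
- by move=> x; rewrite lee_fin.
- exact/measurable_EFinP.
rewrite [RHS](@ge0_integral_density _ _ _ mu _ p)//; last exact/measurable_EFinP.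
transitivity (\int[mu]_(x in (-%R : _ -> measurableTypeR R) @^-1` setT)
   (((fun x => (h x * p x)%:E) \o (-%R : _ -> measurableTypeR R)) x))%E.
  by rewrite preimage_setT; apply: eq_integral => x _ /=; rewrite pN EFinM.
rewrite -ge0_integral_pushforward//=; last 2 first.
- by apply/measurable_EFinP; exact: measurable_funM.
- by move=> x _; rewrite lee_fin mulr_ge0.
transitivity (\int[mu]_x (h x * p x)%:E)%E.
  by apply: eq_measure_integral => //= A mA AS; exact/lebesgue_measureN.
by apply: eq_integral => x _; rewrite EFinM.
Qed.

End normal_moments.

(** * Increments of a Wiener process *)

Section integral_transport.
Context (R : realType) (d : measure_display) (T : measurableType d).
Variable mu : {measure set T -> \bar R}.
Local Open Scope ereal_scope.

Lemma ge0_integral_mrestr (E : set T) (mE : measurable E) (f : T -> \bar R) :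
  measurable_fun setT f -> (forall x, 0 <= f x) ->
  \int[mrestr mu mE]_x f x = \int[mu]_(x in E) f x.
Proof.
move=> mf f0.
rewrite (@ge0_integral_density _ _ _ mu _ (\1_E))//.
- rewrite [in RHS]integral_mkcond; apply: eq_integral => x _.
  by rewrite patchE indicE; case: ifPn => _; rewrite ?mule1 ?mule0.
- by move=> A mA; rewrite integral_indic// /mrestr setIC.
Qed.

(** Under [mu] restricted to [E], the law of [X] has the constant density [mu E] with respect to
    [N]; finiteness of [mu E] makes this density a real number. *)
Lemma ge0_integral_indep (d' : measure_display) (Y : measurableType d')
    (E : set T) (X : T -> Y) (N : {measure set Y -> \bar R}) (h : Y -> R) :
  measurable E -> measurable_fun setT X -> mu E < +oo ->
  (forall C, measurable C -> mu (E `&` X @^-1` C) = mu E * N C) ->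
  measurable_fun setT h -> (forall y, (0 <= h y)%R) ->
  \int[mu]_(x in E) (h (X x))%:E = mu E * \int[N]_y (h y)%:E.
Proof.
move=> mE mX Efin muE mh h0.
have mhX : measurable_fun setT (fun x => (h (X x))%:E).
  by apply/measurable_EFinP; exact: measurableT_comp.
have c0 : (0 <= fine (mu E))%R by apply: fine_ge0.
rewrite -(ge0_integral_mrestr mE)//; last by move=> x; rewrite lee_fin.
have <- : \int[pushforward (mrestr mu mE) X]_y (h y)%:E =
    \int[mrestr mu mE]_x (h (X x))%:E.
  rewrite (@ge0_integral_pushforward _ _ _ _ _ X mX)//.
  - exact/measurable_EFinP.
  - by move=> x _; rewrite lee_fin.
rewrite [LHS](@ge0_integral_density _ _ _ N _ (cst (fine (mu E))))//=.
- rewrite ge0_integralZr//.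
  + by rewrite muleC fineK// ge0_fin_numE.
  + exact/measurable_EFinP.
  + by move=> x _; rewrite lee_fin.
- move=> A mA; rewrite integral_cst// /pushforward /mrestr setIC muE//.
  by rewrite fineK// ge0_fin_numE.
- exact/measurable_EFinP.
Qed.

End integral_transport.

(** * Orthogonality from vanishing integrals on events *)

Section orthogonality.
Context (R : realType) (d : measure_display) (T : measurableType d).
Variable mu : {measure set T -> \bar R}.
Import HBNNSimple.

(** The approximating simple functions live on the line and are composed with [xi], so their level
    sets are events [xi] in [B], on which [Z] integrates to 0. Dominated convergence passes to the
    limit. *)
Let ge0_ip_comp_eq0 (h : R -> R) (xi Z : T -> R) :
  measurable_fun setT h -> (forall y, 0 <= h y) ->
  measurable_fun setT xi -> mu.-integrable setT (EFin \o Z) ->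
  mu.-integrable setT (fun x => (h (xi x) * Z x)%:E) ->
  (forall B, measurable B -> (\int[mu]_(x in xi @^-1` B) (Z x)%:E = 0)%E) ->
  (\int[mu]_x (h (xi x) * Z x)%:E = 0)%E.
Proof.
move=> mh h0 mxi iZ ihZ Z0.
have mZ : measurable_fun setT Z by apply/measurable_EFinP; exact: measurable_int iZ.
have mEh : measurable_fun setT (EFin \o h) by exact/measurable_EFinP.
pose g := nnsfun_approx measurableT mEh.
have g_le n y : g n y <= h y.
  have Eh0 : forall x : R, setT x -> (0 <= (EFin \o h) x)%E by move=> x _; rewrite lee_fin.
  by have := le_approx n Eh0 (x := y) I; rewrite -nnsfun_approxE lee_fin.
have mgxi n : measurable_fun setT (fun x => g n (xi x)).
  by apply: measurableT_comp => //; exact: measurable_funP.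
have gZ0 n : (\int[mu]_x (g n (xi x) * Z x)%:E = 0)%E.
  have fr : finite_set (range (g n)) by [].
  rewrite (eq_integral (fun x => \sum_(y <- finmap.enum_fset (fset_set (range (g n))))
      (y%:E * (\1_(xi @^-1` (g n @^-1` [set y])) x * Z x)%:E)%E)); last first.
    move=> x _; rewrite fimfunE fsbig_finite// big_distrl/= -sumEFin.
    by apply: eq_bigr => y _; rewrite -EFinM mulrA.
  have mA y : measurable (xi @^-1` (g n @^-1` [set y])).
    rewrite -[X in measurable X]setTI; apply: mxi => //.
  have i1Z y : mu.-integrable setT
      (fun x => (\1_(xi @^-1` (g n @^-1` [set y])) x * Z x)%:E).
    apply: (@integrable_le_abs _ _ _ _ _ (fun x => `|Z x|)).
    - by apply: measurable_funM => //; exact: measurable_indic.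
    - exact: integrable_norm.
    - move=> x; rewrite normrM ler_piMl// indicE.
      by case: (_ \in _); rewrite ?normr1 ?normr0.
  rewrite integral_sum//; last by move=> y; exact: integrableZl.
  rewrite big1// => y _; rewrite integralZl//.
  rewrite (_ : \int[mu]_x _ = \int[mu]_(x in xi @^-1` (g n @^-1` [set y])) (Z x)%:E)%E.
    by rewrite Z0 ?mule0.
  rewrite [RHS]integral_mkcond; apply: eq_integral => x _.
  by rewrite patchE indicE; case: ifPn => _; rewrite ?mul1r ?mul0r.
have gcvg : {ae mu, forall x, setT x ->
    (fun n => (g n (xi x) * Z x)%:E) @ \oo --> (h (xi x) * Z x)%:E}.
  apply: nearW => x _.
  apply/cvg_EFin; first exact: nearW.
  have gh : (fun n => (g n (xi x))%:E) @ \oo --> (h (xi x))%:E.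
    by apply: (@cvg_nnsfun_approx _ _ _ _ measurableT _ mEh) => // y _; rewrite lee_fin.
  by apply: cvgMl; have [_] := (fine_cvgP _ _).1 gh.
have gle : {ae mu, forall x n, setT x ->
    (`|(g n (xi x) * Z x)%:E| <= `|(h (xi x) * Z x)%:E|)%E}.
  apply: nearW => x n _ /=; rewrite lee_fin !normrM ler_wpM2r//.
  by rewrite !ger0_norm.
have mgZ n : measurable_fun setT (fun x => (g n (xi x) * Z x)%:E).
  by apply/measurable_EFinP; exact: measurable_funM.
have [_ _] := dominated_convergence measurableT mgZ (measurable_int _ ihZ) gcvg
  (integrable_abse ihZ) gle.
rewrite /=; under eq_fun do rewrite gZ0.
by move=> H; apply: (cvg_unique _ H) => //; exact: cvg_cst.
Qed.

(** The last hypothesis says that the conditional expectation of [Z] given [xi] vanishes. Writing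
    the identity of the line as [h1 - h2] reduces [xi] to the nonnegative case. *)
Lemma ip_eq0 (xi Z : T -> R) :
  measurable_fun setT xi -> mu.-integrable setT (EFin \o Z) ->
  mu.-integrable setT (EFin \o (fun x => xi x * Z x)) ->
  (forall B, measurable B -> (\int[mu]_(x in xi @^-1` B) (Z x)%:E = 0)%E) ->
  ip mu xi Z = 0.
Proof.
move=> mxi iZ ixZ Z0; rewrite /ip.
pose h1 (y : R) := Num.max y 0; pose h2 (y : R) := Num.max (- y) 0.
have mh1 : measurable_fun setT h1 by exact: measurable_maxr.
have mh2 : measurable_fun setT h2 by apply: measurable_maxr => //; exact: measurableT_comp.
have mZ : measurable_fun setT Z by apply/measurable_EFinP; exact: measurable_int iZ.
have ih (h : R -> R) : measurable_fun setT h -> (forall y, 0 <= h y <= `|y|) ->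
    mu.-integrable setT (EFin \o (fun x => h (xi x) * Z x)).
  move=> mh hle; apply: (@integrable_le_abs _ _ _ _ _ (fun x => `|xi x * Z x|)).
  - by apply: measurable_funM => //; exact: measurableT_comp.
  - exact: integrable_norm.
  - move=> x; rewrite !normrM ler_wpM2r//.
    by have /andP[h0 hx] := hle (xi x); rewrite ger0_norm.
have h1le y : 0 <= h1 y <= `|y|.
  by rewrite /h1 le_max lexx orbT ge_max normr_ge0 ler_norm.
have h2le y : 0 <= h2 y <= `|y|.
  by rewrite /h2 le_max lexx orbT ge_max normr_ge0 -normrN ler_norm.
rewrite (_ : (fun x => xi x * Z x) =
    (fun x => h1 (xi x) * Z x - h2 (xi x) * Z x)); last first.
  apply/funext => x; rewrite -mulrBl; congr (_ * _); rewrite /h1 /h2.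
  have [x0|x0] := leP 0 (xi x).
    by rewrite max_r ?subr0// oppr_le0.
  by rewrite max_l ?sub0r ?opprK// oppr_ge0 ltW.
rewrite RintegralB//; [|exact: ih|exact: ih].
rewrite /Rintegral !ge0_ip_comp_eq0//; try exact: ih.
- by rewrite subrr.
- by move=> y; have /andP[] := h2le y.
- by move=> y; have /andP[] := h1le y.
Qed.
End orthogonality.

Lemma integrable_bounded_mul (R : realType) (d : measure_display)
    (T : measurableType d) (mu : {measure set T -> \bar R}) (xi Z : T -> R) (M : R) :
  measurable_fun setT xi -> (forall x, `|xi x| <= M) ->
  mu.-integrable setT (EFin \o Z) ->
  mu.-integrable setT (EFin \o (fun x => xi x * Z x)).
Proof.
move=> mxi bxi iZ.
have mZ : measurable_fun setT Z by apply/measurable_EFinP; exact: measurable_int iZ.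
apply: (@integrable_le_abs _ _ _ _ _ (fun x => M * `|Z x|)).
- exact: measurable_funM.
- by have := integrableZl measurableT M (integrable_norm iZ).
- by move=> x; rewrite normrM ler_wpM2r.
Qed.

Section wiener.
Context (R : realType) (d : measure_display) (Omega : measurableType d).
Context (P : probability Omega R) (F : R -> set (set Omega)).
Context (m : nat) (w : 'I_m -> R -> Omega -> R).
Hypotheses (HF : filtration F) (Hw : wiener_process P F w).

Lemma filtration_measurable (t : R) (E : set Omega) :
  0 <= t -> F t E -> measurable E.
Proof. by case: HF => _ + _ => /[apply]; exact. Qed.

Lemma filtration_le (s t : R) : 0 <= s -> s <= t -> F s `<=` F t.
Proof. by case: HF => _ _; exact. Qed.

Lemma measurable_wrt_measurable (t : R) (X : Omega -> R) :
  0 <= t -> measurable_wrt (F t) X -> measurable_fun setT X.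
Proof.
move=> t0 FX _ C mC; rewrite setTI; apply: (filtration_measurable t0).
exact: FX.
Qed.

Lemma measurable_wrt_le (s t : R) (X : Omega -> R) : 0 <= s -> s <= t ->
  measurable_wrt (F s) X -> measurable_wrt (F t) X.
Proof. by move=> s0 st FX C mC; apply: (filtration_le s0 st); exact: FX. Qed.

(** [measurable_wrt] is a bare preimage condition. On the sigma-algebra generated by [F t], which is
    [F t] itself, it becomes measurability proper and inherits the closure under algebraic
    operations. *)
Lemma measurable_wrtP (t : R) (X : Omega -> R) : 0 <= t ->
  measurable_wrt (F t) X <->
  measurable_fun setT (X : g_sigma_algebraType (F t) -> R).
Proof.
move=> t0; have sF : sigma_algebra setT (F t) by case: HF => /(_ _ t0).
split=> [FX _ C mC|FX C mC].
  by rewrite setTI; apply: sub_gen_smallest; exact: FX.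
have := FX measurableT _ mC; rewrite setTI => H.
by rewrite -(sigma_algebra_id sF).
Qed.

Lemma measurable_wrtM (t : R) (X Y : Omega -> R) : 0 <= t ->
  measurable_wrt (F t) X -> measurable_wrt (F t) Y ->
  measurable_wrt (F t) (fun x => X x * Y x).
Proof.
move=> t0 /(measurable_wrtP _ t0) mX /(measurable_wrtP _ t0) mY.
by apply/(measurable_wrtP _ t0); exact: measurable_funM.
Qed.

Lemma measurable_wrtB (t : R) (X Y : Omega -> R) : 0 <= t ->
  measurable_wrt (F t) X -> measurable_wrt (F t) Y ->
  measurable_wrt (F t) (fun x => X x - Y x).
Proof.
move=> t0 /(measurable_wrtP _ t0) mX /(measurable_wrtP _ t0) mY.
by apply/(measurable_wrtP _ t0); exact: measurable_funB.
Qed.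

Lemma measurable_wrt_cst (t : R) (c : R) : 0 <= t ->
  measurable_wrt (F t) (fun=> c).
Proof. by move=> t0; apply/(measurable_wrtP _ t0); exact: measurable_cst. Qed.

Lemma measurable_wrt_indic (t : R) (E : set Omega) : 0 <= t -> F t E ->
  measurable_wrt (F t) (\1_E : Omega -> R).
Proof.
move=> t0 FE; apply/(measurable_wrtP _ t0).
by apply: (@measurable_indic _ (g_sigma_algebraType (F t))); exact: sub_gen_smallest.
Qed.

Definition dw k (s t : R) omega := w k t omega - w k s omega.

Lemma dw_wrt k (s t : R) : 0 <= s -> s <= t -> measurable_wrt (F t) (dw k s t).
Proof.
move=> s0 st; have t0 := le_trans s0 st; case: Hw => Fw _ _ _ _.
apply: measurable_wrtB => //; first exact: Fw.
by apply: (measurable_wrt_le s0 st); exact: Fw.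
Qed.

Lemma measurable_dw k (s t : R) : 0 <= s -> s <= t ->
  measurable_fun setT (dw k s t).
Proof.
move=> s0 st; apply: (measurable_wrt_measurable (le_trans s0 st)).
exact: dw_wrt.
Qed.

Local Notation N s t := (normal_prob 0 (Num.sqrt (t - s))).

(** Independence of one event from the increment, with the Gaussian law built in. Working event by
    event covers both an event of the past and such an event cut by the increment of another
    component. *)
Definition indep_dw k (s t : R) (E : set Omega) :=
  forall C, measurable C -> (P (E `&` dw k s t @^-1` C) = P E * N s t C)%E.

Lemma wiener_indep k (s t : R) (E : set Omega) : 0 <= s -> s < t -> F s E ->
  indep_dw k s t E.
Proof.
move=> s0 st FE C mC; case: Hw => _ _ _ law prodrule.
have := prodrule _ _ s0 st E (fun j => if j == k then C else setT) FE.
rewrite (_ : [set _ | _] = dw k s t @^-1` C); last first.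
  apply/seteqP; split => x /=; first by move/(_ k); rewrite eqxx.
  by move=> Cx j; case: eqP => [->|].
rewrite (bigD1 k)//= eqxx law// big1 ?mule1 => [->//|j /negbTE ->].
  by move=> j; case: ifP.
by rewrite preimage_setT probability_setT.
Qed.

(** The increment of a second component is absorbed into the event; this is what gives cross terms
    of two components zero mean. *)
Lemma wiener_indep2 k k' (s t : R) (E : set Omega) (B : set R) :
  k != k' -> 0 <= s -> s < t -> F s E -> measurable B ->
  indep_dw k s t (E `&` dw k' s t @^-1` B).
Proof.
move=> kk' s0 st FE mB C mC; rewrite (wiener_indep k' s0 st FE mB).
case: Hw => _ _ _ law prodrule.
have := prodrule _ _ s0 st E
  (fun j => if j == k then C else if j == k' then B else setT) FE.
rewrite (_ : [set _ | _] = dw k' s t @^-1` B `&` dw k s t @^-1` C); last first.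
  apply/seteqP; split => x /=.
    move=> H; split; last by have := H k; rewrite eqxx.
    by have := H k'; rewrite eqxx eq_sym (negbTE kk').
  move=> [Bx Cx] j; case: eqP => [->//|_]; by case: eqP => [->//|].
rewrite (bigD1 k)//= (bigD1 k')/= 1?eq_sym// !eqxx [k' == k]eq_sym (negbTE kk').
rewrite !law// big1 ?mule1 => [|j /andP[/negbTE -> /negbTE ->]]; last first.
  by rewrite preimage_setT probability_setT.
rewrite setIA => ->; first by rewrite [in LHS](muleC (normal_prob _ _ C)) muleA.
by move=> j; case: ifP => // _; case: ifP.
Qed.

Lemma integral_dw_sqr k (s t : R) (E : set Omega) : 0 <= s -> s < t ->
  measurable E -> indep_dw k s t E ->
  (\int[P]_(x in E) (dw k s t x ^+ 2)%:E = P E * (t - s)%:E)%E.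
Proof.
move=> s0 st mE iE.
have ts0 : 0 < t - s by rewrite subr_gt0.
rewrite (@ge0_integral_indep _ _ _ P _ (g_sigma_algebraType R.-ocitv.-measurable)
    E (dw k s t) (N s t) (fun y => y ^+ 2))//.
- by rewrite normal_prob_second_moment ?sqrtr_gt0// sqr_sqrtr// ltW.
- by apply: measurable_dw => //; exact: ltW.
- by rewrite ltey_eq fin_num_measure.
- by move=> y; exact: sqr_ge0.
Qed.

Lemma sqint_dw k (s t : R) : 0 <= s -> s <= t -> sqint P (dw k s t).
Proof.
move=> s0; rewrite le_eqVlt => /predU1P[<-|st].
  rewrite (_ : dw k s s = fun=> 0); first exact: sqint0.
  by apply/funext => x; rewrite /dw subrr.
apply: sqintP; first by apply: measurable_dw => //; exact: ltW.
rewrite (integral_dw_sqr s0 st measurableT).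
  by rewrite probability_setT mul1e ltry.
apply: wiener_indep => //; case: HF => /(_ _ s0) [F0 FC _] _ _.
by rewrite -(setD0 setT); exact: FC.
Qed.

Lemma integrable_dw k (s t : R) : 0 <= s -> s <= t ->
  P.-integrable setT (EFin \o dw k s t).
Proof.
move=> s0 st; have c1 : sqint P (fun=> 1).
  split; first exact: measurable_cst.
  exact: (@finite_measure_integrable_cst _ _ _ P setT (1 ^+ 2)).
have := sqint_int (sqint_dw k s0 st) c1.
by apply: eq_integrable => // x _ /=; rewrite mulr1.
Qed.

(** On [E] the positive and negative parts of the increment have the same integral, [P E] times a
    moment of a symmetric law; [H] treats both parts at once, with [c] equal to 1 and to -1. *)
Lemma integral_dw k (s t : R) (E : set Omega) : 0 <= s -> s < t ->
  measurable E -> indep_dw k s t E ->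
  (\int[P]_(x in E) (dw k s t x)%:E = 0)%E.
Proof.
move=> s0 st mE iE.
have iw : P.-integrable E (EFin \o dw k s t).
  by apply: (integrableS measurableT) => //; exact: integrable_dw (ltW st).
have := integrable_pos_fin_num mE iw.
have mh (c : R) : measurable_fun setT (fun y : R => Num.max (c * y) 0).
  by apply: measurable_maxr => //; exact: measurable_funM.
have H (c : R) : (\int[P]_(x in E) (Num.max (c * dw k s t x) 0)%:E =
    P E * \int[N s t]_y (Num.max (c * y) 0)%:E)%E.
  rewrite (@ge0_integral_indep _ _ _ P _ (g_sigma_algebraType R.-ocitv.-measurable)
    E (dw k s t) (N s t)
    (fun y => Num.max (c * y) 0))//.
  - by apply: measurable_dw => //; exact: ltW.
  - by rewrite ltey_eq fin_num_measure.
  - exact: mh.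
  - by move=> y; rewrite le_max lexx orbT.
have posE : (\int[P]_(x in E) ((EFin \o dw k s t)^\+ x)%E =
    \int[P]_(x in E) (Num.max (1 * dw k s t x) 0)%:E)%E.
  by apply: eq_integral => x _; rewrite mul1r funeposE /= EFin_max.
have negE : (\int[P]_(x in E) ((EFin \o dw k s t)^\- x)%E =
    \int[P]_(x in E) (Num.max (-1 * dw k s t x) 0)%:E)%E.
  by apply: eq_integral => x _; rewrite mulN1r funenegE /= EFin_max.
rewrite [in X in _ -> X]integralE posE negE !H.
suff -> : (\int[N s t]_y (Num.max (1 * y) 0)%:E =
    \int[N s t]_y (Num.max (-1 * y) 0)%:E)%E by move=> ?; rewrite subee.
rewrite -[RHS](@normal_prob_symmetric _ _ _ (fun y => Num.max (-1 * y) 0))//.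
- by apply: eq_integral => y _; rewrite mulrNN.
- by rewrite sqrtr_gt0 subr_gt0.
- by move=> y; rewrite le_max lexx orbT.
Qed.

Lemma ip_dw_past k (s t : R) (zeta : Omega -> R) : 0 <= s -> s <= t ->
  measurable_wrt (F s) zeta -> sqint P zeta -> ip P zeta (dw k s t) = 0.
Proof.
move=> s0; rewrite le_eqVlt => /predU1P[<- _ sz|st Fz sz].
  rewrite ipC -[RHS](ip0l P zeta); congr ip.
  by apply/funext => x; rewrite /dw subrr.
apply: ip_eq0.
- exact: sz.1.
- exact: integrable_dw (ltW st).
- exact: sqint_int sz (sqint_dw _ s0 (ltW st)).
- move=> B mB; apply: integral_dw => //.
  + by apply: (filtration_measurable s0); exact: Fz.
  + by apply: wiener_indep => //; exact: Fz.
Qed.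

(** The centred product of the increments integrates to 0 over every event of [F s], so [ip_eq0]
    applies; boundedness of [zeta] keeps the triple product integrable. *)
Lemma ip_dw_dw k k' (s t : R) (zeta : Omega -> R) (M : R) : 0 <= s -> s <= t ->
  measurable_wrt (F s) zeta -> (forall x, `|zeta x| <= M) ->
  ip P zeta (fun x => dw k s t x * dw k' s t x) =
  (k == k')%:R * (t - s) * \int[P]_x zeta x.
Proof.
move=> s0; rewrite le_eqVlt => /predU1P[<- _ _|st Fz bz].
  rewrite subrr mulr0 mul0r ipC -[RHS](ip0l P zeta); congr ip.
  by apply/funext => x; rewrite /dw subrr mul0r.
have mz := measurable_wrt_measurable s0 Fz.
set c := (k == k')%:R * (t - s).
have sk := sqint_dw k s0 (ltW st); have sk' := sqint_dw k' s0 (ltW st).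
have ikk' := sqint_int sk sk'.
have ic : P.-integrable setT (EFin \o (fun=> c) : Omega -> _).
  exact: (@finite_measure_integrable_cst _ _ _ P setT c).
have iZ : P.-integrable setT
    (EFin \o (fun x => dw k s t x * dw k' s t x - c)).
  by have := integrableB measurableT ikk' ic.
have i1 := integrable_bounded_mul mz bz ikk'.
have i2 := integrable_bounded_mul mz bz ic.
have iz : P.-integrable setT (EFin \o zeta).
  have := integrable_bounded_mul mz bz
    (@finite_measure_integrable_cst _ _ _ P setT 1 measurableT).
  by apply: eq_integrable => // x _ /=; rewrite mulr1.
have : ip P zeta (fun x => dw k s t x * dw k' s t x - c) = 0.
  apply: ip_eq0 => //; first exact: integrable_bounded_mul mz bz iZ.
  move=> B mB; have FB : F s (zeta @^-1` B) by exact: Fz.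
  have mE : measurable (zeta @^-1` B) by exact: filtration_measurable FB.
  have jkk' : P.-integrable (zeta @^-1` B)
      (fun x => (dw k s t x * dw k' s t x)%:E).
    exact: (integrableS measurableT).
  have jc : P.-integrable (zeta @^-1` B) (cst c%:E).
    exact: (integrableS measurableT).
  under eq_integral do rewrite EFinB.
  rewrite integralB// integral_cst//.
  have [kk'|kk'] := eqVneq k k'.
    rewrite -kk'; under eq_integral do rewrite -expr2.
    rewrite integral_dw_sqr//; last exact: wiener_indep.
    by rewrite /c kk' eqxx mul1r muleC subee// fin_numM// fin_num_measure.
  rewrite /c (negbTE kk') mul0r mul0e sube0.
  (* For different components [ip_eq0] is used a second time, conditioning on [dw k']: cutting the
     event further by [dw k'] in [C] keeps it independent of [dw k]. *)
  rewrite (_ : \int[P]_(x in _) _ =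
     (ip P (dw k' s t) (fun x => \1_(zeta @^-1` B) x * dw k s t x))%:E)%E.
    rewrite ip_eq0//.
    - exact: sk'.1.
    - have := integrable_bounded_mul (M := 1) (measurable_indic mE) _
        (integrable_dw k s0 (ltW st)); apply.
      by move=> x; rewrite indicE; case: (_ \in _); rewrite ?normr1 ?normr0.
    - have := integrable_bounded_mul (M := 1) (measurable_indic mE) _
        ikk'.
      move=> /(_ _)/=.
      have b1 x : `|\1_(zeta @^-1` B) x| <= 1 :> R.
        by rewrite indicE; case: (_ \in _); rewrite ?normr1 ?normr0.
      move=> /(_ b1); apply: eq_integrable => // x _ /=; congr EFin; ring.
    - move=> C mC.
      rewrite (_ : \int[P]_(x in _) _ = \int[P]_(x in zeta @^-1` B `&`
          dw k' s t @^-1` C) (dw k s t x)%:E)%E.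
        apply: integral_dw => //; last exact: wiener_indep2.
        apply: measurableI => //; rewrite -[X in measurable X]setTI.
        by apply: measurable_dw => //; exact: ltW.
      rewrite setIC integral_mkcondr; apply: eq_integral => x _.
      by rewrite patchE indicE; case: ifPn => _; rewrite ?mul1r ?mul0r.
  rewrite /ip /Rintegral fineK.
    rewrite [LHS]integral_mkcond; apply: eq_integral => x _.
    rewrite patchE indicE; case: ifPn => _; rewrite ?mul1r ?mul0r ?mulr0//.
    by rewrite mulrC.
  apply: integrable_fin_num => //.
  apply: (@eq_integrable _ _ _ _ setT measurableT
    ((fun x => (dw k s t x * dw k' s t x)%:E) \_ (zeta @^-1` B))).
    move=> x _; rewrite patchE indicE; case: ifPn => _; rewrite ?mul1r ?mul0r ?mulr0//.
    by rewrite mulrC.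
  exact/(integrable_mkcond _ mE).
rewrite /ip.
under eq_Rintegral do rewrite mulrBr.
rewrite RintegralB// => /eqP; rewrite subr_eq0 => /eqP ->.
by rewrite RintegralZr// mulrC.
Qed.

End wiener.

(** * The Ito isometry *)

Lemma integral_indic_itv (R : realType) (a b : R) :
  (\int[lebesgue_measure]_x (\1_(`]a, b]%classic : set R) x)%:E =
   (Num.max 0 (b - a))%:E)%E.
Proof.
rewrite integral_indic//=; rewrite setIT.
rewrite lebesgue_measure_itv/= lte_fin -EFinB.
case: ltP => h/=; first by rewrite max_r// subr_ge0 ltW.
by rewrite max_l// subr_le0.
Qed.

Section past_future.
Context (R : realType) (d : measure_display) (Omega : measurableType d).
Context (P : probability Omega R) (F : R -> set (set Omega)).
Context (m : nat) (w : 'I_m -> R -> Omega -> R).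
Hypotheses (HF : filtration F) (Hw : wiener_process P F w).
Local Notation dw := (dw w).
Local Notation LP := (@lebesgue_measure R \x P)%E.

Lemma sqint_bounded_mul (xi f : Omega -> R) (M : R) :
  measurable_fun setT xi -> (forall x, `|xi x| <= M) -> sqint P f ->
  sqint P (fun x => xi x * f x).
Proof.
move=> mxi bxi sf; apply: (sqint_le _ (sqintZ M sf)).
  by apply: measurable_funM => //; exact: sf.1.
move=> x; rewrite !normrM ler_wpM2r//; apply: le_trans (bxi x) _.
exact: ler_norm.
Qed.

Lemma ip_past (s u : R) k (X eta : Omega -> R) (M : R) :
  0 <= s -> s <= u -> measurable_wrt (F s) X -> sqint P X ->
  measurable_wrt (F s) eta -> (forall x, `|eta x| <= M) ->
  ip P X (fun x => eta x * dw k s u x) = 0.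
Proof.
move=> s0 su FX sX Fe be.
rewrite -(ip_dw_past HF Hw k s0 su (measurable_wrtM HF s0 Fe FX)).
  by apply: eq_Rintegral => x _; rewrite mulrCA mulrA.
by apply: (sqint_bounded_mul _ be) => //; exact: (measurable_wrt_measurable HF s0).
Qed.

(** Both steps are cut at [a'] and at the smaller right end. Every piece but the common one meets a
    factor known before it starts, hence contributes nothing; the outer [Num.max] covers disjoint
    steps. *)
Lemma elem_isometry_le k k' (a b a' b' : R) (eta eta' : Omega -> R) (M M' : R) :
  0 <= a -> a <= b -> a <= a' -> a' <= b' ->
  measurable_wrt (F a) eta -> (forall x, `|eta x| <= M) ->
  measurable_wrt (F a') eta' -> (forall x, `|eta' x| <= M') ->
  ip P (fun x => eta x * dw k a b x) (fun x => eta' x * dw k' a' b' x) =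
  (k == k')%:R * (\int[P]_x (eta x * eta' x)) * Num.max 0 (Num.min b b' - a').
Proof.
move=> a0 ab aa' a'b' Fe be Fe' be'.
have a'0 := le_trans a0 aa'; have b0 := le_trans a0 ab.
have b'0 := le_trans a'0 a'b'.
have Fea := measurable_wrt_le HF a0 aa' Fe.
have me := measurable_wrt_measurable HF a0 Fe.
have me' := measurable_wrt_measurable HF a'0 Fe'.
have sg k0 s u : 0 <= s -> s <= u -> sqint P (fun x => eta x * dw k0 s u x).
  by move=> s0 su; apply: (sqint_bounded_mul me be); exact: (sqint_dw HF Hw).
have sg' k0 s u : 0 <= s -> s <= u -> sqint P (fun x => eta' x * dw k0 s u x).
  by move=> s0 su; apply: (sqint_bounded_mul me' be'); exact: (sqint_dw HF Hw).
have split_dw k0 (s u v : R) x : dw k0 s v x = dw k0 s u x + dw k0 u v x.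
  by rewrite /dw; ring.
have past s : 0 <= s -> a <= s -> s <= a' ->
    ip P (fun x => eta x * dw k a s x) (fun x => eta' x * dw k' a' b' x) = 0.
  move=> s0 as_ sa'; apply: (@ip_past _ _ _ _ _ M') => //; last exact: sg.
  apply: (measurable_wrtM HF) => //; apply: (measurable_wrt_le HF s0 sa').
  exact: (dw_wrt HF Hw).
have [ba'|a'b] := leP b a'.
  rewrite past// (max_l (y := _ - _)) ?mulr0// subr_le0.
  by rewrite ge_min ba'.
rewrite (_ : (fun x => eta x * dw k a b x) =
   fun x => eta x * dw k a a' x + eta x * dw k a' b x); last first.
  by apply/funext => x; rewrite -mulrDr -split_dw.
rewrite ipDl//; [|exact: sg|exact: sg (ltW _)|exact: sg'].
rewrite past// add0r.
have mid c : a' <= c -> ip P (fun x => eta x * dw k a' c x)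
    (fun x => eta' x * dw k' a' c x) =
    (k == k')%:R * \int[P]_x (eta x * eta' x) * (c - a').
  move=> a'c.
  have bee' x : `|eta x * eta' x| <= M * M' by rewrite normrM ler_pM.
  have := ip_dw_dw HF Hw k k' a'0 a'c (measurable_wrtM HF a'0 Fea Fe') bee'.
  rewrite mulrAC => <-; apply: eq_Rintegral => x _; ring.
have [bb'|b'b] := leP b b'.
  rewrite (max_r (x := 0)) ?subr_ge0 ?(ltW a'b)// -mid ?(ltW a'b)//.
  rewrite (_ : (fun x => eta' x * dw k' a' b' x) =
     fun x => eta' x * dw k' a' b x + eta' x * dw k' b b' x); last first.
    by apply/funext => x; rewrite -mulrDr -split_dw.
  rewrite ipDr//; [|exact: sg' (ltW _)|exact: sg'|exact: sg (ltW _)].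
  rewrite (@ip_past b b' k' _ _ M') ?addr0//.
  - apply: (measurable_wrtM HF) => //; last by apply: (dw_wrt HF Hw) => //; exact: ltW.
    exact: (measurable_wrt_le HF a0 ab).
  - exact: sg (ltW _).
  - by apply: (measurable_wrt_le HF a'0 (ltW a'b)).
rewrite (max_r (x := 0)) ?subr_ge0// -mid//.
rewrite (_ : (fun x => eta x * dw k a' b x) =
   fun x => eta x * dw k a' b' x + eta x * dw k b' b x); last first.
  by apply/funext => x; rewrite -mulrDr -split_dw.
rewrite ipDl//; [|exact: sg|exact: sg (ltW _)|exact: sg'].
rewrite [X in _ + X]ipC (@ip_past b' b k _ _ M) ?addr0//.
- exact: ltW.
- apply: (measurable_wrtM HF) => //; last by apply: (dw_wrt HF Hw) => //; exact: ltW.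
  exact: (measurable_wrt_le HF a'0 a'b').
- exact: sg'.
- by apply: (measurable_wrt_le HF a0 (le_trans aa' a'b')).
Qed.

Definition elem_proc (a b : R) (eta : Omega -> R) (p : R * Omega) : R :=
  eta p.2 * \1_(`]a, b]) p.1.

Lemma measurable_elem_proc a b (eta : Omega -> R) : measurable_fun setT eta ->
  measurable_fun setT (elem_proc a b eta).
Proof.
move=> me; apply: measurable_funM; first exact: measurableT_comp.
by apply: measurableT_comp => //; exact: measurable_indic.
Qed.

Lemma sqint_elem_proc a b (eta : Omega -> R) (M : R) : measurable_fun setT eta ->
  (forall x, `|eta x| <= M) -> sqint LP (elem_proc a b eta).
Proof.
move=> me be; have mp := measurable_elem_proc a b me; apply: sqintP => //.
rewrite fubini_tonelli1//=; last 2 first.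
- by apply/measurable_EFinP; exact: measurable_funX.
- by move=> x; rewrite lee_fin sqr_ge0.
apply: (@le_lt_trans _ _
  (\int[lebesgue_measure]_x ((M ^+ 2)%:E * (\1_(`]a, b]) x)%:E))%E).
  apply: ge0_le_integral_any => x _.
    by apply: integral_ge0 => y _; rewrite lee_fin sqr_ge0.
  rewrite /fubini_F /=.
  apply: (@le_trans _ _ (\int[P]_y ((M ^+ 2)%:E * (\1_(`]a, b]) x)%:E))%E).
    apply: ge0_le_integral_any => y _; first by rewrite lee_fin sqr_ge0.
    rewrite -EFinM lee_fin /elem_proc /= exprMn.
    rewrite indicE; case: (_ \in _); rewrite /= ?expr1n ?mulr1 ?expr0n ?mulr0//.
    rewrite -[leLHS]real_normK ?num_real// lerXn2r ?nnegrE//.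
    exact: le_trans (be y).
  by rewrite integral_cst// [X in (_ * X)%E]probability_setT mule1.
rewrite ge0_integralZl//; last 2 first.
- by apply/measurable_EFinP; exact: measurable_indic.
- by rewrite lee_fin sqr_ge0.
by rewrite integral_indic_itv -EFinM ltry.
Qed.

Lemma ip_elem_proc (a b a' b' : R) (eta eta' : Omega -> R) (M M' : R) :
  measurable_fun setT eta -> (forall x, `|eta x| <= M) ->
  measurable_fun setT eta' -> (forall x, `|eta' x| <= M') ->
  ip LP (elem_proc a b eta) (elem_proc a' b' eta') =
  (\int[P]_x (eta x * eta' x)) *
  Num.max 0 (Num.min b b' - Num.max a a').
Proof.
move=> me be me' be'.
have iee : P.-integrable setT (EFin \o (fun x => eta x * eta' x)).
  apply: (integrable_bounded_mul me be).
  have := integrable_bounded_mul me' be'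
    (@finite_measure_integrable_cst _ _ _ P setT 1 measurableT).
  by apply: eq_integrable => // x _ /=; rewrite mulr1.
rewrite /ip /Rintegral -integral12_prod_meas1; last first.
  exact: (sqint_int (sqint_elem_proc a b me be) (sqint_elem_proc a' b' me' be')).
rewrite /fubini_F /elem_proc /=.
set E := (\int[P]_x (eta x * eta' x)%:E)%E.
have Efin : E \is a fin_num by exact: integrable_fin_num iee.
have itvI x : \1_(`]a, b]) x * \1_(`]a', b']) x =
    \1_(`](Num.max a a'), (Num.min b b')]%classic : set R) x :> R.
  rewrite !indicE -natrM mulnb; congr (_%:R); rewrite !mem_setE !in_itv/= gt_max le_min.
  by case: (a < x); case: (x <= b); case: (a' < x); case: (x <= b').
transitivity (fine (\int[lebesgue_measure]_x (E *
    (\1_(`](Num.max a a'), (Num.min b b')]%classic : set R) x)%:E)))%E.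
  congr fine; apply: eq_integral => x _.
  rewrite -itvI -integralZr//.
  by apply: eq_integral => y _; rewrite -!EFinM; congr EFin; ring.
rewrite -(fineK Efin) integralZl//; last exact: integrable_indic_itv.
by rewrite integral_indic_itv -EFinM.
Qed.

Lemma elem_isometry k k' (a b a' b' : R) (eta eta' : Omega -> R) (M M' : R) :
  0 <= a -> a <= b -> 0 <= a' -> a' <= b' ->
  measurable_wrt (F a) eta -> (forall x, `|eta x| <= M) ->
  measurable_wrt (F a') eta' -> (forall x, `|eta' x| <= M') ->
  ip P (fun x => eta x * dw k a b x) (fun x => eta' x * dw k' a' b' x) =
  (k == k')%:R * ip LP (elem_proc a b eta) (elem_proc a' b' eta').
Proof.
move=> a0 ab a'0 a'b' Fe be Fe' be'.
have me := measurable_wrt_measurable HF a0 Fe.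
have me' := measurable_wrt_measurable HF a'0 Fe'.
rewrite (ip_elem_proc _ _ _ _ me be me' be').
have [aa'|a'a] := leP a a'.
  by rewrite (elem_isometry_le _ _ a0 ab aa' a'b' Fe be Fe' be') -mulrA.
rewrite ipC (elem_isometry_le _ _ a'0 a'b' (ltW a'a) ab Fe' be' Fe be) -mulrA.
rewrite eq_sym minC; congr (_ * (_ * _)).
by apply: eq_Rintegral => x _; rewrite mulrC.
Qed.

End past_future.

(** * Ito integrals as L^2 limits: isometry and martingale property *)

Section ito.
Context (R : realType) (d : measure_display) (Omega : measurableType d).
Context (P : probability Omega R) (F : R -> set (set Omega)).
Context (m : nat) (w : 'I_m -> R -> Omega -> R).
Hypotheses (HF : filtration F) (Hw : wiener_process P F w).
Local Notation dw := (dw w).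
Local Notation LP := (@lebesgue_measure R \x P)%E.
Implicit Types (S : simple_process R Omega) (t : R).

Definition sp_proc S (p : R * Omega) : R := sp_val S p.1 p.2.

Lemma sp_procE S : sp_proc S = fun p =>
  \sum_(j < sp_size S) elem_proc (sp_time S j) (sp_time S j.+1) (sp_coef S j) p.
Proof. by []. Qed.

Lemma sp_intE k S : sp_int (w k) S = fun x =>
  \sum_(j < sp_size S) sp_coef S j x * dw k (sp_time S j) (sp_time S j.+1) x.
Proof. by []. Qed.

Lemma sp_time_ge0 t S j : sp_wf F t S -> (j <= sp_size S)%N -> 0 <= sp_time S j.
Proof.
case=> S0 Smon _ _; elim: j => [//|j ih jS].
exact: le_trans (ih (ltnW jS)) (Smon _ jS).
Qed.

Lemma sp_time_le t S j : sp_wf F t S -> (j <= sp_size S)%N -> sp_time S j <= t.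
Proof.
case=> S0 Smon St _ jS; apply: le_trans St.
have : forall i, (j + i <= sp_size S)%N -> sp_time S j <= sp_time S (j + i)%N.
  elim=> [|i ih]; first by rewrite addn0.
  rewrite addnS => jiS; apply: (le_trans (ih (ltnW jiS))); exact: Smon.
by move=> /(_ (sp_size S - j)%N); rewrite subnKC// => /(_ (leqnn _)).
Qed.

Section well_formed.
Variables (t : R) (S : simple_process R Omega) (wfS : sp_wf F t S).

Lemma sp_step (j : 'I_(sp_size S)) : sp_time S j <= sp_time S j.+1.
Proof. by case: wfS => _ + _ _; apply. Qed.

Lemma sp_coef_wrt (j : 'I_(sp_size S)) :
  measurable_wrt (F (sp_time S j)) (sp_coef S j).
Proof. by case: wfS => _ _ _ /(_ j (ltn_ord j)) []. Qed.

Lemma sp_coef_bounded (j : 'I_(sp_size S)) :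
  exists M : R, forall x, `|sp_coef S j x| <= M.
Proof. by case: wfS => _ _ _ /(_ j (ltn_ord j)) []. Qed.

Lemma sp_time_ge0_ord (j : 'I_(sp_size S)) : 0 <= sp_time S j.
Proof. exact: sp_time_ge0 wfS (ltnW (ltn_ord j)). Qed.

Lemma sqint_sp_int_term k (j : 'I_(sp_size S)) :
  sqint P (fun x => sp_coef S j x * dw k (sp_time S j) (sp_time S j.+1) x).
Proof.
have [M be] := sp_coef_bounded j.
apply: (sqint_bounded_mul _ be).
  exact: (measurable_wrt_measurable HF (sp_time_ge0_ord j) (sp_coef_wrt j)).
exact: (sqint_dw HF Hw _ (sp_time_ge0_ord j) (sp_step j)).
Qed.

Lemma sqint_sp_proc_term (j : 'I_(sp_size S)) :
  sqint LP (elem_proc (sp_time S j) (sp_time S j.+1) (sp_coef S j)).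
Proof.
have [M be] := sp_coef_bounded j.
apply: (sqint_elem_proc P _ _ _ be).
exact: (measurable_wrt_measurable HF (sp_time_ge0_ord j) (sp_coef_wrt j)).
Qed.

Lemma sqint_sp_int k : sqint P (sp_int (w k) S).
Proof. by rewrite sp_intE; apply: sqint_sum => j; exact: sqint_sp_int_term. Qed.

Lemma sqint_sp_proc : sqint LP (sp_proc S).
Proof. by rewrite sp_procE; apply: sqint_sum => j; exact: sqint_sp_proc_term. Qed.

Lemma sp_proc_outside (v : R) x : v \notin `]0, t] -> sp_proc S (v, x) = 0.
Proof.
move=> vt; rewrite sp_procE big1// => j _; rewrite /elem_proc /= indicE.
rewrite mem_setE; case: (boolP (_ \in _)) => /= [|_]; last by rewrite mulr0.
rewrite in_itv/= => /andP[jv vj]; case/negP: vt; rewrite in_itv/=.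
rewrite (le_lt_trans (sp_time_ge0_ord j) jv)/=.
exact: le_trans vj (sp_time_le wfS (ltn_ord j)).
Qed.

End well_formed.

(** Bilinearity reduces this to pairs of elementary steps over arbitrary intervals, so two
    partitions with different horizons are compared without a common refinement. *)
Lemma sp_isometry k k' t t' S S' : sp_wf F t S -> sp_wf F t' S' ->
  ip P (sp_int (w k) S) (sp_int (w k') S') =
  (k == k')%:R * ip LP (sp_proc S) (sp_proc S').
Proof.
move=> wfS wfS'; rewrite !sp_intE !sp_procE.
have s1 := sqint_sp_int_term wfS k; have s2 := sqint_sp_int_term wfS' k'.
have s3 := sqint_sp_proc_term wfS; have s4 := sqint_sp_proc_term wfS'.
rewrite ip_suml//; last exact: sqint_sum.
rewrite [in RHS]ip_suml//; last exact: sqint_sum.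
rewrite mulr_sumr; apply: eq_bigr => i _.
rewrite ip_sumr// ip_sumr// mulr_sumr; apply: eq_bigr => j _.
have [M be] := sp_coef_bounded wfS i; have [M' be'] := sp_coef_bounded wfS' j.
apply: (elem_isometry HF Hw k k' _ _ _ _ _ be _ be').
- exact: sp_time_ge0_ord wfS i.
- exact: sp_step wfS i.
- exact: sp_time_ge0_ord wfS' j.
- exact: sp_step wfS' j.
- exact: sp_coef_wrt wfS i.
- exact: sp_coef_wrt wfS' j.
Qed.

(** [ito_integral] transferred to the product space: [X] is a function of time and outcome, and both
    convergences take place in L^2 spaces. The horizon enters only through [sp_wf]. *)
Definition ito_pair k t (X : R * Omega -> R) (Y : Omega -> R) : Prop :=
  [/\ sqint LP X, sqint P Y & exists S_ : nat -> simple_process R Omega,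
    [/\ forall l, sp_wf F t (S_ l), cvgsq LP (fun l => sp_proc (S_ l)) X &
        cvgsq P (fun l => sp_int (w k) (S_ l)) Y]].

Lemma cvgsq_cst (d' : measure_display) (T : measurableType d')
    (mu : {measure set T -> \bar R}) (f : T -> R) : cvgsq mu (fun=> f) f.
Proof.
rewrite /cvgsq (_ : (fun _ => _) = fun=> 0%E); first exact: cvg_cst.
apply/funext => l; apply: integral0_eq => x _.
by rewrite subrr expr0n.
Qed.

Lemma ito_pair_simple k t S : sp_wf F t S ->
  ito_pair k t (sp_proc S) (sp_int (w k) S).
Proof.
move=> wfS; split; [exact: sqint_sp_proc wfS|exact: sqint_sp_int wfS k|].
by exists (fun=> S); split => //; exact: cvgsq_cst.
Qed.

Lemma ito_pair_isometry k k' t t' X X' Y Y' :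
  ito_pair k t X Y -> ito_pair k' t' X' Y' ->
  ip P Y Y' = (k == k')%:R * ip LP X X'.
Proof.
move=> [sX sY [S [wfS SX SY]]] [sX' sY' [S' [wfS' SX' SY']]].
have c1 := ip_cvg (fun l => sqint_sp_int (wfS l) k)
  (fun l => sqint_sp_int (wfS' l) k') sY sY' SY SY'.
have c2 := ip_cvg (fun l => sqint_sp_proc (wfS l))
  (fun l => sqint_sp_proc (wfS' l)) sX sX' SX SX'.
move: c1; under eq_fun do rewrite (sp_isometry _ _ (wfS _) (wfS' _)).
by move=> c1; apply: (cvg_unique _ c1) => //; exact: cvgMr.
Qed.

(** Expanding both sides gives four instances of the isometry. The horizons may differ, which allows
    limits of stopped sums to be identified. *)
Lemma ito_pair_dist k t t' X X' Y Y' :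
  ito_pair k t X Y -> ito_pair k t' X' Y' ->
  ip P (fun x => Y x - Y' x) (fun x => Y x - Y' x) =
  ip LP (fun p => X p - X' p) (fun p => X p - X' p).
Proof.
move=> I I'; have [sX sY _] := I; have [sX' sY' _] := I'.
have sYY := sqintB sY sY'; have sXX := sqintB sX sX'.
rewrite (ipBl sY sY' sYY) !ipBr//.
rewrite !(ipBl sX sX')//.
rewrite !(ito_pair_isometry I I') !(ito_pair_isometry I' I).
rewrite !(ito_pair_isometry I I) !(ito_pair_isometry I' I') eqxx !mul1r.
by rewrite -!addrA; congr (_ + _); rewrite !opprB; ring.
Qed.

Lemma sp_int_mean k t S : sp_wf F t S -> ip P (fun=> 1) (sp_int (w k) S) = 0.
Proof.
move=> wfS; rewrite sp_intE ip_sumr; last 2 first.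
- exact: sqint_sp_int_term wfS k.
- split; first exact: measurable_cst.
  exact: (@finite_measure_integrable_cst _ _ _ P setT (1 ^+ 2)).
rewrite big1// => j _; have [M be] := sp_coef_bounded wfS j.
apply: (ip_past HF Hw k _ _ _ _ _ be).
- exact: sp_time_ge0_ord wfS j.
- exact: sp_step wfS j.
- by apply: (measurable_wrt_cst HF); exact: sp_time_ge0_ord wfS j.
- split; first exact: measurable_cst.
  exact: (@finite_measure_integrable_cst _ _ _ P setT (1 ^+ 2)).
- exact: sp_coef_wrt wfS j.
Qed.

Lemma sqint_cst (c : R) : sqint P (fun=> c).
Proof.
split; first exact: measurable_cst.
exact: (@finite_measure_integrable_cst _ _ _ P setT (c ^+ 2)).
Qed.

Lemma ito_pair_mean k t X Y : ito_pair k t X Y -> ip P (fun=> 1) Y = 0.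
Proof.
move=> [sX sY [S [wfS SX SY]]].
have c1 := ip_cvgr (fun l => sqint_sp_int (wfS l) k) sY (sqint_cst 1) SY.
move: c1; under eq_fun do rewrite (sp_int_mean _ (wfS _)).
by move=> c1; apply: (cvg_unique _ c1) => //; exact: cvg_cst.
Qed.

(** The partition is truncated at [s]. Steps starting at [s] or later collapse to a point, and their
    coefficients must be reset to 0: they are measurable at their own time, not necessarily at [s],
    where the truncated step now starts. *)
Definition sp_stop (s : R) S : simple_process R Omega :=
  SimpleProcess (sp_size S) (fun j => Num.min (sp_time S j) s)
    (fun j x => if sp_time S j < s then sp_coef S j x else 0).

Lemma sp_stop_wf s t S : 0 <= s -> sp_wf F t S -> sp_wf F s (sp_stop s S).
Proof.
move=> s0 wfS; have [S0 Smon St Sc] := wfS; split => /=.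
- by rewrite le_min S0.
- by move=> j jS; rewrite le_min ge_min Smon// ge_min lexx orbT.
- by rewrite ge_min lexx orbT.
- move=> j jS; have [Fj [M bM]] := Sc j jS.
  case: ltP => js; last first.
    by split; [exact: (measurable_wrt_cst HF)|exists 0 => x; rewrite normr0].
  by split => //; exists M.
Qed.

Definition restr (s : R) (X : R * Omega -> R) (p : R * Omega) : R :=
  X p * \1_(`[0, s]) p.1.

Lemma sp_stop_proc s t S : 0 <= s -> sp_wf F t S ->
  sp_proc (sp_stop s S) = restr s (sp_proc S).
Proof.
move=> s0 wfS; apply/funext => -[v x]; rewrite /restr !sp_procE /=.
rewrite big_distrl/=; apply: eq_bigr => j _; rewrite /elem_proc /= !indicE.
rewrite !mem_setE !in_itv/=.
have j0 := sp_time_ge0_ord wfS j.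
case: ltP => js; rewrite ?(min_l (ltW js)) ?(min_r js).
  rewrite le_min; have [jv|] := ltP (sp_time S j) v; last by rewrite !mulr0 mul0r.
  rewrite (ltW (le_lt_trans j0 jv))/=.
  by case: (v <= _); rewrite ?mulr0 ?mul0r ?mulr1.
rewrite mul0r; have [jv|] := ltP (sp_time S j) v; last by rewrite mulr0 mul0r.
by rewrite [v <= s]leNgt (le_lt_trans js jv)/= andbF mulr0.
Qed.

Lemma sqint_indic E : measurable E -> sqint P (\1_E : Omega -> R).
Proof.
move=> mE; apply: (sqint_le _ (sqint_cst 1)).
  exact: measurable_indic.
by move=> x; rewrite indicE; case: (_ \in _); rewrite /= ?normr1 ?normr0.
Qed.

(** Increments after [s] are orthogonal to events of [F s]: steps before [s] are unchanged, later
    ones contribute 0, and a step across [s] is split there. *)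
Lemma sp_stop_int k s t S E : 0 <= s -> sp_wf F t S -> F s E ->
  ip P (\1_E) (sp_int (w k) S) = ip P (\1_E) (sp_int (w k) (sp_stop s S)).
Proof.
move=> s0 wfS FE; have wfSs := sp_stop_wf s0 wfS.
have mE := filtration_measurable HF s0 FE.
have sE := sqint_indic mE.
rewrite !sp_intE ip_sumr//; last exact: sqint_sp_int_term wfS k.
rewrite [RHS]ip_sumr//; last exact: sqint_sp_int_term wfSs k.
apply: eq_bigr => j _ /=.
have j0 := sp_time_ge0_ord wfS j; have jj := sp_step wfS j.
have [M be] := sp_coef_bounded wfS j; have Fj := sp_coef_wrt wfS j.
have mj := measurable_wrt_measurable HF j0 Fj.
have [js|sj] := ltP (sp_time S j) s; last first.
  rewrite (_ : (fun x => 0 * _) = fun=> 0); last first.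
    by apply/funext => x; rewrite mul0r.
  rewrite [RHS]ipC ip0l.
  apply: (ip_past HF Hw k j0 jj _ _ Fj be) => //.
  apply: (measurable_wrt_le HF s0 sj); exact: measurable_wrt_indic.
have [j1s|sj1] := leP (sp_time S j.+1) s; first by [].
rewrite (_ : (fun x => _) = fun x =>
    sp_coef S j x * dw k (sp_time S j) s x +
    sp_coef S j x * dw k s (sp_time S j.+1) x); last first.
  by apply/funext => x; rewrite /dw; ring.
have sqd u v : 0 <= u -> u <= v -> sqint P (fun x => sp_coef S j x * dw k u v x).
  by move=> u0 uv; apply: (sqint_bounded_mul mj be); exact: (sqint_dw HF Hw).
rewrite ipDr//; [|exact: sqd (ltW _)|exact: sqd (ltW _)].
rewrite [X in _ + X](ip_past HF Hw k s0 (ltW sj1) _ _ _ be) ?addr0//.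
- exact: measurable_wrt_indic.
- exact: (measurable_wrt_le HF j0 (ltW js)).
Qed.

Lemma restr_abs_le s X p : `|restr s X p| <= `|X p|.
Proof.
rewrite /restr normrM ler_piMr// indicE.
by case: (_ \in _); rewrite /= ?normr1 ?normr0.
Qed.

Lemma ip_le_abs (d' : measure_display) (T : measurableType d')
    (mu : {measure set T -> \bar R}) (f g : T -> R) :
  sqint mu f -> sqint mu g -> (forall x, `|f x| <= `|g x|) -> ip mu f f <= ip mu g g.
Proof.
move=> sf sg fg; rewrite -lee_fin !ip_sqrE//.
apply: ge0_le_integral_any => x _; first by rewrite lee_fin sqr_ge0.
rewrite lee_fin -[leLHS]real_normK ?num_real// -[leRHS]real_normK ?num_real//.
by rewrite lerXn2r ?nnegrE.
Qed.

(** [Y'] comes with an approximating sequence of its own. It is nevertheless the limit of the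
    stopped sums of [Y]: by the isometry their distance to [Y'] is that of the integrands, and
    cutting at [s] can only shrink the distance to [X]. *)
Lemma ito_pair_martingale_indic k s t X Y Y' E : 0 <= s -> ito_pair k t X Y ->
  ito_pair k s (restr s X) Y' -> F s E -> ip P (\1_E) Y = ip P (\1_E) Y'.
Proof.
move=> s0 I I' FE; have [sX sY [S [wfS SX SY]]] := I; have [sX' sY' _] := I'.
have mE := filtration_measurable HF s0 FE; have sE := sqint_indic mE.
have wfSs l := sp_stop_wf s0 (wfS l).
have c1 := ip_cvgr (fun l => sqint_sp_int (wfS l) k) sY sE SY.
move: c1; under eq_fun do rewrite (sp_stop_int k s0 (wfS _) FE).
move=> c1; apply: (cvg_unique _ c1) => //.
apply: ip_cvgr => //; first by move=> l; exact: sqint_sp_int (wfSs l) k.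
apply/cvgsqP => //; first by move=> l; exact: sqint_sp_int (wfSs l) k.
under eq_fun do rewrite (ito_pair_dist (ito_pair_simple k (wfSs _)) I').
have /cvgsqP c2 := SX.
have {}c2 := c2 (fun l => sqint_sp_proc (wfS l)) sX.
apply: (squeeze_cvgr _ (cvg_cst 0) c2); apply: nearW => l; rewrite ip_ge0/=.
apply: ip_le_abs.
- by apply: sqintB => //; exact: sqint_sp_proc (wfSs l).
- by apply: sqintB => //; exact: sqint_sp_proc (wfS l).
move=> p; rewrite (sp_stop_proc s0 (wfS l)) /restr -mulrBl.
exact: (restr_abs_le s (fun p => sp_proc (S l) p - X p)).
Qed.

Lemma ito_pair_martingale k s t X Y Y' xi : 0 <= s -> ito_pair k t X Y ->
  ito_pair k s (restr s X) Y' -> measurable_wrt (F s) xi -> sqint P xi ->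
  ip P xi Y = ip P xi Y'.
Proof.
move=> s0 I I' Fxi sxi; have [_ sY _] := I; have [_ sY' _] := I'.
apply/eqP; rewrite -subr_eq0 -ipBr//; apply/eqP.
have iint f : sqint P f -> P.-integrable setT (EFin \o f).
  move=> sf; have := sqint_int sf (sqint_cst 1).
  by apply: eq_integrable => // x _ /=; rewrite mulr1.
have sYY := sqintB sY sY'.
apply: ip_eq0.
- exact: sxi.1.
- exact: iint.
- exact: sqint_int.
- move=> B mB; have FB : F s (xi @^-1` B) by exact: Fxi.
  have mE := filtration_measurable HF s0 FB; have sE := sqint_indic mE.
  have := ito_pair_martingale_indic s0 I I' FB.
  move/eqP; rewrite -subr_eq0 -ipBr// => /eqP.
  rewrite /ip /Rintegral => H.
  have fin := integrable_fin_num measurableT (sqint_int sE sYY).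
  rewrite integral_mkcond -[RHS](_ : (fine (\int[P]_x (\1_(xi @^-1` B) x *
      (Y x - Y' x))%:E))%:E%E = _); last by rewrite H.
  rewrite fineK//; apply: eq_integral => x _.
  by rewrite patchE indicE; case: ifPn => _; rewrite ?mul1r ?mul0r.
Qed.


Lemma measurable_restr_process t (X : R -> Omega -> R) :
  measurable_fun ((`[0, +oo[ : set R) `*` [set: Omega]) (fun p => X p.1 p.2) ->
  measurable_fun setT (restr t (fun p => X p.1 p.2)).
Proof.
move=> mX.
rewrite (_ : restr _ _ = (fun p => X p.1 p.2) \_ ((`[0, t] : set R) `*` [set: Omega])).
  apply/(measurable_restrictT _ _).1; first exact: measurableX.
  apply: measurable_funS mX => //; first exact: measurableX.
  move=> [v x] /= [+ _]; rewrite !in_itv/= => /andP[-> _]; by split.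
apply/funext => -[v x]; rewrite /restr patchE indicE /=.
case: ifPn => h; last first.
  by rewrite memNset ?mulr0// => vt; case/negP: h; rewrite inE; split.
by rewrite mem_set ?mulr1//; move: h; rewrite inE => -[].
Qed.

Lemma integral_LP_restr t (X : R * Omega -> R) : measurable_fun setT (restr t X) ->
  (\int[LP]_p (restr t X p ^+ 2)%:E =
   \int[P]_omega \int[lebesgue_measure]_(v in `[0%R, t])
           (X (v, omega) ^+ 2)%:E)%E.
Proof.
move=> mX.
transitivity (\int[P]_y fubini_G lebesgue_measure
    (fun p => (restr t X p ^+ 2)%:E) y)%E.
  apply: fubini_tonelli2.
  - by apply/measurable_EFinP; exact: measurable_funX.
  - by move=> p; rewrite lee_fin sqr_ge0.
apply: eq_integral => x _; rewrite /fubini_G [in RHS]integral_mkcond.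
  apply: eq_integral => v _; rewrite patchE /restr /= indicE.
  by case: (_ \in _); rewrite ?mulr1 // mulr0 expr0n.
Qed.

Lemma sqint_restr_process t (X : R -> Omega -> R) :
  measurable_fun ((`[0, +oo[ : set R) `*` [set: Omega]) (fun p => X p.1 p.2) ->
  (\int[P]_omega \int[lebesgue_measure]_(v in `[0%R, t])
           (X v omega ^+ 2)%R%:E < +oo)%E ->
  sqint LP (restr t (fun p => X p.1 p.2)).
Proof.
move=> mX Xoo; have mXt := measurable_restr_process t mX; apply: sqintP => //.
by rewrite integral_LP_restr.
Qed.

Lemma ito_integral_pair k t (X : R -> Omega -> R) (Y : Omega -> R) :
  measurable_fun ((`[0, +oo[ : set R) `*` [set: Omega]) (fun p => X p.1 p.2) ->
  (\int[P]_omega \int[lebesgue_measure]_(v in `[0%R, t])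
           (X v omega ^+ 2)%R%:E < +oo)%E ->
  ito_integral P F (w k) t X Y ->
  ito_pair k t (restr t (fun p => X p.1 p.2)) Y.
Proof.
move=> mX Xoo [mY [S [wfS SX SY]]].
have sX := sqint_restr_process mX Xoo.
split => //; first exact: cvgsq_sqint mY (fun l => sqint_sp_int (wfS l) k) SY.
exists S; split => //; rewrite /cvgsq.
rewrite (_ : (fun l => _) = (fun l => \int[P]_omega
   \int[lebesgue_measure]_(v in `[0%R, t])
           ((sp_val (S l) v omega - X v omega) ^+ 2)%R%:E)%E)//.
apply/funext => l.
(* The simple process already vanishes outside ]0, t], so cutting it to [0, t] leaves it
   unchanged. *)
have procE p : sp_proc (S l) p - restr t (fun p => X p.1 p.2) p =
    restr t (fun p => sp_proc (S l) p - X p.1 p.2) p.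
  rewrite /restr mulrBl; congr (_ - _); case: p => v x /=.
  rewrite indicE; case: (boolP (_ \in _)) => [_|vt]; first by rewrite mulr1.
  rewrite mulr0 (sp_proc_outside (wfS l))//; apply: contra vt.
  by rewrite mem_setE !in_itv/= => /andP[/ltW -> ->].
under eq_integral do rewrite procE.
rewrite integral_LP_restr//.
rewrite (_ : restr _ _ = fun p => sp_proc (S l) p - restr t (fun p => X p.1 p.2) p).
  by apply: measurable_funB; [exact: (sqint_sp_proc (wfS l)).1|exact: sX.1].
by apply/funext => p; rewrite procE.
Qed.

End ito.

(** * The product rule for Ito processes *)

Section fubini_real.
Context (R : realType) (d1 d2 : measure_display).
Context (T1 : measurableType d1) (T2 : measurableType d2).
Variables (m1 : {sigma_finite_measure set T1 -> \bar R}).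
Variables (m2 : {sigma_finite_measure set T2 -> \bar R}).

(** Inner integrals of an integrable function are finite only almost everywhere; [fine] makes them
    real-valued without changing the outer integral. *)
Lemma integrable_fine (d : measure_display) (T : measurableType d)
    (mu : {measure set T -> \bar R}) (g : T -> \bar R) :
  mu.-integrable setT g ->
  mu.-integrable setT (EFin \o (fun x => fine (g x))) /\
  Rintegral mu setT (fun x => fine (g x)) = fine (\int[mu]_x g x).
Proof.
move=> ig; have mg := measurable_int _ ig.
have mfg : measurable_fun setT (fun x => (fine (g x))%:E).
  by apply/measurable_EFinP; exact: measurableT_comp.
have aefin := integrable_ae measurableT ig.
have ae_fg : {ae mu, forall x, setT x -> g x = (fine (g x))%:E}.
  by apply: filterS aefin => x + _ => /(_ I) /fineK ->.
split; last first.
  by rewrite /Rintegral; congr fine; apply/esym/ae_eq_integral.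
apply/integrableP; split => //; have /integrableP[_] := ig.
congr (_ < _)%E; apply: ae_eq_integral => //.
- exact: measurableT_comp.
- exact: measurableT_comp.
- by apply: filterS ae_fg => x /= + _ => /(_ I) {1}->.
Qed.

Lemma Rintegral_prod12 (f : T1 * T2 -> R) :
  (m1 \x m2)%E.-integrable setT (EFin \o f) ->
  m1.-integrable setT (EFin \o (fun x => \int[m2]_y f (x, y))) /\
  Rintegral (m1 \x m2)%E setT f = \int[m1]_x \int[m2]_y f (x, y).
Proof.
move=> fi; have [? ?] := integrable_fine (integrable_fubini_F fi).
by split => //; rewrite /Rintegral -integral12_prod_meas1.
Qed.

Lemma Rintegral_prod21 (f : T1 * T2 -> R) :
  (m1 \x m2)%E.-integrable setT (EFin \o f) ->
  m2.-integrable setT (EFin \o (fun y => \int[m1]_x f (x, y))) /\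
  Rintegral (m1 \x m2)%E setT f = \int[m2]_y \int[m1]_x f (x, y).
Proof.
move=> fi; have iG : m2.-integrable setT (fubini_G m1 (EFin \o f)).
  apply/integrableP; split; first exact: measurable_fubini_G fi.
  have mf := measurable_int _ fi.
  have loo := (integrable21ltyP m1 m2 mf).1 fi.
  apply: (le_lt_trans _ loo).
  apply: ge0_le_integral => //.
  - by apply: measurableT_comp => //; exact: measurable_fubini_G fi.
  - apply: (measurable_fun_fubini_tonelli_G (abse \o (EFin \o f))) => //.
    + exact: measurableT_comp.
    + by move=> p; exact: abse_ge0.
  - move=> y _; apply: le_abse_integral => //.
    exact: measurableT_comp.
have [? ?] := integrable_fine iG.
by split => //; rewrite /Rintegral -integral21_prod_meas1.
Qed.

Lemma integrable_tensor (f : T1 -> R) (g : T2 -> R) :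
  m1.-integrable setT (EFin \o f) -> m2.-integrable setT (EFin \o g) ->
  (m1 \x m2)%E.-integrable setT (EFin \o (fun p => f p.1 * g p.2)).
Proof.
move=> fi gi.
have mf : measurable_fun setT f by apply/measurable_EFinP; exact: measurable_int fi.
have mg : measurable_fun setT g by apply/measurable_EFinP; exact: measurable_int gi.
apply/integrable12ltyP.
  apply/measurable_EFinP; apply: measurable_funM; exact: measurableT_comp.
have [_ foo] := (integrableP _ _ _ fi); have [_ goo] := (integrableP _ _ _ gi).
set C := (\int[m2]_y `|(EFin \o g) y|)%E in goo.
have C0 : (0 <= C)%E by exact: integral_ge0.
rewrite (eq_integral (fun x => `|(f x)%:E| * C)%E); last first.
  move=> x _; rewrite -ge0_integralZl//.
    by apply: eq_integral => y _; rewrite /= normrM EFinM.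
  by apply: measurableT_comp => //; exact/measurable_EFinP.
rewrite ge0_integralZr//; last first.
  by apply: measurableT_comp => //; exact/measurable_EFinP.
have Cfin : C \is a fin_num by rewrite ge0_fin_numE.
rewrite -(fineK Cfin).
have F0 : (0 <= \int[m1]_x `|(f x)%:E|)%E by exact: integral_ge0.
have Ffin : (\int[m1]_x `|(f x)%:E|)%E \is a fin_num by rewrite ge0_fin_numE.
by rewrite -(fineK Ffin) -EFinM ltry.
Qed.

Lemma sqint_tensor (f : T1 -> R) (g : T2 -> R) :
  sqint m1 f -> sqint m2 g -> sqint (m1 \x m2)%E (fun p => f p.1 * g p.2).
Proof.
move=> [mf fi] [mg gi]; split.
  by apply: measurable_funM; exact: measurableT_comp.
have := integrable_tensor fi gi.
by apply: eq_integrable => // p _ /=; rewrite exprMn.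
Qed.

End fubini_real.

(** * Time integrals of square-integrable processes *)

Section time_integral.
Context (R : realType) (d : measure_display) (Omega : measurableType d).
Context (P : probability Omega R).
Local Notation la := (@lebesgue_measure R).
Local Notation LP := (la \x P)%E.
Implicit Types (alpha : R * Omega -> R) (v : R).

Definition tint alpha v (x : Omega) : R := \int[la]_(u in `[0, v]) alpha (u, x).

(** Seen as an inner product with an indicator, the time integral falls under Cauchy-Schwarz and
    under Fubini for products of L^2 functions. *)
Lemma tintE alpha v x :
  tint alpha v x = ip la (\1_(`[0, v] : set R)) (fun u => alpha (u, x)).
Proof.
rewrite /tint Rintegral_mkcond; apply: eq_Rintegral => u _.
by rewrite patchE indicE; case: ifPn => _; rewrite ?mul1r ?mul0r.
Qed.

Lemma ip_indic_itv v : 0 <= v ->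
  sqint la (\1_(`[0, v] : set R)) /\
  ip la (\1_(`[0, v] : set R)) (\1_(`[0, v] : set R)) = v.
Proof.
move=> v0; have E : (\int[la]_u (\1_(`[0%R, v] : set R) u ^+ 2)%:E = v%:E)%E.
  transitivity (\int[la]_u (\1_(`[0%R, v] : set R) u)%:E)%E.
    apply: eq_integral; by move=> u _; rewrite indicE; case: (_ \in _); rewrite ?expr1n// expr0n.
  rewrite integral_indic//= setIT lebesgue_measure_itv/= lte_fin oppr0 adde0.
  by case: ltP => // v0'; have/eqP -> : v == 0 by rewrite eq_le v0 v0'.
have s1 : sqint la (\1_(`[0, v] : set R)).
  apply: sqintP; first exact: measurable_indic.
  by rewrite E ltry.
by split => //; apply: EFin_inj; rewrite ip_sqrE.
Qed.

Lemma sqint_ae_section alpha : sqint LP alpha ->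
  {ae P, forall x, sqint la (fun u => alpha (u, x))}.
Proof.
move=> [ma ia]; have := ae_integrable2 ia.
apply: filterS => x ix; split => //.
exact: (measurableT_comp ma).
Qed.

Lemma integrable_indic_snd v alpha (xi : Omega -> R) : 0 <= v ->
  sqint LP alpha -> sqint P xi ->
  LP.-integrable setT
    (EFin \o (fun p => \1_(`[0, v] : set R) p.1 * xi p.2 * alpha p)).
Proof.
move=> v0 sa sxi; apply: sqint_int => //.
by apply: sqint_tensor => //; exact: (ip_indic_itv v0).1.
Qed.

Lemma measurable_tint alpha v : 0 <= v -> sqint LP alpha ->
  measurable_fun setT (tint alpha v).
Proof.
move=> v0 sa; have := integrable_indic_snd v0 sa (sqint_cst P 1).
move=> /Rintegral_prod21[/measurable_int /measurable_EFinP + _].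
congr measurable_fun; apply/funext => x; rewrite tintE.
by apply: eq_Rintegral => u _ /=; rewrite mulr1.
Qed.

(** For almost every outcome, Cauchy-Schwarz in time bounds the square by [v] times the time
    integral of [alpha ^+ 2], whose expectation is finite by Tonelli. *)
Lemma sqint_tint alpha v : 0 <= v -> sqint LP alpha -> sqint P (tint alpha v).
Proof.
move=> v0 sa; have mt := measurable_tint v0 sa; apply: sqintP => //.
have [s1 v1] := ip_indic_itv v0; have [ma ia] := sa.
have ma2 : measurable_fun setT (fun p => (alpha p ^+ 2)%:E).
  exact: measurable_int ia.
have G0 p : (0 <= (alpha p ^+ 2)%:E)%E by rewrite lee_fin sqr_ge0.
have mG := measurable_fun_fubini_tonelli_G (m1 := la) _ ma2 G0.
apply: (@le_lt_trans _ _ (\int[P]_x (v%:E *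
    fubini_G la (fun p => (alpha p ^+ 2)%:E) x))%E); last first.
  rewrite ge0_integralZl//; last first.
    by move=> x _; exact: integral_ge0.
  have E : (\int[LP]_p (alpha p ^+ 2)%:E =
      \int[P]_x fubini_G la (fun p => (alpha p ^+ 2)%:E) x)%E.
    exact: fubini_tonelli2.
  by rewrite -E -ip_sqrE// -EFinM ltry.
apply: ae_ge0_le_integral => //.
- by move=> x _; rewrite lee_fin sqr_ge0.
- by apply/measurable_EFinP; exact: measurable_funX.
- by move=> x _; apply: mule_ge0 => //; exact: integral_ge0.
- by apply: measurable_funeM.
- apply: filterS (sqint_ae_section sa) => x sx _.
  rewrite tintE /fubini_G /= -ip_sqrE// -EFinM lee_fin -[in leRHS]v1.
  exact: ip_cauchy_schwarz.
Qed.

Lemma ip_tint alpha v (xi : Omega -> R) : 0 <= v -> sqint LP alpha -> sqint P xi ->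
  la.-integrable `[0, v] (EFin \o (fun u => ip P xi (fun x => alpha (u, x)))) /\
  ip P xi (tint alpha v) =
  \int[la]_(u in `[0, v]) ip P xi (fun x => alpha (u, x)).
Proof.
move=> v0 sa sxi; have fi := integrable_indic_snd v0 sa sxi.
have [s1 _] := ip_indic_itv v0.
have [i1 E1] := Rintegral_prod12 fi; have [i2 E2] := Rintegral_prod21 fi.
have F1 u : \int[P]_y (\1_(`[0, v] : set R) u * xi y * alpha (u, y)) =
    ((fun u => ip P xi (fun x => alpha (u, x))) \_ `[0, v]) u.
  rewrite patchE indicE; case: (boolP (_ \in _)) => _ /=.
    by apply: eq_Rintegral => y _; rewrite mul1r.
  by rewrite /Rintegral integral0_eq// => y _; rewrite !mul0r.
split.
  apply/integrable_mkcond => //; apply: eq_integrable i1 => // u _ /=.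
  by rewrite F1 !patchE; case: ifP.
rewrite Rintegral_mkcond.
transitivity (\int[la]_u \int[P]_y (\1_(`[0, v] : set R) u * xi y * alpha (u, y))).
  rewrite -E1 E2 /ip /Rintegral; congr fine; apply: ae_eq_integral => //.
  - by apply/measurable_EFinP/measurable_funM; [exact: sxi.1|exact: measurable_tint].
  - exact: measurable_int i2.
  - apply: filterS (sqint_ae_section sa) => x sx _.
    rewrite tintE /ip; congr EFin.
    rewrite -[LHS]RintegralZl//; last exact: sqint_int.
    by apply: eq_Rintegral => u _ /=; rewrite mulrCA mulrA.
by apply: eq_Rintegral => u _; rewrite F1.
Qed.

End time_integral.

(** * Fubini's theorem on the two halves of a square *)

Section triangle.
Context (R : realType).
Local Notation la := (@lebesgue_measure R).
Local Notation LL := (la \x la)%E.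
Variables (t : R) (c : R -> R -> R).
Hypothesis ic : LL.-integrable setT (EFin \o (fun q : R * R => c q.1 q.2)).
Hypothesis c0 : forall u v, (u \notin `[0, t]) || (v \notin `[0, t]) -> c u v = 0.

Let mc : measurable_fun setT (fun q : R * R => c q.1 q.2).
Proof. by apply/measurable_EFinP; exact: measurable_int ic. Qed.

Let K1 (q : R * R) : R := c q.1 q.2 * (q.1 <= q.2)%R%:R.
Let K2 (q : R * R) : R := c q.1 q.2 * (q.2 < q.1)%R%:R.

Let mK1 : measurable_fun setT K1.
Proof.
apply: measurable_funM => //.
apply: (measurableT_comp (f := fun b : bool => b%:R : R)) => //.
by apply: measurable_fun_ler; [exact: measurable_fst|exact: measurable_snd].
Qed.

Let mK2 : measurable_fun setT K2.
Proof.
apply: measurable_funM => //.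
apply: (measurableT_comp (f := fun b : bool => b%:R : R)) => //.
by apply: measurable_fun_ltr; [exact: measurable_snd|exact: measurable_fst].
Qed.

Let iK1 : LL.-integrable setT (EFin \o K1).
Proof.
apply: (@integrable_le_abs _ _ _ LL K1 (fun q => `|c q.1 q.2|)).
- exact: mK1.
- exact: integrable_norm ic.
move=> q.
rewrite /K1 normrM ler_piMr//.
by rewrite normr_nat lern1 leq_b1.
Qed.

Let iK2 : LL.-integrable setT (EFin \o K2).
Proof.
apply: (@integrable_le_abs _ _ _ LL K2 (fun q => `|c q.1 q.2|)).
- exact: mK2.
- exact: integrable_norm ic.
move=> q.
rewrite /K2 normrM ler_piMr//.
by rewrite normr_nat lern1 leq_b1.
Qed.

Let K1E v : \int[la]_u K1 (u, v) = \int[la]_(u in `[0, v]) c u v.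
Proof.
rewrite [RHS]Rintegral_mkcond; apply: eq_Rintegral => u _.
rewrite /K1 patchE mem_setE in_itv/=; have [u0|u0] /= := leP 0 u.
  by case: (u <= v); rewrite ?mulr1 ?mulr0.
by rewrite c0 ?mul0r// in_itv/= leNgt u0.
Qed.

Let K2E u : \int[la]_v K2 (u, v) = \int[la]_(v in `[0, u]) c u v.
Proof.
(* The diagonal is counted in [K1], so sections of [K2] are half-open; the missing end point has
   measure zero. *)
transitivity (\int[la]_(v in `[0, u[) c u v).
  rewrite [RHS]Rintegral_mkcond; apply: eq_Rintegral => v _.
  rewrite /K2 patchE mem_setE in_itv/=; have [v0|v0] /= := leP 0 v.
    by case: (v < u); rewrite ?mulr1 ?mulr0.
  by rewrite c0 ?mul0r// !in_itv/= [0 <= v]leNgt v0 orbT.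
rewrite /Rintegral integral_itv_bndo_bndc//.
have mcu : measurable_fun setT (c u) by exact: (measurable_fun_pair2 u mc).
by apply: measurable_funTS; apply/measurable_EFinP.
Qed.

Let supp (h : R -> R) : (forall v, v \notin `[0, t] -> h v = 0) ->
  h \_ `[0, t] = h.
Proof.
move=> h0; apply/funext => v; rewrite patchE mem_setE.
by case: (boolP (_ \in _)) => // /h0 ->.
Qed.

Let Rint0 (D : set R) (h : R -> R) : (forall u, h u = 0) -> \int[la]_(u in D) h u = 0.
Proof. by move=> h0; rewrite /Rintegral integral0_eq// => u _; rewrite h0. Qed.

Lemma triangle_integrable :
  la.-integrable `[0, t] (EFin \o (fun v => \int[la]_(u in `[0, v]) c u v)) /\
  la.-integrable `[0, t] (EFin \o (fun v => \int[la]_(u in `[0, v]) c v u)).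
Proof.
split.
  have [i1 _] := Rintegral_prod21 iK1.
  apply: (integrableS measurableT) => //.
  by apply: eq_integrable i1 => // v _ /=; rewrite K1E.
have [i2 _] := Rintegral_prod12 iK2.
apply: (integrableS measurableT) => //.
by apply: eq_integrable i2 => // v _ /=; rewrite K2E.
Qed.

(** The square is cut along its diagonal, and each half is integrated in the order that makes the
    inner variable the smaller one. *)
Lemma triangle_integral :
  \int[la]_(v in `[0, t]) \int[la]_(u in `[0, t]) c u v =
  \int[la]_(v in `[0, t]) \int[la]_(u in `[0, v]) c u v +
  \int[la]_(v in `[0, t]) \int[la]_(u in `[0, v]) c v u.
Proof.
have [_ E] := Rintegral_prod21 ic; have [_ E1] := Rintegral_prod21 iK1.
have [_ E2] := Rintegral_prod12 iK2.
have S : Rintegral LL setT (fun q => c q.1 q.2) = Rintegral LL setT K1 + Rintegral LL setT K2.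
  transitivity (Rintegral LL setT (fun q => K1 q + K2 q)).
    apply: eq_Rintegral => q _.
    by rewrite /K1 /K2 -mulrDr ltNge; case: (_ <= _); rewrite /= ?addr0 ?add0r mulr1.
  exact: (@RintegralD _ _ _ LL setT K1 K2 measurableT iK1 iK2).
have A : \int[la]_v \int[la]_u c u v =
    \int[la]_(v in `[0, t]) \int[la]_(u in `[0, t]) c u v.
  rewrite [RHS]Rintegral_mkcond supp; last first.
    by move=> v vt; apply: Rint0 => u; rewrite c0// vt orbT.
  apply: eq_Rintegral => v _; rewrite [RHS]Rintegral_mkcond supp//.
  by move=> u ut; rewrite c0// ut.
have A1 : \int[la]_v \int[la]_u K1 (u, v) =
    \int[la]_(v in `[0, t]) \int[la]_(u in `[0, v]) c u v.
  rewrite [RHS]Rintegral_mkcond supp; last first.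
    by move=> v vt; apply: Rint0 => u; rewrite c0// vt orbT.
  by apply: eq_Rintegral => v _; rewrite K1E.
have A2 : \int[la]_u \int[la]_v K2 (u, v) =
    \int[la]_(v in `[0, t]) \int[la]_(u in `[0, v]) c v u.
  rewrite [RHS]Rintegral_mkcond supp; last first.
    by move=> v vt; apply: Rint0 => u; rewrite c0// vt.
  by apply: eq_Rintegral => v _; rewrite K2E.
by rewrite -A -A1 -A2 -E -E1 -E2.
Qed.

End triangle.

(** * The covariance of two drifts as a function of two times *)

Section covariance_kernel.
Context (R : realType) (d : measure_display) (Omega : measurableType d).
Context (P : probability Omega R).
Local Notation la := (@lebesgue_measure R).
Local Notation LP := (la \x P)%E.
Local Notation LL := (la \x la)%E.
Variables (t : R) (alpha alpha' : R * Omega -> R).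
Hypotheses (t0 : 0 <= t) (sa : sqint LP alpha) (sa' : sqint LP alpha').
Hypotheses (sau : forall u, sqint P (fun x => alpha (u, x)))
  (sau' : forall u, sqint P (fun x => alpha' (u, x))).
Hypotheses (a0 : forall u x, u \notin `[0, t] -> alpha (u, x) = 0)
  (a0' : forall u x, u \notin `[0, t] -> alpha' (u, x) = 0).

Definition cov_kernel (u v : R) : R :=
  ip P (fun x => alpha (u, x)) (fun x => alpha' (v, x)).

Let N (e : R) (q : R * R) : \bar R :=
  (\int[P]_x ((alpha (q.1, x) + e * alpha' (q.2, x)) ^+ 2)%:E)%E.

Let mN e : measurable_fun setT (N e).
Proof.
apply: (measurable_fun_fubini_tonelli_F (m2 := P)
  (fun p : (R * R) * Omega => ((alpha (p.1.1, p.2) + e * alpha' (p.1.2, p.2)) ^+ 2)%:E)).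
  apply/measurable_EFinP; apply: measurable_funX; apply: measurable_funD.
    apply: (measurableT_comp sa.1); apply: measurable_fun_pair => //.
    by apply: measurableT_comp; [exact: measurable_fst|exact: measurable_fst].
  apply: measurable_funM => //; apply: (measurableT_comp sa'.1).
  apply: measurable_fun_pair => //.
  by apply: measurableT_comp; [exact: measurable_snd|exact: measurable_fst].
by move=> p; rewrite lee_fin sqr_ge0.
Qed.

Let NE e q : N e q = (ip P (fun x => alpha (q.1, x) + e * alpha' (q.2, x))
  (fun x => alpha (q.1, x) + e * alpha' (q.2, x)))%:E.
Proof. by rewrite ip_sqrE//; apply: sqintD => //; exact: sqintZ. Qed.

(** Polarisation: [N 1] and [N (-1)] integrate nonnegative functions over [Omega], so their
    measurability in the two times is Tonelli's theorem, whereas the product itself has no sign. *)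
Lemma measurable_cov_kernel :
  measurable_fun setT (fun q : R * R => cov_kernel q.1 q.2).
Proof.
rewrite (_ : (fun q => _) = fun q => (fine (N 1 q) - fine (N (-1) q)) / 4).
  apply: measurable_funM => //.
  by apply: measurable_funB; exact: measurableT_comp.
apply/funext => q; rewrite !NE /= /cov_kernel.
have z (e : R) := sqintZ e (sau' q.2).
rewrite !ipDl ?ipDr//; try exact: sqintD.
rewrite !ipZl// !ipZr// ![ip _ (fun x => alpha' _) _]ipC.
by field.
Qed.

Let normr_ip (f g : Omega -> R) : sqint P f -> sqint P g ->
  `|ip P f g| <= ip P f f + ip P g g.
Proof.
move=> sf sg; have F0 := ip_ge0 P f; have G0 := ip_ge0 P g.
rewrite -(@ler_pXn2r _ 2)// ?nnegrE ?addr_ge0// real_normK ?num_real//.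
apply: (le_trans (ip_cauchy_schwarz sf sg)); nra.
Qed.

Let ia (b : R * Omega -> R) : sqint LP b ->
  la.-integrable setT (EFin \o (fun u => ip P (fun x => b (u, x)) (fun x => b (u, x)))).
Proof. by move=> sb; have [] := Rintegral_prod12 (sqint_int sb sb). Qed.

(** The covariance is at most the sum of two second moments. Inside the square each of these is an
    integrable function of one time multiplied by the indicator of the other. *)
Lemma integrable_cov_kernel :
  LL.-integrable setT (EFin \o (fun q : R * R => cov_kernel q.1 q.2)).
Proof.
have i1 : la.-integrable setT (EFin \o (\1_(`[0, t] : set R))).
  have := sqint_int (ip_indic_itv t0).1 (ip_indic_itv t0).1.
  apply: eq_integrable => // u _ /=; rewrite indicE.
  by case: (_ \in _); rewrite ?mulr1 ?mulr0.
have ig := integrableD measurableT (integrable_tensor (ia sa) i1)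
  (integrable_tensor i1 (ia sa')).
apply: (@integrable_le_abs _ _ _ LL _ (fun q =>
  ip P (fun x => alpha (q.1, x)) (fun x => alpha (q.1, x)) * \1_(`[0, t] : set R) q.2 +
  \1_(`[0, t] : set R) q.1 * ip P (fun x => alpha' (q.2, x)) (fun x => alpha' (q.2, x)))).
- exact: measurable_cov_kernel.
- exact: ig.
move=> [u v] /=.
have [ut|ut] := boolP (u \in `[0, t]); last first.
  rewrite /cov_kernel (_ : (fun x => alpha (u, x)) = fun=> 0).
    by rewrite ip0l normr0 addr_ge0// mulr_ge0// ?ip_ge0// indicE.
  by apply/funext => x; rewrite a0.
have [vt|vt] := boolP (v \in `[0, t]); last first.
  rewrite /cov_kernel (_ : (fun x => alpha' (v, x)) = fun=> 0).
    by rewrite ipC ip0l normr0 addr_ge0// mulr_ge0// ?ip_ge0// indicE.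
  by apply/funext => x; rewrite a0'.
rewrite !indicE !mem_setE ut vt mulr1 mul1r; exact: normr_ip.
Qed.

Lemma cov_kernel0 u v : (u \notin `[0, t]) || (v \notin `[0, t]) ->
  cov_kernel u v = 0.
Proof.
rewrite /cov_kernel => /orP[ut|vt].
  rewrite (_ : (fun x => alpha (u, x)) = fun=> 0) ?ip0l//.
  by apply/funext => x; rewrite a0.
rewrite ipC (_ : (fun x => alpha' (v, x)) = fun=> 0) ?ip0l//.
by apply/funext => x; rewrite a0'.
Qed.

End covariance_kernel.

(** * Expectation of a product of two Ito processes *)

Section ito_product.
Context (R : realType) (d : measure_display) (Omega : measurableType d).
Context (P : probability Omega R) (F : R -> set (set Omega)).
Local Notation la := (@lebesgue_measure R).
Local Notation LP := (la \x P)%E.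

(** The decomposition into drift and martingale part, almost surely at each fixed time. The
    martingale property compares [M v] only with the terminal [M t], in the weak form tested against
    square-integrable variables of [F v]. *)
Definition ito_process (t x0 : R) (X M : R -> Omega -> R) (alpha : R * Omega -> R) : Prop :=
  [/\ sqint LP alpha, forall u, sqint P (fun x => alpha (u, x)),
      forall u x, u \notin `[0, t] -> alpha (u, x) = 0 &
      forall v, 0 <= v -> v <= t ->
        [/\ sqint P (X v), sqint P (M v) /\ ip P (fun=> 1) (M v) = 0,
            {ae P, forall x, X v x = x0 + tint alpha v x + M v x},
            measurable_wrt (F v) (fun x => alpha (v, x)) &
            forall xi, measurable_wrt (F v) xi -> sqint P xi ->
              ip P xi (M t) = ip P xi (M v)]].

Lemma ip_ito_process t x0 X M alpha v xi : 0 <= v -> v <= t ->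
  ito_process t x0 X M alpha -> sqint P xi ->
  ip P xi (X v) = x0 * ip P (fun=> 1) xi +
    \int[la]_(u in `[0, v]) ip P xi (fun x => alpha (u, x)) + ip P xi (M v).
Proof.
move=> v0 vt [sa sau a0 /(_ v v0 vt)[sX [sM _] XE _ _]] sxi.
have st := sqint_tint v0 sa; have s1 := sqint_cst P 1.
rewrite -(ip_tint v0 sa sxi).2 ipC [in RHS]ipC.
rewrite (@ae_eq_ip _ _ _ P _ (fun x => x0 * 1 + tint alpha v x + M v x)).
- rewrite ipDl//; last by apply: sqintD => //; exact: sqintZ.
  rewrite ipDl//; last exact: sqintZ.
  rewrite ipZl//.
  by rewrite [ip P xi (fun=> 1)]ipC [ip P xi (tint _ _)]ipC [ip P xi (M v)]ipC.
- exact: sX.1.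
- apply: measurable_funD; last exact: sM.1.
  by apply: measurable_funD; [exact: measurable_cst|exact: st.1].
- exact: sxi.1.
- by apply: filterS XE => x ->; rewrite mulr1.
Qed.

(* With c(u,v) = E[alpha_u alpha'_v], orthogonality of martingale increments
   to the past expresses E[X_t alpha'_v] and E[M'_t alpha_v] through X_v, X'_v
   and partial integrals of c, which cancel by Fubini on a triangle. *)
Lemma ito_process_product t x0 x0' X M alpha X' M' alpha' : 0 <= t ->
  ito_process t x0 X M alpha -> ito_process t x0' X' M' alpha' ->
  ip P (X t) (X' t) = x0 * x0' +
    \int[la]_(v in `[0, t]) (ip P (X v) (fun x => alpha' (v, x)) +
                             ip P (fun x => alpha (v, x)) (X' v)) +
    ip P (M t) (M' t).
Proof.
move=> t0 I I'; have [sa sau a0 H] := I; have [sa' sau' a0' H'] := I'.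
have [sX [sM M0] _ _ _] := H t t0 (lexx _).
have [sX' [sM' M0'] _ _ _] := H' t t0 (lexx _).
have s1 := sqint_cst P 1.
pose c := cov_kernel P alpha alpha'.
have ic := integrable_cov_kernel t0 sa sa' sau sau' a0 a0'.
have c0 : forall u v, (u \notin `[0, t]) || (v \notin `[0, t]) -> c u v = 0.
  exact: cov_kernel0.
have [ig ig'] := triangle_integrable ic c0; have tri := triangle_integral ic c0.
rewrite -/c in ig ig' tri.
pose h v := \int[la]_(u in `[0, t]) c u v.
pose g v := \int[la]_(u in `[0, v]) c u v.
pose g' v := \int[la]_(u in `[0, v]) c v u.
pose I1 v := ip P (X t) (fun x => alpha' (v, x)).
pose I2 v := ip P (M' t) (fun x => alpha (v, x)).
pose I3 v := ip P (fun=> 1) (fun x => alpha (v, x)).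
have [i1 _] := ip_tint t0 sa' sX; rewrite -/I1 in i1.
have [i2 _] := ip_tint t0 sa sM'; rewrite -/I2 in i2.
have [i3 _] := ip_tint t0 sa s1; rewrite -/I3 in i3.
have hE v : h v = ip P (tint alpha t) (fun x => alpha' (v, x)).
  rewrite ipC (ip_tint t0 sa (sau' v)).2.
  by apply: eq_Rintegral => u _; rewrite /c /cov_kernel ipC.
have [ih _] := ip_tint t0 sa' (sqint_tint t0 sa).
have {}ih : la.-integrable `[0, t] (EFin \o h).
  by apply: eq_integrable ih => // v _ /=; rewrite hE.
have E0 := ip_ito_process t0 (lexx _) I' sX.
have E1 := ip_ito_process t0 (lexx _) I sM'.
have E2 := ip_ito_process t0 (lexx _) I s1.
have one : ip P (fun=> 1) (fun=> 1) = 1.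
  by rewrite /ip Rintegral_cst// [X in fine X]probability_setT/= !mulr1.
rewrite one mulr1 M0 addr0 in E2.
rewrite M0' mulr0 add0r in E1.
rewrite E0 [ip P (X t) (M' t)]ipC E1 E2 [ip P (M t) (M' t)]ipC.
(* [h] integrates [c] over the whole interval, [g] and [g'] over the two triangular parts. Trading
   [M v] for [M t] leaves the remainder [g + g' - h], whose integral is 0 by [tri]. *)
have AB v : v \in `[0, t] -> ip P (X v) (fun x => alpha' (v, x)) +
    ip P (fun x => alpha (v, x)) (X' v) =
    I1 v + I2 v + x0' * I3 v + (g v + g' v - h v).
  rewrite in_itv/= => /andP[v0 vt].
  have [_ _ _ Fa mart] := H v v0 vt; have [_ _ _ Fa' mart'] := H' v v0 vt.
  have P1 := ip_ito_process t0 (lexx _) I (sau' v).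
  have P2 := ip_ito_process v0 vt I (sau' v).
  have P3 := ip_ito_process v0 vt I' (sau v).
  rewrite (mart _ Fa' (sau' v)) in P1.
  rewrite -(mart' _ Fa (sau v)) in P3.
  rewrite [ip P (X v) _]ipC P2 P3 /I1 [ip P (X t) _]ipC P1 /I2 [ip P (M' t) _]ipC /I3.
  have e1 : \int[la]_(u in `[0, t]) ip P (fun x => alpha' (v, x)) (fun x => alpha (u, x)) = h v.
    by apply: eq_Rintegral => u _; rewrite ipC.
  have e2 : \int[la]_(u in `[0, v]) ip P (fun x => alpha' (v, x)) (fun x => alpha (u, x)) = g v.
    by apply: eq_Rintegral => u _; rewrite ipC.
  rewrite e1 e2; rewrite /g' /c /cov_kernel; ring.
have mt : @measurable _ (measurableTypeR R) `[0, t]%classic by exact: measurable_itv.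
have iD (f1 f2 : R -> R) : la.-integrable `[0, t] (EFin \o f1) ->
  la.-integrable `[0, t] (EFin \o f2) ->
  la.-integrable `[0, t] (EFin \o (fun v => f1 v + f2 v)).
  by move=> f1i f2i; have := integrableD mt f1i f2i.
have iB (f1 f2 : R -> R) : la.-integrable `[0, t] (EFin \o f1) ->
  la.-integrable `[0, t] (EFin \o f2) ->
  la.-integrable `[0, t] (EFin \o (fun v => f1 v - f2 v)).
  by move=> f1i f2i; have := integrableB mt f1i f2i.
have i3' : la.-integrable `[0, t] (EFin \o (fun v => x0' * I3 v)).
  by have := integrableZl mt x0' i3.
rewrite [\int[la]_(v in `[0, t]) (_ + _)](_ : _ = \int[la]_(v in `[0, t])
    (I1 v + I2 v + x0' * I3 v + (g v + g' v - h v))); last first.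
  by apply: eq_Rintegral => v; rewrite inE/=; exact: AB.
have igg := iD _ _ ig ig'; have igh := iB _ _ igg ih.
have i12 := iD _ _ i1 i2; have i123 := iD _ _ i12 i3'.
have S (f : R -> R) : exists r, Rintegral la `[0, t] f = r by eexists.
have [S1 E_1] := S I1; have [S2 E_2] := S I2; have [S3 E_3] := S I3.
have [Sg E_g] := S g; have [Sg' E_g'] := S g'; have [Sh E_h] := S h.
have -> : \int[la]_(v in `[0, t]) (I1 v + I2 v + x0' * I3 v + (g v + g' v - h v)) =
    S1 + S2 + x0' * S3 + (Sg + Sg' - Sh).
  transitivity (Rintegral la `[0, t] (fun v => I1 v + I2 v + x0' * I3 v) +
    Rintegral la `[0, t] (fun v => g v + g' v - h v)).
    exact: (RintegralD mt i123 igh).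
  congr (_ + _).
    transitivity (Rintegral la `[0, t] (fun v => I1 v + I2 v) +
      Rintegral la `[0, t] (fun v => x0' * I3 v)).
      exact: (RintegralD mt i12 i3').
    by rewrite -E_1 -E_2 -E_3; congr (_ + _); [exact: (RintegralD mt i1 i2)|
      exact: (RintegralZl x0' mt i3)].
  transitivity (Rintegral la `[0, t] (fun v => g v + g' v) - Rintegral la `[0, t] h).
    exact: (RintegralB mt igg ih).
  by rewrite E_h -E_g -E_g'; congr (_ - _); exact: (RintegralD mt ig ig').
have {}tri : Sh = Sg + Sg' by rewrite -E_h -E_g -E_g'; exact: tri.
rewrite tri subrr addr0.
have -> : \int[la]_(u in `[0, t]) ip P (fun=> 1) (fun x => alpha (u, x)) = S3 := E_3.
have -> : \int[la]_(u in `[0, t]) ip P (X t) (fun x => alpha' (u, x)) = S1 := E_1.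
have -> : \int[la]_(u in `[0, t]) ip P (M' t) (fun x => alpha (u, x)) = S2 := E_2.
ring.
Qed.

End ito_product.

(** * The second moment of the fundamental solution *)

Section second_moment.
Context (R : realType) (n m : nat).
Context (d : measure_display) (Omega : measurableType d) (P : probability Omega R).
Context (F : R -> set (set Omega)) (w : 'I_m -> R -> Omega -> R).
Context (A : 'M[R]_n) (N : 'I_m -> 'M[R]_n) (Phi : R -> Omega -> 'M[R]_n).
Hypotheses (HF : filtration F) (Hw : wiener_process P F w)
  (HPhi : fundamental_solution P F w A N Phi).
Local Notation la := (@lebesgue_measure R).
Local Notation LP := (la \x P)%E.

Let phi (t : R) (a b : 'I_n) (x : Omega) : R := Phi t x a b.
Let PhiT (t : R) (a b : 'I_n) : R * Omega -> R := restr t (fun p => Phi p.1 p.2 a b).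

Let phi_wrt v a b : 0 <= v -> measurable_wrt (F v) (phi v a b).
Proof. by case: HPhi => _ + _ _ v0; exact. Qed.

Let phi_meas v a b : 0 <= v -> measurable_fun setT (phi v a b).
Proof. by move=> v0; apply: (measurable_wrt_measurable HF v0); exact: phi_wrt. Qed.

Let sqint_PhiT t a b : 0 <= t -> sqint LP (PhiT t a b).
Proof.
case: HPhi => mes _ L2 _ t0; apply: (sqint_restr_process (X := fun v x => Phi v x a b) (mes a b)).
exact: L2.
Qed.

Let drift (t : R) (a b : 'I_n) (p : R * Omega) : R := \sum_e A a e * PhiT t e b p.

Let sqint_drift t a b : 0 <= t -> sqint LP (drift t a b).
Proof. by move=> t0; apply: sqint_sum => e; apply: sqintZ; exact: sqint_PhiT. Qed.

Let PhiT_in t v x a b : 0 <= v -> v <= t -> PhiT t a b (v, x) = phi v a b x.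
Proof. by move=> v0 vt; rewrite /PhiT /restr indicE mem_setE in_itv/= v0 vt mulr1. Qed.

Let PhiT_out t v x a b : v \notin `[0, t] -> PhiT t a b (v, x) = 0.
Proof. by move=> vt; rewrite /PhiT /restr indicE mem_setE (negbTE vt) mulr0. Qed.

Let restr_restr v t a b : v <= t -> restr v (PhiT t a b) = PhiT v a b.
Proof.
move=> vt; apply/funext => -[u x]; rewrite /PhiT /restr !indicE !mem_setE /= !in_itv/=.
case: (0 <= u) => /=; last by rewrite !mulr0.
have [uv|uv] := leP u v; last by rewrite !mulr0.
by rewrite (le_trans uv vt) mulr1.
Qed.

Let mxint_drift t v x a b : v <= t ->
  mxint v (fun u => A *m Phi u x) a b = tint (drift t a b) v x.
Proof.
move=> vt; rewrite /mxint mxE /tint; apply: eq_Rintegral => u.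
rewrite inE/= in_itv/= => /andP[u0 uv].
rewrite mxE /drift; apply: eq_bigr => e _.
by rewrite PhiT_in// (le_trans uv vt).
Qed.

Let Jex : exists J : R -> 'I_m -> Omega -> 'M[R]_n, forall t, 0 <= t ->
  (forall k a b, ito_integral P F (w k) t
     (fun v omega => Phi v omega a b) (fun omega => J t k omega a b)) /\
  {ae P, forall omega, Phi t omega =
     1%:M + mxint t (fun v => A *m Phi v omega) + \sum_k N k *m J t k omega}.
Proof.
case: HPhi => _ _ _ eqn.
have H t : exists Jt : 'I_m -> Omega -> 'M[R]_n, 0 <= t ->
  (forall k a b, ito_integral P F (w k) t
     (fun v omega => Phi v omega a b) (fun omega => Jt k omega a b)) /\
  {ae P, forall omega, Phi t omega =
     1%:M + mxint t (fun v => A *m Phi v omega) + \sum_k N k *m Jt k omega}.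
  have [t0|t0] := boolP (0 <= t).
    by have [J HJ] := eqn t t0; exists J.
  (* A dummy value at negative times, so that [choice] yields one total function. *)
  by exists (fun _ _ => 0).
by have [J HJ] := choice H; exists J.
Qed.

Let J := projT1 (cid Jex).
Let HJ := projT2 (cid Jex).

Let ito_J k t a b : 0 <= t ->
  ito_pair P F w k t (PhiT t a b) (fun x => J t k x a b).
Proof.
move=> t0; have [/(_ k a b) IJ _] := HJ t0; case: HPhi => mes _ L2 _.
by apply: (ito_integral_pair HF Hw (X := fun v x => Phi v x a b) (mes a b) _ IJ); exact: L2.
Qed.

Let mart (t : R) (a b : 'I_n) (x : Omega) : R := \sum_k \sum_e N k a e * J t k x e b.

Let sqint_J k t a b : 0 <= t -> sqint P (fun x => J t k x a b).
Proof. by move=> t0; have [] := ito_J k a b t0. Qed.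

Let sqint_mart t a b : 0 <= t -> sqint P (mart t a b).
Proof.
move=> t0; apply: sqint_sum => k; apply: sqint_sum => e; apply: sqintZ.
exact: sqint_J.
Qed.

Let ip_mart t a b xi : 0 <= t -> sqint P xi ->
  ip P xi (mart t a b) = \sum_k \sum_e N k a e * ip P xi (fun x => J t k x e b).
Proof.
move=> t0 sxi; rewrite ip_sumr//; last first.
  by move=> k; apply: sqint_sum => e; apply: sqintZ; exact: sqint_J.
apply: eq_bigr => k _; rewrite ip_sumr//; last by move=> e; apply: sqintZ; exact: sqint_J.
by apply: eq_bigr => e _; rewrite ipZr//; exact: sqint_J.
Qed.

Let phi_eq v a b : 0 <= v ->
  {ae P, forall x, phi v a b x = (a == b)%:R + tint (drift v a b) v x + mart v a b x}.
Proof.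
move=> v0; have [_] := HJ v0; apply: filterS => x Hx.
rewrite /phi Hx [LHS]mxE [X in X + _]mxE [X in X + _ + _]mxE (@mxint_drift v)//; congr (_ + _).
rewrite summxE; apply: eq_bigr => k _; rewrite mxE; exact: eq_bigr.
Qed.

Let sqint_phi v a b : 0 <= v -> sqint P (phi v a b).
Proof.
move=> v0.
apply: (ae_eq_sqint (f := fun x => (a == b)%:R + tint (drift v a b) v x + mart v a b x)).
- exact: phi_meas.
- by apply: filterS (phi_eq a b v0) => x ->.
- apply: sqintD; last exact: sqint_mart.
  by apply: sqintD; [exact: sqint_cst|apply: sqint_tint => //; exact: sqint_drift].
Qed.

Let drift_in t v x a b : 0 <= v -> v <= t ->
  drift t a b (v, x) = \sum_e A a e * phi v e b x.
Proof. by move=> v0 vt; apply: eq_bigr => e _; rewrite PhiT_in. Qed.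

Let drift_out t v x a b : v \notin `[0, t] -> drift t a b (v, x) = 0.
Proof. by move=> vt; rewrite /drift big1// => e _; rewrite PhiT_out// mulr0. Qed.

Let sqint_drift_section t v a b : sqint P (fun x => drift t a b (v, x)).
Proof.
have [vt|vt] := boolP (v \in `[0, t]); last first.
  rewrite (_ : (fun x => _) = fun=> 0); first exact: sqint0.
  by apply/funext => x; rewrite drift_out.
move: vt; rewrite in_itv/= => /andP[v0 vt].
rewrite (_ : (fun x => _) = fun x => \sum_e A a e * phi v e b x).
  by apply: sqint_sum => e; apply: sqintZ; exact: sqint_phi.
by apply/funext => x; rewrite drift_in.
Qed.

(** The integrals [J t] are chosen separately for each [t]. The martingale lemma links them, because
    the integrand of [J t] cut at [v] is that of [J v]. *)
Let ito_phi t a b : 0 <= t ->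
  ito_process P F t (a == b)%:R (fun v => phi v a b) (fun v => mart v a b) (drift t a b).
Proof.
move=> t0; split.
- exact: sqint_drift.
- by move=> u; exact: sqint_drift_section.
- by move=> u x; exact: drift_out.
move=> v v0 vt; split.
- exact: sqint_phi.
- split; first exact: sqint_mart.
  rewrite ip_mart//; last exact: sqint_cst.
  rewrite big1// => k _; rewrite big1// => e _.
  by rewrite (ito_pair_mean HF Hw (ito_J k e b v0)) mulr0.
- apply: filterS (phi_eq a b v0) => x ->; congr (_ + _ + _).
  by rewrite -(@mxint_drift t)// -(@mxint_drift v).
- rewrite (_ : (fun x => _) = fun x => \sum_e A a e * phi v e b x); last first.
    by apply/funext => x; rewrite drift_in.
  apply/(measurable_wrtP HF _ v0); apply: measurable_sum => e.
  by apply: measurable_funM => //; apply/(measurable_wrtP HF _ v0); exact: phi_wrt.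
- move=> xi Fxi sxi; rewrite !ip_mart//.
  apply: eq_bigr => k _; apply: eq_bigr => e _; congr (_ * _).
  apply: (ito_pair_martingale HF Hw v0 (ito_J k e b t0)) => //.
  by rewrite restr_restr//; exact: ito_J.
Qed.

(** This is E[Phi_t E_bc Phi_t^T] for the elementary matrix E_bc, from which E[Phi_t K Phi_t^T] is
    later assembled by linearity in [K]. *)
Definition second_moment (b c : 'I_n) (t : R) : 'M[R]_n :=
  \matrix_(a, e) ip P (fun x => Phi t x a b) (fun x => Phi t x e c).

Let ip_PhiT t a b e c : 0 <= t ->
  la.-integrable `[0, t] (EFin \o (fun v => second_moment b c v a e)) /\
  ip LP (PhiT t a b) (PhiT t e c) = \int[la]_(v in `[0, t]) second_moment b c v a e.
Proof.
move=> t0; have [i1 E1] := Rintegral_prod12 (sqint_int (sqint_PhiT a b t0) (sqint_PhiT e c t0)).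
have E v : \int[P]_x (PhiT t a b (v, x) * PhiT t e c (v, x)) =
    ((fun v => second_moment b c v a e) \_ `[0, t]) v.
  rewrite patchE mem_setE; case: (boolP (_ \in _)) => [|vt].
    rewrite in_itv/= => /andP[v0 vt]; rewrite mxE.
    by apply: eq_Rintegral => x _; rewrite !PhiT_in.
  by rewrite /Rintegral integral0_eq// => x _; rewrite !PhiT_out// mul0r.
split.
  apply/integrable_mkcond => //; apply: eq_integrable i1 => // v _ /=.
  by rewrite E !patchE; case: ifP.
rewrite /ip E1 [RHS]Rintegral_mkcond; apply: eq_Rintegral => v _.
by rewrite E.
Qed.

Lemma integrable_second_moment b c a e t : 0 <= t ->
  la.-integrable `[0, t] (EFin \o (fun v => second_moment b c v a e)).
Proof. by move=> t0; have [] := ip_PhiT a b e c t0. Qed.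

(** The isometry makes integrals against different components of [w] orthogonal; the diagonal terms
    give the integral of the N_k X N_k^T, with X the second moment. *)
Let ip_mart_mart t a b e c : 0 <= t ->
  ip P (mart t a b) (mart t e c) =
  \sum_k \sum_i \sum_j N k a i * N k e j *
    \int[la]_(v in `[0, t]) second_moment b c v i j.
Proof.
move=> t0; rewrite ip_mart//; last exact: sqint_mart.
rewrite (eq_bigr (fun k => \sum_j \sum_i N k a i * N k e j *
    \int[la]_(v in `[0, t]) second_moment b c v i j)); last first.
  move=> k _; apply: eq_bigr => j _.
  rewrite ipC ip_mart//; last exact: sqint_J.
  rewrite (bigD1 k)//= [X in _ + X]big1 ?addr0; last first.
    move=> k' k'k; rewrite big1// => i _.
    rewrite (ito_pair_isometry HF Hw (ito_J k j c t0) (ito_J k' i b t0)).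
    by rewrite eq_sym (negbTE k'k) mul0r mulr0.
  rewrite mulr_sumr; apply: eq_bigr => i _.
  rewrite (ito_pair_isometry HF Hw (ito_J k j c t0) (ito_J k i b t0)) eqxx mul1r.
  by rewrite ipC (ip_PhiT i b j c t0).2 mulrA [N k e j * _]mulrC.
by apply: eq_bigr => k _; rewrite exchange_big.
Qed.


Let Rintegral_lin (I : Type) (s : seq I) (D : set R) (f : I -> R -> R) (c : I -> R) :
  @measurable _ (measurableTypeR R) D ->
  (forall i, la.-integrable D (EFin \o f i)) ->
  la.-integrable D (EFin \o (fun v => \sum_(i <- s) c i * f i v)) /\
  \int[la]_(v in D) (\sum_(i <- s) c i * f i v) =
  \sum_(i <- s) c i * \int[la]_(v in D) f i v.
Proof.
move=> mD fi.
have cfi i : la.-integrable D (EFin \o (fun v => c i * f i v)).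
  by have := integrableZl mD (c i) (fi i).
elim: s => [|i s [ih1 ih2]].
  split.
    rewrite (_ : _ \o _ = cst 0%E); first exact: integrable0.
    by apply/funext => v /=; rewrite big_nil.
  rewrite big_nil /Rintegral integral0_eq// => v _; by rewrite big_nil.
have E : (fun v => \sum_(i <- i :: s) c i * f i v) =
    (fun v => c i * f i v + \sum_(i <- s) c i * f i v).
  by apply/funext => v; rewrite big_cons.
rewrite E; split; first by have := integrableD mD (cfi i) ih1.
rewrite big_cons -ih2 -(RintegralZl (c i) mD (fi i)).
exact: (RintegralD mD (cfi i) ih1).
Qed.

(** In the product rule the drifts contribute A X + X A^T and the martingale parts the sum of the
    N_k X N_k^T. The identity stays in integrated form, since continuity in [t] is not yet known. *)
Lemma second_moment_eq b c a e t : 0 <= t ->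
  la.-integrable `[0, t] (EFin \o (fun v => lyap A N (second_moment b c v) a e)) /\
  second_moment b c t a e = (delta_mx b c : 'M[R]_n) a e +
    \int[la]_(v in `[0, t]) lyap A N (second_moment b c v) a e.
Proof.
move=> t0; pose sm i j v := second_moment b c v i j.
have ism i j : la.-integrable `[0, t] (EFin \o sm i j).
  exact: integrable_second_moment.
have mt : @measurable _ (measurableTypeR R) `[0, t]%classic by exact: measurable_itv.
have [i1 I1] := Rintegral_lin (index_enum 'I_n) (fun j => A e j) mt (fun j => ism a j).
have [i2 I2] := Rintegral_lin (index_enum 'I_n) (fun i => A a i) mt (fun i => ism i e).
have [i3 I3] := Rintegral_lin (index_enum ('I_m * 'I_n * 'I_n)%type)
  (fun q => N q.1.1 a q.1.2 * N q.1.1 e q.2) mt (fun q => ism q.1.2 q.2).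
have LE v : lyap A N (second_moment b c v) a e =
    \sum_i A a i * sm i e v + \sum_j A e j * sm a j v +
    \sum_(q : 'I_m * 'I_n * 'I_n) N q.1.1 a q.1.2 * N q.1.1 e q.2 * sm q.1.2 q.2 v.
  rewrite /lyap mxE [X in X + _]mxE [X in X + _ + _]mxE; congr (_ + _ + _).
    by rewrite mxE; apply: eq_bigr => j _; rewrite [A^T _ _]mxE mulrC.
  rewrite summxE -(pair_bigA _ (fun p j => N p.1 a p.2 * N p.1 e j * sm p.2 j v))/=.
  rewrite -(pair_bigA _ (fun k i => \sum_j N k a i * N k e j * sm i j v))/=.
  apply: eq_bigr => k _; rewrite mxE.
  rewrite exchange_big/=; apply: eq_bigr => j _.
  rewrite !mxE mulr_suml; apply: eq_bigr => i _; rewrite /sm; ring.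
have iD (f1 f2 : R -> R) : la.-integrable `[0, t] (EFin \o f1) ->
  la.-integrable `[0, t] (EFin \o f2) ->
  la.-integrable `[0, t] (EFin \o (fun v => f1 v + f2 v)).
  by move=> f1i f2i; have := integrableD mt f1i f2i.
have i21 := iD _ _ i2 i1; have i213 := iD _ _ i21 i3.
split; first by apply: eq_integrable i213 => // v _ /=; rewrite LE.
rewrite [LHS]mxE (ito_process_product t0 (ito_phi a b t0) (ito_phi e c t0)).
rewrite ip_mart_mart// mxE.
have -> : \int[la]_(v in `[0, t]) lyap A N (second_moment b c v) a e =
    \int[la]_(v in `[0, t]) (\sum_i A a i * sm i e v + \sum_j A e j * sm a j v) +
    \int[la]_(v in `[0, t]) (\sum_(q : 'I_m * 'I_n * 'I_n)
      N q.1.1 a q.1.2 * N q.1.1 e q.2 * sm q.1.2 q.2 v).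
  rewrite -[RHS](RintegralD mt i21 i3); apply: eq_Rintegral => v _; exact: LE.
rewrite addrA; congr (_ + _ + _).
- by rewrite -natrM mulnb.
- apply: eq_Rintegral => v; rewrite inE/= in_itv/= => /andP[v0 vt].
  rewrite addrC; congr (_ + _).
    rewrite (_ : (fun x => _) = fun x => \sum_i A a i * phi v i b x); last first.
      by apply/funext => x; rewrite drift_in.
    rewrite ip_suml; last 2 first.
    + by move=> i; apply: sqintZ; exact: sqint_phi.
    + exact: sqint_phi.
    apply: eq_bigr => i _; rewrite ipZl; last 2 first.
    + exact: sqint_phi.
    + exact: sqint_phi.
    by rewrite /sm mxE.
  rewrite (_ : (fun x => drift _ _ _ _) = fun x => \sum_j A e j * phi v j c x); last first.
    by apply/funext => x; rewrite drift_in.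
  rewrite ip_sumr; last 2 first.
  + by move=> i; apply: sqintZ; exact: sqint_phi.
  + exact: sqint_phi.
  apply: eq_bigr => i _; rewrite ipZr; last 2 first.
  + exact: sqint_phi.
  + exact: sqint_phi.
  by rewrite /sm mxE.
- rewrite I3 -(pair_bigA _ (fun p j => N p.1 a p.2 * N p.1 e j *
    \int[la]_(v in `[0, t]) sm p.2 j v))/=.
  by rewrite -(pair_bigA _ (fun k i => \sum_j N k a i * N k e j *
    \int[la]_(v in `[0, t]) sm i j v))/=.
Qed.

Lemma sqint_fundamental v a b : 0 <= v -> sqint P (fun x => Phi v x a b).
Proof. exact: sqint_phi. Qed.

End second_moment.

(** * Linear differential equations *)

Section smooth_halfline.
Variable R : realType.
Implicit Types (f g : R -> R) (s t c : R).

Definition C1_halfline f df : Prop :=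
  {within `[0, +oo[, continuous f} /\
  forall t, 0 < t -> is_derive t (1 : R) f (df t).

Lemma C1_halfline_cst c : C1_halfline (fun=> c) (fun=> 0).
Proof.
split=> [x|t _]; first exact: cvg_cst.
exact: is_derive_cst.
Qed.

Lemma C1_halflineD f df g dg : C1_halfline f df -> C1_halfline g dg ->
  C1_halfline (fun t => f t + g t) (fun t => df t + dg t).
Proof.
move=> [cf hf] [cg hg]; split=> [x|t t0].
  by apply: cvgD; [exact: cf|exact: cg].
exact: is_deriveD (hf t t0) (hg t t0).
Qed.

Lemma C1_halflineM f df g dg : C1_halfline f df -> C1_halfline g dg ->
  C1_halfline (fun t => f t * g t) (fun t => f t * dg t + g t * df t).
Proof.
move=> [cf hf] [cg hg]; split=> [x|t t0].
  by apply: cvgM; [exact: cf|exact: cg].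
exact: is_deriveM (hf t t0) (hg t t0).
Qed.

Lemma C1_halfline_ext f df dg : (forall t, 0 < t -> df t = dg t) ->
  C1_halfline f df -> C1_halfline f dg.
Proof. by move=> e [cf hf]; split=> // t t0; rewrite -e//; exact: hf. Qed.

Lemma C1_halflineZ c f df : C1_halfline f df ->
  C1_halfline (fun t => c * f t) (fun t => c * df t).
Proof.
move=> hf; apply: C1_halfline_ext (C1_halflineM (C1_halfline_cst c) hf).
by move=> t _; rewrite mulr0 addr0.
Qed.

Lemma C1_halfline_sum (I : Type) (r : seq I) (f df : I -> R -> R) :
  (forall i, C1_halfline (f i) (df i)) ->
  C1_halfline (fun t => \sum_(i <- r) f i t) (fun t => \sum_(i <- r) df i t).
Proof.
move=> hf; elim: r => [|i r ih].
  rewrite (_ : (fun t => _) = fun=> 0); last by apply/funext => t; rewrite big_nil.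
  rewrite (_ : (fun t => _) = fun=> 0); last by apply/funext => t; rewrite big_nil.
  exact: C1_halfline_cst.
rewrite (_ : (fun t => _) = fun t => f i t + \sum_(i <- r) f i t); last first.
  by apply/funext => t; rewrite big_cons.
rewrite (_ : (fun t => \sum_(i <- _ :: _) df i t) =
    fun t => df i t + \sum_(i <- r) df i t); last first.
  by apply/funext => t; rewrite big_cons.
exact: C1_halflineD.
Qed.

Lemma C1_halfline_expR c :
  C1_halfline (fun t => expR (c * t)) (fun t => c * expR (c * t)).
Proof.
split=> [|t _].
  apply: continuous_subspaceT => x; apply: (@continuous_comp _ _ _ (fun t => c * t) expR).
    by apply: cvgMr; exact: cvg_id.
  exact: continuous_expR.
have h : is_derive t (1 : R) (fun s => c * s) c.
  apply: (is_derive_eq (is_deriveZ c (is_derive_id t (1 : R)))).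
  by rewrite /GRing.scale/= mulr1.
by rewrite mulrC; exact: (is_derive1_comp (is_derive_expR _) h).
Qed.

Lemma C1_halfline_nonincreasing f df (T : R) : C1_halfline f df -> 0 <= T ->
  (forall t, T < t -> df t <= 0) -> forall s t, T <= s -> s <= t -> f t <= f s.
Proof.
move=> [cf hf] T0 df0 s t Ts st.
have s0 := le_trans T0 Ts.
have [||z zst E] := @MVT_segment R f df s t st.
- by move=> z; rewrite in_itv/= => /andP[sz _]; apply: hf; exact: le_lt_trans sz.
- apply: continuous_subspaceW cf => z /=; rewrite !in_itv/= andbT => /andP[sz _].
  exact: le_trans sz.
move: st; rewrite le_eqVlt => /predU1P[->//|st].
(* The sign of [df] is known only strictly beyond [T], hence an intermediate point in the open
   interval. *)
have [||z' z'st E'] := @MVT R f df s t st.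
- by move=> u; rewrite in_itv/= => /andP[su _]; apply: hf; exact: le_lt_trans su.
- apply: continuous_subspaceW cf => u /=; rewrite !in_itv/= andbT => /andP[su _].
  exact: le_trans su.
rewrite -subr_le0 E' mulr_le0_ge0// ?subr_ge0 ?(ltW st)//; apply: df0.
by move: z'st; rewrite in_itv/= => /andP[sz _]; exact: le_lt_trans sz.
Qed.

Lemma gronwall_decay (a : R) u du h : 0 < a -> C1_halfline u du ->
  (forall t, 0 <= u t) -> (forall t, 0 < t -> du t <= - a * u t + h t) ->
  h t @[t --> +oo] --> 0 -> u t @[t --> +oo] --> 0.
Proof.
move=> a0 hu u0 duh h0; apply/cvgrPdist_le => e e0.
have e20 : 0 < e / 2 by rewrite divr_gt0.
have /cvgrPdist_le/(_ (a * (e / 2)) (mulr_gt0 a0 e20)) := h0.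
(* The bound holds strictly beyond [T0], whence the [+ 1]; the maximum with 0 keeps [T] in the
   half-line. *)
move=> [T0 [_ hT0]]; pose T := Num.max 0 (T0 + 1).
have T_ge0 : 0 <= T by rewrite le_max lexx.
have hT t : T <= t -> h t <= a * (e / 2).
  move=> Tt; have /hT0 : T0 < t.
    by apply: lt_le_trans Tt; rewrite lt_max ltrDl ltr01 orbT.
  by rewrite sub0r normrN; apply: le_trans; exact: ler_norm.
(* [e / 2] is the equilibrium of [u' = - a u + a (e / 2)], so the shifted and rescaled function is
   nonincreasing beyond [T]. *)
pose v t := (u t + - (e / 2)) * expR (a * t).
have hv := C1_halflineM (C1_halflineD hu (C1_halfline_cst (- (e / 2))))
  (C1_halfline_expR a).
have dec t : T <= t -> v t <= v T.
  move=> Tt; apply: (C1_halfline_nonincreasing hv T_ge0 _ (lexx T) Tt) => z Tz.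
  have E0 := expR_gt0 (a * z).
  have := duh z (le_lt_trans T_ge0 Tz); have := hT z (ltW Tz) => H1 H2.
  rewrite [X in X <= 0](_ : _ = (du z + a * u z - a * (e / 2)) * expR (a * z)); last by ring.
  rewrite mulr_le0_ge0// ?(ltW E0)//; lra.
pose Cc := `|v T|.
have c0 : Cc * expR (- (a * t)) @[t --> +oo] --> 0.
  rewrite -(mulr0 Cc); apply: cvgMr.
  apply: (cvg_comp (fun t => a * t) (fun t => expR (- t))); last exact: cvgr_expR.
  apply: gt0_cvgMry => //; exact: cvg_id.
have /cvgrPdist_le/(_ _ e20) := c0; apply: filter_app.
near=> t => ct.
rewrite sub0r normrN ger0_norm//.
have Tt : T <= t by near: t; apply: nbhs_pinfty_ge; exact: num_real.
have := dec t Tt; rewrite /v => vt.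
have E0 := expR_gt0 (a * t).
have : u t + - (e / 2) <= Cc * expR (- (a * t)).
  rewrite expRN ler_pdivlMr//; apply: (le_trans vt); exact: ler_norm.
move: ct; rewrite sub0r normrN => /(le_trans (ler_norm _)); lra.
Unshelve. all: by end_near. Qed.

End smooth_halfline.

(** The characteristic polynomial splits into linear factors, and Cayley-Hamilton turns this into a
    vanishing product of matrices; it is kept as a fold over a list so that factors can be removed
    singly. *)
Lemma annihilating_eigenvalues (K : closedFieldType) (p : nat) (M : 'M[K]_p) :
  exists2 s : seq K, forall z, z \in s -> eigenvalue M z &
    foldr (fun z Q => Q *m (M - z%:M)) 1%:M s = 0.
Proof.
case: p M => [|p] M; first by exists [::] => //; apply/matrixP => -[].
have [s sE] := closed_field_poly_normal (char_poly M).
rewrite (monicP (char_poly_monic M)) scale1r in sE.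
exists s => [z zs|]; first by rewrite eigenvalue_root_char sE root_prod_XsubC.
transitivity (horner_mx M (char_poly M)); last exact: Cayley_Hamilton.
rewrite sE; elim: s {sE} => [|z s ih] /=; first by rewrite big_nil (rmorph1 (horner_mx M)).
rewrite big_cons mulrC rmorphM/= ih rmorphB/= horner_mx_X horner_mx_C.
by rewrite mulmxE.
Qed.

Lemma Rintegral_lincomb d (T : measurableType d) (R : realType)
    (mu : {measure set T -> \bar R}) (D : set T) (I : Type) (r : seq I)
    (c : I -> R) (f : I -> T -> R) : measurable D ->
  (forall i, mu.-integrable D (EFin \o f i)) ->
  mu.-integrable D (EFin \o (fun x => \sum_(i <- r) c i * f i x)) /\
  \int[mu]_(x in D) (\sum_(i <- r) c i * f i x) =
  \sum_(i <- r) c i * \int[mu]_(x in D) f i x.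
Proof.
move=> mD hf; elim: r => [|i r [ih1 ih2]].
  rewrite (_ : (fun x => _) = fun=> 0); last by apply/funext => x; rewrite big_nil.
  rewrite big_nil; split; first exact: integrable0.
  by rewrite Rintegral_cst// mul0r.
have hi : mu.-integrable D (EFin \o (fun x => c i * f i x)).
  rewrite (_ : _ \o _ = (fun x => (c i)%:E * (f i x)%:E)%E)//.
  exact: integrableZl (hf i).
rewrite (_ : (fun x => _) = fun x => c i * f i x + \sum_(j <- r) c j * f j x); last first.
  by apply/funext => x; rewrite big_cons.
split.
  exact: (integrableD mD hi ih1).
by rewrite RintegralD// RintegralZl// ih2 big_cons.
Qed.

Lemma cvg_finsum (R : realType) (T : Type) (G : set_system T) (FG : Filter G)
    (I : Type) (r : seq I) (f : I -> T -> R) (l : I -> R) :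
  (forall i, f i t @[t --> G] --> l i) ->
  \sum_(i <- r) f i t @[t --> G] --> \sum_(i <- r) l i.
Proof.
move=> fl; elim: r => [|i r ih].
  rewrite (_ : (fun t => _) = fun=> 0); last by apply/funext => x; rewrite big_nil.
  by rewrite big_nil; exact: cvg_cst.
rewrite (_ : (fun t => _) = fun t => f i t + \sum_(j <- r) f j t); last first.
  by apply/funext => x; rewrite big_cons.
by rewrite big_cons; apply: cvgD.
Qed.

(** * Uniqueness, decay and integrals of linear systems *)

Section linear_ode.
Context (R : realType) (p : nat) (M : 'M[R]_p).
Implicit Types x : R -> 'I_p -> R.

Definition linear_ode x : Prop := forall i,
  C1_halfline (fun t => x t i) (fun t => \sum_j M i j * x t j).

(** Energy estimate: as |x_j x_k| is at most u = |x|^2, one has u' at most 2 K u, with [K] the sum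
    of all absolute entries of [M]. Hence [v] is nonincreasing, and it starts at 0. *)
Lemma linear_ode_unique x : linear_ode x -> (forall i, x 0 i = 0) ->
  forall t i, 0 <= t -> x t i = 0.
Proof.
move=> hx x0 t i t0.
pose K := \sum_i \sum_j `|M i j|.
pose u t := \sum_i x t i * x t i.
pose v t := u t * expR (- (2 * K) * t).
have hu := C1_halfline_sum (index_enum 'I_p) (fun i => C1_halflineM (hx i) (hx i)).
have hv := C1_halflineM hu (C1_halfline_expR (- (2 * K))).
have sq_le j s : x s j * x s j <= u s.
  rewrite /u (bigD1 j)//= lerDl sumr_ge0// => k _; by rewrite -expr2 sqr_ge0.
have vt : v t <= v 0.
  apply: (C1_halfline_nonincreasing hv (lexx 0) _ (lexx 0) t0) => s s0.
  have E0 := expR_gt0 (- (2 * K) * s).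
  rewrite [X in X <= _](_ : _ = (\sum_j (x s j * \sum_k M j k * x s k +
     x s j * \sum_k M j k * x s k) - 2 * K * u s) * expR (- (2 * K) * s)); last first.
    by rewrite /u; ring.
  rewrite mulr_le0_ge0// ?(ltW E0)// subr_le0.
  have -> (U : R) : 2 * K * U = \sum_j \sum_k 2 * `|M j k| * U.
    rewrite /K mulr_sumr mulr_suml; apply: eq_bigr => j _.
    by rewrite mulr_sumr mulr_suml.
  apply: ler_sum => j _.
  rewrite [leLHS](_ : _ = \sum_k 2 * (M j k * (x s j * x s k))); last first.
    by rewrite -mulrDl mulr_sumr; apply: eq_bigr => k _; ring.
  apply: ler_sum => k _.
  rewrite -[leRHS]mulrA ler_wpM2l//; apply: (le_trans (ler_norm _)).
  rewrite normrM ler_wpM2l// normrM.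
  have := sq_le j s; have := sq_le k s.
  have -> : x s j * x s j = `|x s j| * `|x s j| by rewrite -normrM ger0_norm// -expr2 sqr_ge0.
  have -> : x s k * x s k = `|x s k| * `|x s k| by rewrite -normrM ger0_norm// -expr2 sqr_ge0.
  have := sqr_ge0 (`|x s j| - `|x s k|); nra.
have v0 : v 0 = 0 by rewrite /v /u big1 ?mul0r// => j _; rewrite x0 mulr0.
have := sq_le i t; rewrite v0 /v pmulr_lle0 ?expR_gt0// in vt => h.
have : x t i ^+ 2 <= 0 by rewrite expr2; exact: le_trans vt.
by rewrite real_exprn_even_le0 ?num_real// => /eqP.
Qed.

Local Notation C := R[i].
Local Notation MC := (map_mx (real_complex R) M).

(** Real and imaginary part of the complex scalar c x: eigenvalues may be complex while [x] is real,
    so each scalar complex equation is handled as a pair of real ones. *)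
Let re_part (c : 'rV[C]_p) x t : R := \sum_j complex.Re (c 0 j) * x t j.
Let im_part (c : 'rV[C]_p) x t : R := \sum_j complex.Im (c 0 j) * x t j.

Let vanishes x (c : 'rV[C]_p) : Prop :=
  re_part c x t @[t --> +oo] --> 0 /\ im_part c x t @[t --> +oo] --> 0.

Let ReD (a b : C) : complex.Re (a + b) = complex.Re a + complex.Re b.
Proof. by case: a; case: b. Qed.

Let ImD (a b : C) : complex.Im (a + b) = complex.Im a + complex.Im b.
Proof. by case: a; case: b. Qed.

Let Re_sum (I : Type) (r : seq I) (f : I -> C) :
  complex.Re (\sum_(i <- r) f i) = \sum_(i <- r) complex.Re (f i).
Proof.
by elim: r => [|i r ih]; rewrite ?big_nil// !big_cons ReD ih.
Qed.

Let Im_sum (I : Type) (r : seq I) (f : I -> C) :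
  complex.Im (\sum_(i <- r) f i) = \sum_(i <- r) complex.Im (f i).
Proof.
by elim: r => [|i r ih]; rewrite ?big_nil// !big_cons ImD ih.
Qed.

Let ReM_real (a : C) (b : R) : complex.Re (a * real_complex R b) = complex.Re a * b.
Proof. by case: a => a1 a2 /=; rewrite mulr0 subr0. Qed.

Let ImM_real (a : C) (b : R) : complex.Im (a * real_complex R b) = complex.Im a * b.
Proof. by case: a => a1 a2 /=; rewrite mulr0 add0r. Qed.

Let C1_part (pr : C -> R) x (c : 'rV[C]_p) : linear_ode x ->
  (forall (a : C) (b : R), pr (a * real_complex R b) = pr a * b) ->
  (forall (I : Type) (r : seq I) (f : I -> C),
    pr (\sum_(i <- r) f i) = \sum_(i <- r) pr (f i)) ->
  C1_halfline (fun t => \sum_j pr (c 0 j) * x t j)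
    (fun t => \sum_j pr ((c *m MC) 0 j) * x t j).
Proof.
move=> hx prM prS.
have h := C1_halfline_sum (index_enum 'I_p) (fun j => C1_halflineZ (pr (c 0 j)) (hx j)).
apply: C1_halfline_ext h => t _.
transitivity (\sum_i \sum_j pr (c 0 i) * M i j * x t j).
  by apply: eq_bigr => i _; rewrite mulr_sumr; apply: eq_bigr => j _; rewrite mulrA.
rewrite exchange_big/=; apply: eq_bigr => j _; rewrite mxE prS mulr_suml.
by apply: eq_bigr => i _; rewrite [MC _ _]mxE prM.
Qed.

(* u = |c x|^2 satisfies u' <= Re(l) u + h, where h tends to 0 with c (M - l) x. *)
Let vanishes_step x (c : 'rV[C]_p) (l : C) : linear_ode x -> complex.Re l < 0 ->
  vanishes x (c *m (MC - l%:M)) -> vanishes x c.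
Proof.
move=> hx l0 [qr qi]; set q := c *m (MC - l%:M) in qr qi.
have cM : c *m MC = q + l *: c.
  by rewrite /q mulmxBr mul_mx_scalar subrK.
have hre := C1_part c hx ReM_real Re_sum.
have him := C1_part c hx ImM_real Im_sum.
pose a := - complex.Re l; have a0 : 0 < a by rewrite oppr_gt0.
pose b := complex.Im l.
have dre t : \sum_j complex.Re ((c *m MC) 0 j) * x t j =
    re_part q x t - a * re_part c x t - b * im_part c x t.
  rewrite /re_part /im_part !mulr_sumr -!sumrB; apply: eq_bigr => j _.
  rewrite cM mxE ReD [(l *: c) 0 j]mxE /a /b.
  case: (c 0 j) => c1 c2; case: (q 0 j) => q1 q2; case: (l) => l1 l2 /=; ring.
have dim t : \sum_j complex.Im ((c *m MC) 0 j) * x t j =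
    im_part q x t - a * im_part c x t + b * re_part c x t.
  rewrite /re_part /im_part !mulr_sumr -sumrB -big_split/=; apply: eq_bigr => j _.
  rewrite cM mxE ImD [(l *: c) 0 j]mxE /a /b.
  case: (c 0 j) => c1 c2; case: (q 0 j) => q1 q2; case: (l) => l1 l2 /=; ring.
pose u t := re_part c x t * re_part c x t + im_part c x t * im_part c x t.
pose h t := (re_part q x t * re_part q x t + im_part q x t * im_part q x t) / a.
have hu := C1_halflineD (C1_halflineM hre hre) (C1_halflineM him him).
have u_ge0 t : 0 <= u t by rewrite addr_ge0// -expr2 sqr_ge0.
have h0 : h t @[t --> +oo] --> 0.
  rewrite [X in _ --> X](_ : 0 = (0 * 0 + 0 * 0) / a); last by rewrite !mulr0 addr0 mul0r.
  by apply: cvgMl; apply: cvgD; apply: cvgM.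
have uto0 : u t @[t --> +oo] --> 0.
  apply: (gronwall_decay a0 hu u_ge0 _ h0) => t _; rewrite dre dim /u /h.
  rewrite -/(re_part c x t) -/(im_part c x t).
  move: (re_part c x t) (im_part c x t) (re_part q x t) (im_part q x t) => X Y U V.
  have -> : (U * U + V * V) / a = a * ((U / a) ^+ 2 + (V / a) ^+ 2).
    by field; rewrite gt_eqF.
  rewrite -subr_ge0.
  (* The rotation terms in [b] cancel in the derivative of [u], and what separates the two sides is
     this completed square. *)
  rewrite (_ : _ - _ = a * ((X - U / a) ^+ 2 + (Y - V / a) ^+ 2)); last first.
    by field; rewrite gt_eqF.
  by rewrite mulr_ge0 ?(ltW a0)// addr_ge0// sqr_ge0.
have sq_cvg (f : R -> R) : (forall t, f t * f t <= u t) -> f t @[t --> +oo] --> 0.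
  move=> fu; apply/norm_cvg0P.
  have su : Num.sqrt (u t) @[t --> +oo] --> 0.
    rewrite -(@sqrtr0 R); exact: (continuous_cvg _ (@sqrt_continuous R _)).
  apply: (squeeze_cvgr _ (cvg_cst 0) su); apply: nearW => t.
  by rewrite normr_ge0/= -sqrtr_sqr ler_wsqrtr// expr2.
by split; apply: sq_cvg => t; rewrite ?lerDl ?lerDr -expr2 sqr_ge0.
Qed.

(* By Cayley-Hamilton every c is annihilated by the product of the M - z over
   the eigenvalues z, and these factors can be peeled off one at a time. *)
Lemma linear_ode_vanishes x : spectrum_in_Cminus M -> linear_ode x ->
  forall i, x t i @[t --> +oo] --> 0.
Proof.
move=> HM hx i.
have [s s_eig s0] := annihilating_eigenvalues MC.
suff : vanishes x (delta_mx 0 i).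
  move=> [+ _]; rewrite /re_part.
  rewrite (_ : (fun t => _) = fun t => x t i)//; apply/funext => t.
  rewrite (bigD1 i)//= mxE !eqxx mul1r big1 ?addr0// => j ji.
  by rewrite mxE eqxx (negPf ji) mul0r.
have : forall c, vanishes x (c *m foldr (fun z Q => Q *m (MC - z%:M)) 1%:M s).
  move=> c; rewrite s0 mulmx0; split.
    rewrite (_ : re_part _ _ = fun=> 0); first exact: cvg_cst.
    by apply/funext => t; rewrite /re_part big1// => j _; rewrite mxE mul0r.
  rewrite (_ : im_part _ _ = fun=> 0); first exact: cvg_cst.
  by apply/funext => t; rewrite /im_part big1// => j _; rewrite mxE mul0r.
elim: s s_eig {s0} => [|z s ih] s_eig /= h; first by have := h (delta_mx 0 i); rewrite mulmx1.
apply: ih => [y ys|c]; first by apply: s_eig; rewrite inE ys orbT.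
apply: (vanishes_step hx (l := z)); last by rewrite -mulmxA; exact: h.
by apply: HM; apply: s_eig; rewrite mem_head.
Qed.

Lemma spectrum_in_Cminus_unitmx : spectrum_in_Cminus M -> M \in unitmx.
Proof.
move=> HM; rewrite -row_free_unit -kermx_eq0; apply/negPn/negP => K0.
suff /HM : eigenvalue MC 0 by rewrite /= ltxx.
have /rowV0Pn[v /sub_kermxP vM v0] := K0.
apply/eigenvalueP; exists (map_mx (real_complex R) v).
  by rewrite -map_mxM vM map_mx0 scale0r.
by rewrite map_mx_eq0.
Qed.

Lemma linear_ode_integrable x j t : linear_ode x ->
  lebesgue_measure.-integrable `[0, t] (EFin \o (fun s => x s j)).
Proof.
move=> hx; apply: continuous_compact_integrable; first exact: segment_compact.
apply: continuous_subspaceW (hx j).1 => z /=; rewrite !in_itv/= andbT.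
by case/andP.
Qed.

Lemma linear_ode_integral x i : linear_ode x -> forall t, 0 <= t ->
  \int[lebesgue_measure]_(s in `[0, t]) (\sum_j M i j * x s j) = x t i - x 0 i.
Proof.
move=> hx t; rewrite le_eqVlt => /predU1P[<-|t0].
  by rewrite set_itv1 Rintegral_set1 subrr.
have [_ dx] := hx i.
have cf j : {within `[0, t], continuous (fun s => x s j)}.
  apply: continuous_subspaceW (hx j).1 => z /=; rewrite !in_itv/= andbT.
  by case/andP.
have /(continuous_within_itvP _ t0)[_ x_0 x_t] := cf i.
rewrite /Rintegral.
rewrite (@continuous_FTC2 _ _ (fun s => x s i) 0 t t0)//.
- have [cs _] := C1_halfline_sum (index_enum 'I_p) (fun j => C1_halflineZ (M i j) (hx j)).
  apply: continuous_subspaceW cs => z /=; rewrite !in_itv/= andbT.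
  by case/andP.
- split=> [z||] //; rewrite in_itv/= => /andP[z0 _]; by case: (dx z z0).
- move=> z; rewrite in_itv/= => /andP[z0 _]; rewrite derive1E.
  by case: (dx z z0).
Qed.

Lemma linear_ode_integral_cvg x : spectrum_in_Cminus M -> linear_ode x ->
  forall i, cvg (\int[lebesgue_measure]_(s in `[0, t]) x s i @[t --> +oo]).
Proof.
move=> HM hx i.
have uM := spectrum_in_Cminus_unitmx HM.
have xE t : 0 <= t -> \int[lebesgue_measure]_(s in `[0, t]) x s i =
    \sum_k invmx M i k * (x t k - x 0 k).
  move=> t0.
  transitivity ((invmx M *m (M *m
    (\col_j (\int[lebesgue_measure]_(s in `[0, t]) x s j)))) i 0).
    by rewrite mulKmx// mxE.
  rewrite mxE; apply: eq_bigr => k _; congr (_ * _).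
  rewrite -(linear_ode_integral k hx t0).
  have mt : @measurable _ (measurableTypeR R) `[0,t]%classic by exact: measurable_itv.
  have [_ ->] := Rintegral_lincomb (index_enum 'I_p) (M k) mt
    (fun j => linear_ode_integrable j t hx).
  by rewrite mxE; apply: eq_bigr => j _; rewrite mxE.
apply/cvg_ex; exists (\sum_k invmx M i k * (0 - x 0 k)).
have h : (\sum_k invmx M i k * (x t k - x 0 k)) @[t --> +oo] -->
    \sum_k invmx M i k * (0 - x 0 k).
  apply: cvg_finsum => k; apply: cvgMr; apply: cvgB; last exact: cvg_cst.
  exact: linear_ode_vanishes.
apply: cvg_trans h; apply: near_eq_cvg; near=> t; rewrite xE//.
Unshelve. all: by end_near. Qed.

End linear_ode.

(** * The Lyapunov equation *)

(** The identity vec(U X V^T) = (U tensor V) vec(X), for the vectorisation that lists entries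
    through [mxtens_index]. *)
Lemma tensmx_sandwich (R : comNzRingType) (n p q : nat) (U : 'M[R]_(p, n))
    (V : 'M[R]_(q, n)) (X : 'M[R]_n) i j :
  (U *m X *m V^T) i j =
  \sum_k (U *t V) (mxtens_index (i, j)) k *
    X (mxtens_unindex k).1 (mxtens_unindex k).2.
Proof.
rewrite (reindex (@mxtens_index n n)); last first.
  by exists (@mxtens_unindex n n) => k _; rewrite (mxtens_indexK, mxtens_unindexK).
transitivity (\sum_a \sum_b U i a * V j b * X a b); last first.
  rewrite pair_bigA; apply: eq_bigr => -[a b] _.
  by rewrite tensmxE mxtens_indexK.
rewrite exchange_big mxE; apply: eq_bigr => b _.
by rewrite !mxE mulr_suml; apply: eq_bigr => a _; rewrite mulrAC.
Qed.

Section lyapunov_equation.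
Context (R : realType) (n m : nat) (A : 'M[R]_n) (N : 'I_m -> 'M[R]_n).
Implicit Types (X : 'M[R]_n) (Z : R -> 'M[R]_n).
Local Notation K := (A *t 1%:M + 1%:M *t A + \sum_k (N k *t N k)).

Let vec Z t (k : 'I_(n * n)) : R := Z t (mxtens_unindex k).1 (mxtens_unindex k).2.

Let vecE Z t a b : vec Z t (mxtens_index (a, b)) = Z t a b.
Proof. by rewrite /vec mxtens_indexK. Qed.

(** Padding A X and X A^T with identities puts all terms in sandwich form; vectorised, the Lyapunov
    operator is the Kronecker matrix of the spectral condition. *)
Lemma lyap_tensE X i j : lyap A N X i j =
  \sum_k K (mxtens_index (i, j)) k * X (mxtens_unindex k).1 (mxtens_unindex k).2.
Proof.
rewrite /lyap -[A *m X in LHS]mulmx1 -[X *m A^T in LHS]mul1mx mulmxA.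
rewrite -[X in _ *m X + _ + _]trmx1 mxE [X in X + _]mxE !tensmx_sandwich summxE.
under [X in _ + X]eq_bigr do rewrite tensmx_sandwich.
rewrite exchange_big/= -!big_split/=; apply: eq_bigr => k _.
rewrite -mulr_suml -!mulrDl; congr (_ * _).
by rewrite [RHS]mxE [X in _ = X + _]mxE summxE.
Qed.

Lemma lyap_lincomb (I : Type) (r : seq I) (c : I -> R) (X : I -> 'M[R]_n) :
  lyap A N (\sum_(i <- r) c i *: X i) = \sum_(i <- r) c i *: lyap A N (X i).
Proof.
apply/matrixP => a b; rewrite lyap_tensE summxE.
under eq_bigr do rewrite summxE mulr_sumr.
rewrite exchange_big/=; apply: eq_bigr => i _; rewrite mxE lyap_tensE mulr_sumr/=.
by apply: eq_bigr => k _; rewrite [(_ *: X i) _ _]mxE mulrCA.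
Qed.

Lemma solves_lyapP (Z0 : 'M[R]_n) Z : solves_lyap A N Z0 Z <->
  Z 0 = Z0 /\ forall a b, C1_halfline (fun t => Z t a b) (fun t => lyap A N (Z t) a b).
Proof.
split=> [[Z0E cZ dZ]|[Z0E hZ]].
  by split=> // a b; split=> [|t t0]; [exact: cZ|exact: dZ].
by split=> // [a b|t t0 a b]; have [cZ dZ] := hZ a b; [exact: cZ|exact: dZ].
Qed.

Lemma solves_lyap_lincomb (I : Type) (r : seq I) (c : I -> R) (Z0 : I -> 'M[R]_n)
    (Z : I -> R -> 'M[R]_n) :
  (forall i, solves_lyap A N (Z0 i) (Z i)) ->
  solves_lyap A N (\sum_(i <- r) c i *: Z0 i) (fun t => \sum_(i <- r) c i *: Z i t).
Proof.
move=> hZ; apply/solves_lyapP; split.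
  by apply: eq_bigr => i _; have [-> _ _] := hZ i.
move=> a b.
have h := C1_halfline_sum r
  (fun i => C1_halflineZ (c i) (((solves_lyapP _ _).1 (hZ i)).2 a b)).
rewrite (_ : (fun t => _) = fun t => \sum_(i <- r) c i * Z i t a b); last first.
  by apply/funext => t; rewrite summxE; apply: eq_bigr => i _; rewrite mxE.
apply: C1_halfline_ext h => t _; rewrite lyap_lincomb summxE.
by apply: eq_bigr => i _; rewrite [RHS]mxE.
Qed.

Lemma solves_lyap_linear_ode (Z0 : 'M[R]_n) Z : solves_lyap A N Z0 Z -> linear_ode K (vec Z).
Proof.
move=> /solves_lyapP[_ hZ] k; apply: C1_halfline_ext (hZ _ _) => t _.
by rewrite lyap_tensE -surjective_pairing mxtens_unindexK.
Qed.

Lemma solves_lyap_unique (Z0 : 'M[R]_n) Z Z' : solves_lyap A N Z0 Z -> solves_lyap A N Z0 Z' ->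
  forall t, 0 <= t -> Z t = Z' t.
Proof.
move=> hZ hZ' t t0; pose W (i : bool) := if i then Z else Z'.
pose c (i : bool) : R := if i then 1 else -1.
have hW i : solves_lyap A N Z0 (W i) by case: i.
have /solves_lyap_linear_ode hD := solves_lyap_lincomb [:: true; false] c hW.
apply/matrixP => a b; apply/eqP; rewrite -subr_eq0; apply/eqP.
have E s : \sum_(i <- [:: true; false]) c i *: W i s = Z s - Z' s.
  by rewrite !big_cons big_nil addr0 scale1r scaleN1r.
have := fun h => linear_ode_unique hD h (mxtens_index (a, b)) t0.
rewrite vecE E [in X in (_ -> X) -> _]mxE [(- Z' t) a b]mxE; apply => k.
by rewrite /vec E; have [-> _ _] := hZ; have [-> _ _] := hZ'; rewrite subrr mxE.
Qed.

Lemma solves_lyap_integrable (Z0 : 'M[R]_n) Z a b t : solves_lyap A N Z0 Z ->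
  lebesgue_measure.-integrable `[0, t] (EFin \o (fun s => Z s a b)).
Proof.
move=> [_ cZ _]; apply: continuous_compact_integrable; first exact: segment_compact.
apply: continuous_subspaceW (cZ a b) => z /=; rewrite !in_itv/= andbT.
by case/andP.
Qed.

Lemma solves_lyap_mxint_cvg (Z0 : 'M[R]_n) Z : spectrum_in_Cminus K -> solves_lyap A N Z0 Z ->
  forall a b, cvg (mxint t Z a b @[t --> +oo]).
Proof.
move=> HK /solves_lyap_linear_ode hZ a b.
have := @linear_ode_integral_cvg _ _ _ _ HK hZ (mxtens_index (a, b)).
rewrite (_ : (fun t => _) = fun t => mxint t Z a b)//; apply/funext => t.
by rewrite mxE; apply: eq_Rintegral => s _; rewrite vecE.
Qed.

(** Bootstrap: an integral with integrable integrand is continuous in its upper end, so [Z] is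
    continuous; then so is the integrand, being linear in [Z], and the fundamental theorem of
    calculus gives the derivative. *)
Lemma integral_solves_lyap (Z0 : 'M[R]_n) Z :
  (forall a b t, 0 <= t ->
    lebesgue_measure.-integrable `[0, t] (EFin \o (fun s => lyap A N (Z s) a b)) /\
    Z t a b = Z0 a b + \int[lebesgue_measure]_(s in `[0, t]) lyap A N (Z s) a b) ->
  solves_lyap A N Z0 Z.
Proof.
move=> hZ; pose g a b s := lyap A N (Z s) a b.
have Zint a b t : 0 <= t ->
    {within `[0, t], continuous (fun s => Z s a b)}.
  move=> t0; have [ig _] := hZ a b t t0.
  have cI := parameterized_integral_continuous t0 ig.
  apply/subspace_continuousP => x xt.
  have /subspace_continuousP/(_ x xt) cx := cI.
  have [_ Zx] := hZ a b x (proj1 (andP xt)).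
  rewrite [X in _ --> X]Zx; apply: (cvg_trans _ (cvgD (cvg_cst (Z0 a b)) cx)).
  apply: near_eq_cvg; rewrite near_withinE; near=> s => st.
  by have [_ Zs] := hZ a b s (proj1 (andP st)); exact: esym.
have cZ a b : {within `[0, +oo[, continuous (fun t => Z t a b)}.
  apply/subspace_continuousP => x /=; rewrite in_itv/= andbT => x0.
  (* In [0, x + 1] the point [x] has room on its right, so continuity within this segment gives
     continuity within the half-line. *)
  have x1 : 0 <= x + 1 by rewrite addr_ge0.
  have /subspace_continuousP/(_ x) := Zint a b (x + 1) x1.
  rewrite /= in_itv/= x0 lerDl ler01 => /(_ isT); apply: cvg_trans.
  apply: cvg_app => U; rewrite !nbhs_simpl /within/=; apply: filter_app.
  have : \forall s \near x, s \in `]-oo, (x + 1)[.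
    by apply: near_in_itvNyo; rewrite in_itv/= ltrDl.
  apply: filter_app; near=> s => /=; rewrite !in_itv/= => /ltW s1 Us.
  by rewrite andbT => s0; apply: Us; rewrite s0 s1.
apply/solves_lyapP; split.
  apply/matrixP => a b; have [_ ->] := hZ a b 0 (lexx 0).
  by rewrite set_itv1 Rintegral_set1 addr0.
move=> a b; split=> [|t t0]; first exact: cZ.
have t1 : t < t + 1 by rewrite ltrDl.
have ctZ c e : {for t, continuous (fun s => Z s c e)}.
  apply: (within_continuous_continuous _ (Zint c e (t + 1) _)); rewrite ?in_itv/= ?t0//.
  - exact: lt_trans t1.
  - exact: ltW (lt_trans t0 t1).
have cg : {for t, continuous (g a b)}.
  rewrite (_ : g a b = fun s => \sum_k K (mxtens_index (a, b)) k * vec Z s k).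
    by apply: cvg_finsum => k; apply: cvgMr; exact: ctZ.
  by apply/funext => s; rewrite /g lyap_tensE.
have [ig _] := hZ a b (t + 1) (ltW (lt_trans t0 t1)).
have [dI vI] := continuous_FTC1_closed t1 ig t0 cg.
have dZ : is_derive t (1 : R)
    (fun s => Z0 a b + \int[lebesgue_measure]_(v in `[0, s]) g a b v) (g a b t).
  apply: (is_derive_eq (is_deriveD (is_derive_cst _ _ _) (DeriveDef dI _))).
    by rewrite -derive1E; exact: vI.
  by rewrite add0r.
apply: near_eq_is_derive dZ; near=> s.
have s0 : 0 <= s.
  apply: ltW; near: s; exact: lt_nbhsr.
by have [_ Zs] := hZ a b s s0; exact: esym.
Unshelve. all: by end_near. Qed.

End lyapunov_equation.

(** * Operator norms *)

Section operator_norm.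
Context (R : realType).
Implicit Types (p q : nat).

Lemma sqr_enorm p (x : 'cV[R]_p) : enorm x ^+ 2 = \sum_i x i 0 ^+ 2.
Proof. by rewrite sqr_sqrtr// sumr_ge0// => i _; exact: sqr_ge0. Qed.

Lemma enorm_ge0 p (x : 'cV[R]_p) : 0 <= enorm x.
Proof. exact: sqrtr_ge0. Qed.

Lemma enorm0 p : enorm (0 : 'cV[R]_p) = 0.
Proof.
by rewrite /enorm big1 ?sqrtr0// => i _; rewrite mxE expr0n.
Qed.

Lemma enormZ p (a : R) (x : 'cV[R]_p) : enorm (a *: x) = `|a| * enorm x.
Proof.
apply/eqP; rewrite -(@eqrXn2 _ 2)// ?mulr_ge0 ?enorm_ge0//.
rewrite exprMn !sqr_enorm real_normK ?num_real// mulr_sumr.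
by apply/eqP; apply: eq_bigr => i _; rewrite mxE exprMn.
Qed.

Lemma enorm_eq0 p (x : 'cV[R]_p) : enorm x = 0 -> x = 0.
Proof.
move=> x0; have := sqr_enorm x; rewrite x0 expr0n/= => /esym/eqP.
rewrite psumr_eq0 => [/allP h|i _]; last exact: sqr_ge0.
apply/colP => i; rewrite mxE; apply/eqP.
by have := h i (mem_index_enum i); rewrite sqrf_eq0.
Qed.

Lemma enorm_delta p (i : 'I_p) : enorm (delta_mx i 0 : 'cV[R]_p) = 1.
Proof.
apply/eqP; rewrite -(@eqrXn2 _ 2)// ?enorm_ge0// expr1n sqr_enorm.
rewrite (bigD1 i)//= mxE !eqxx expr1n big1 ?addr0// => j ji.
by rewrite mxE (negPf ji) expr0n.
Qed.

Lemma bilin_sum p (y x : 'cV[R]_p) : (y^T *m x) 0 0 = \sum_i y i 0 * x i 0.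
Proof. by rewrite mxE; apply: eq_bigr => i _; rewrite mxE. Qed.

Lemma enorm_cauchy_schwarz p (y x : 'cV[R]_p) :
  `|(y^T *m x) 0 0| <= enorm y * enorm x.
Proof.
rewrite bilin_sum; apply: (le_trans (ler_norm_sum _ _ _)).
set a := enorm x; set b := enorm y.
have [x0|x0] := eqVneq a 0.
  by rewrite x0 mulr0 big1// => i _; rewrite (enorm_eq0 x0) mxE mulr0 normr0.
have [y0|y0] := eqVneq b 0.
  by rewrite y0 mul0r big1// => i _; rewrite (enorm_eq0 y0) mxE mul0r normr0.
have a0 : 0 < a by rewrite lt_def x0 enorm_ge0.
have b0 : 0 < b by rewrite lt_def y0 enorm_ge0.
(* Weighted arithmetic-geometric inequality, with weights chosen so that each of the two terms sums
   to [a * b]. *)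
apply: (@le_trans _ _ (\sum_i (a / b * y i 0 ^+ 2 + b / a * x i 0 ^+ 2) / 2)).
  apply: ler_sum => i _; rewrite normrM -[y i 0 ^+ 2]real_normK ?num_real//.
  rewrite -[x i 0 ^+ 2]real_normK ?num_real//.
  rewrite -subr_ge0 (_ : _ - _ = a * b / 2 * (`|y i 0| / b - `|x i 0| / a) ^+ 2).
    by rewrite mulr_ge0 ?sqr_ge0// divr_ge0// mulr_ge0// ltW.
  by field; rewrite x0 y0.
rewrite -mulr_suml big_split/= -!mulr_sumr -!sqr_enorm -/a -/b.
by rewrite [leLHS](_ : _ = b * a)//; field; rewrite x0 y0.
Qed.

(** The squared Frobenius norm. It bounds the set whose supremum is [opnorm], and it is the squared
    Euclidean norm of a vectorised matrix. *)
Definition frob2 p q (M : 'M[R]_(p, q)) : R := \sum_i \sum_j M i j ^+ 2.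

Lemma frob2_ge0 p q (M : 'M[R]_(p, q)) : 0 <= frob2 M.
Proof. by apply: sumr_ge0 => i _; apply: sumr_ge0 => j _; exact: sqr_ge0. Qed.

Lemma frob2_tr p q (M : 'M[R]_(p, q)) : frob2 M^T = frob2 M.
Proof.
rewrite /frob2 exchange_big; apply: eq_bigr => i _.
by apply: eq_bigr => j _; rewrite mxE.
Qed.

Lemma frob2_col p q (M : 'M[R]_(p, q)) : frob2 M = \sum_j enorm (col j M) ^+ 2.
Proof.
rewrite /frob2 exchange_big; apply: eq_bigr => i _.
by rewrite sqr_enorm; apply: eq_bigr => j _; rewrite mxE.
Qed.

Lemma enorm_mulmx_frob p q (M : 'M[R]_(p, q)) (x : 'cV[R]_q) :
  enorm (M *m x) <= Num.sqrt (frob2 M) * enorm x.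
Proof.
rewrite -(@ler_pXn2r _ 2)// ?nnegrE ?mulr_ge0 ?enorm_ge0 ?sqrtr_ge0//.
rewrite exprMn (sqr_sqrtr (frob2_ge0 M)) -frob2_tr frob2_col mulr_suml sqr_enorm.
apply: ler_sum => i _.
have -> : (M *m x) i 0 = ((col i M^T)^T *m x) 0 0.
  by rewrite !mxE; apply: eq_bigr => j _; rewrite !mxE.
rewrite -exprMn -[leLHS]real_normK ?num_real//.
by rewrite lerXn2r ?nnegrE ?mulr_ge0 ?enorm_ge0// enorm_cauchy_schwarz.
Qed.

Lemma opnorm_has_sup p q (M : 'M[R]_(p, q)) :
  has_sup [set enorm (M *m x) | x in [set x : 'cV[R]_q | enorm x <= 1]].
Proof.
split; first by exists (enorm (M *m 0)); exists 0 => //=; rewrite enorm0.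
exists (Num.sqrt (frob2 M)) => _ [x /= x1 <-].
apply: (le_trans (enorm_mulmx_frob M x)).
by rewrite ler_piMr ?sqrtr_ge0.
Qed.

Lemma opnorm_ge0 p q (M : 'M[R]_(p, q)) : 0 <= opnorm M.
Proof.
apply: (ub_le_sup (opnorm_has_sup M).2); exists 0 => /=; rewrite ?enorm0//.
by rewrite mulmx0 enorm0.
Qed.

Lemma enorm_mulmx_le p q (M : 'M[R]_(p, q)) (x : 'cV[R]_q) :
  enorm (M *m x) <= opnorm M * enorm x.
Proof.
have [/enorm_eq0 ->|x0] := eqVneq (enorm x) 0.
  by rewrite mulmx0 !enorm0 mulr0.
have xp : 0 < enorm x by rewrite lt_def x0 enorm_ge0.
rewrite -ler_pdivrMr//; apply: (ub_le_sup (opnorm_has_sup M).2).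
exists ((enorm x)^-1 *: x) => /=.
  by rewrite enormZ gtr0_norm ?invr_gt0// mulVf.
by rewrite -scalemxAr enormZ gtr0_norm ?invr_gt0// mulrC.
Qed.

Lemma opnorm_le p q (M : 'M[R]_(p, q)) c : 0 <= c ->
  (forall x, enorm (M *m x) <= c * enorm x) -> opnorm M <= c.
Proof.
move=> c0 h; apply: ge_sup; first exact: (opnorm_has_sup M).1.
by move=> _ [x /= x1 <-]; apply: (le_trans (h x)); rewrite ler_piMr.
Qed.

(** The bilinear bound is tested at y = M x. This form suits covariances, which are controlled
    through the scalars y^T Z x. *)
Lemma opnorm_le_bilin p q (M : 'M[R]_(p, q)) c : 0 <= c ->
  (forall y x, `|(y^T *m M *m x) 0 0| <= c * (enorm y * enorm x)) -> opnorm M <= c.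
Proof.
move=> c0 h; apply: opnorm_le => // x.
have [->|y0] := eqVneq (enorm (M *m x)) 0; first by rewrite mulr_ge0 ?enorm_ge0.
have yp : 0 < enorm (M *m x) by rewrite lt_def y0 enorm_ge0.
rewrite -(ler_pM2l yp) -expr2 mulrCA; apply: le_trans (h _ _).
rewrite -mulmxA bilin_sum sqr_enorm; apply: le_trans (ler_norm _).
by apply: ler_sum => i _; rewrite expr2.
Qed.

Lemma bilin_le p q (M : 'M[R]_(p, q)) y x :
  `|(y^T *m M *m x) 0 0| <= opnorm M * (enorm y * enorm x).
Proof.
rewrite -mulmxA; apply: (le_trans (enorm_cauchy_schwarz _ _)).
by rewrite mulrCA ler_wpM2l ?enorm_ge0// enorm_mulmx_le.
Qed.

Lemma opnorm_tr_le p q (M : 'M[R]_(p, q)) : opnorm M^T <= opnorm M.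
Proof.
apply: opnorm_le_bilin => [|y x]; first exact: opnorm_ge0.
rewrite [enorm y * _]mulrC; apply: le_trans (bilin_le _ _ _).
rewrite (_ : (x^T *m M *m y) = (y^T *m M^T *m x)^T).
  by rewrite [in leRHS]mxE.
by rewrite !trmx_mul !trmxK mulmxA.
Qed.

Lemma entry_le_opnorm p q (M : 'M[R]_(p, q)) i j : `|M i j| <= opnorm M.
Proof.
have := bilin_le M (delta_mx i 0) (delta_mx j 0).
by rewrite !enorm_delta !mulr1 trmx_delta -rowE -colE !mxE.
Qed.

Lemma opnorm_sum p q (I : Type) (r : seq I) (Q : pred I) (M : I -> 'M[R]_(p, q)) :
  opnorm (\sum_(i <- r | Q i) M i) <= \sum_(i <- r | Q i) opnorm (M i).
Proof.
have s0 : 0 <= \sum_(i <- r | Q i) opnorm (M i).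
  by apply: sumr_ge0 => i _; exact: opnorm_ge0.
apply: opnorm_le_bilin => // y x.
rewrite mulmx_sumr mulmx_suml summxE mulr_suml.
by apply: (le_trans (ler_norm_sum _ _ _)); apply: ler_sum => i _; exact: bilin_le.
Qed.

Lemma frob2_mulmx p q r (M : 'M[R]_(p, q)) (W : 'M[R]_(q, r)) :
  frob2 (M *m W) <= opnorm M ^+ 2 * frob2 W.
Proof.
rewrite !frob2_col mulr_sumr; apply: ler_sum => j _; rewrite -exprMn.
rewrite lerXn2r ?nnegrE ?mulr_ge0 ?enorm_ge0 ?opnorm_ge0//.
by rewrite !colE -mulmxA; exact: enorm_mulmx_le.
Qed.

(** Read [z] as a matrix [W]: the Kronecker product then acts as W -> X W Y^T, and the Euclidean
    norm is the Frobenius norm, for which each outer factor costs its operator norm. *)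
Lemma opnorm_tens n p q (X : 'M[R]_(p, n)) (Y : 'M[R]_(q, n)) :
  opnorm (X *t Y) <= opnorm X * opnorm Y.
Proof.
apply: opnorm_le => [|z]; first by rewrite mulr_ge0 ?opnorm_ge0.
pose W : 'M[R]_n := \matrix_(i, j) z (mxtens_index (i, j)) 0.
have sum2 (a b : nat) (f : 'I_(a * b) -> R) :
    \sum_k f k = \sum_i \sum_j f (mxtens_index (i, j)).
  rewrite (reindex (@mxtens_index a b)); last first.
    by exists (@mxtens_unindex a b) => k _; rewrite (mxtens_indexK, mxtens_unindexK).
  by rewrite pair_bigA; apply: eq_bigr => -[i j].
rewrite -(@ler_pXn2r _ 2)// ?nnegrE ?mulr_ge0 ?enorm_ge0 ?opnorm_ge0//.
have -> : enorm ((X *t Y) *m z) ^+ 2 = frob2 (X *m W *m Y^T).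
  rewrite sqr_enorm sum2; apply: eq_bigr => i _; apply: eq_bigr => j _.
  rewrite tensmx_sandwich mxE; congr (_ ^+ 2); apply: eq_bigr => k _.
  by rewrite [W _ _]mxE -surjective_pairing mxtens_unindexK.
have -> : (opnorm X * opnorm Y * enorm z) ^+ 2 =
    opnorm Y ^+ 2 * (opnorm X ^+ 2 * frob2 W).
  rewrite (_ : frob2 W = enorm z ^+ 2); first by ring.
  by rewrite sqr_enorm sum2; apply: eq_bigr => i _; apply: eq_bigr => j _; rewrite mxE.
rewrite -frob2_tr trmx_mul trmxK; apply: (le_trans (frob2_mulmx _ _)).
by rewrite ler_wpM2l ?sqr_ge0// frob2_tr frob2_mulmx.
Qed.

End operator_norm.

(** * Convolution inequalities and matrix series *)

(** With l = i - j the left side runs over pairs j, l >= 1 with j + l <= k, so both indices stay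
    below [k]. The sum on the right is one term shorter, which makes the induction on partial sums
    possible. *)
Lemma ler_sum_convolution (R : realDomainType) (G : nat -> R) k :
  (forall i, 0 <= G i) ->
  \sum_(1 <= i < k.+1) \sum_(1 <= j < i) G j * G (i - j)%N <=
  (\sum_(1 <= i < k) G i) ^+ 2.
Proof.
move=> G0.
have -> : \sum_(1 <= i < k.+1) \sum_(1 <= j < i) G j * G (i - j)%N =
    \sum_(1 <= j < k) G j * \sum_(j.+1 <= i < k.+1) G (i - j)%N.
  transitivity (\sum_(1 <= i < k.+1) \sum_(1 <= j < k | (j < i)%N) G j * G (i - j)%N).
    rewrite big_nat_cond [RHS]big_nat_cond; apply: eq_bigr => i /andP[/andP[_ ik] _].
    by rewrite (big_nat_widen _ _ k).
  rewrite (exchange_big_dep xpredT)//=.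
  rewrite big_nat_cond [RHS]big_nat_cond; apply: eq_bigr => j /andP[/andP[j1 _] _].
  by rewrite mulr_sumr (big_nat_widenl j.+1 1).
rewrite expr2 mulr_suml big_nat_cond [leRHS]big_nat_cond.
apply: ler_sum => j /andP[/andP[j1 jk] _]; rewrite ler_wpM2l//.
rewrite -[j.+1]add1n big_addn.
under eq_bigr do rewrite addnK.
rewrite [leRHS](@big_cat_nat _ _ _ (k.+1 - j)%N) ?lerDl ?sumr_ge0//=.
  by rewrite subn_gt0 ltnS ltnW.
by rewrite leq_subLR -addn1 addnC leq_add2r.
Qed.

(* The quadratic map s |-> G 1 + f s^2 leaves [0, 2 (G 1)] invariant exactly
   when 4 f (G 1) <= 1. *)
Lemma convolution_bounded (R : realFieldType) (G : nat -> R) (f : R) :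
  (forall i, 0 <= G i) -> 0 <= f ->
  (forall i, (2 <= i)%N -> G i <= f * \sum_(1 <= j < i) G j * G (i - j)%N) ->
  4 * f * G 1%N <= 1 ->
  forall k, \sum_(1 <= i < k) G i <= 2 * G 1%N.
Proof.
move=> G0 f0 hG h4; elim=> [|k ih]; first by rewrite big_geq// mulr_ge0.
case: k ih => [|k] ih; first by rewrite big_geq// mulr_ge0.
rewrite big_ltn//; set S := \sum_(1 <= i < k.+1) G i in ih.
have S0 : 0 <= S by rewrite sumr_ge0.
apply: (@le_trans _ _ (G 1%N + f * S ^+ 2)).
  rewrite lerD2l; apply: (@le_trans _ _ (\sum_(2 <= i < k.+2)
      f * \sum_(1 <= j < i) G j * G (i - j)%N)).
    rewrite big_nat_cond [leRHS]big_nat_cond; apply: ler_sum => i /andP[/andP[i2 _] _].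
    exact: hG.
  rewrite -mulr_sumr ler_wpM2l//; apply: le_trans (ler_sum_convolution _ G0).
  by rewrite [leRHS]big_ltn// lerDr big_geq.
have g0 := G0 1%N.
(* Then f S^2 <= (4 f G_1) G_1 <= G_1, which leaves exactly 2 G_1. *)
have : S ^+ 2 <= (2 * G 1%N) ^+ 2 by rewrite lerXn2r ?nnegrE ?mulr_ge0.
move=> /(ler_wpM2l f0); have := ler_wpM2r g0 h4; lra.
Qed.

(** * Entrywise limits and absolutely convergent matrix series *)

Section matrix_limits.
Context (R : realType).

Lemma cvg_mx (T : Type) (G : set_system T) (FG : Filter G) p q
    (f : T -> 'M[R]_(p, q)) (L : 'M[R]_(p, q)) :
  (forall i j, f t i j @[t --> G] --> L i j) -> f t @[t --> G] --> L.
Proof.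
move=> h U [V VL VU].
have : G [set t | forall i, forall j, V i j (f t i j)].
  apply: filter_forall => i; apply: filter_forall => j; exact: h (VL i j).
by apply: (@filterS _ G) => t Vt; apply: VU.
Qed.

Lemma cvg_mx_entry (T : Type) (G : set_system T) (FG : Filter G) p q
    (f : T -> 'M[R]_(p, q)) (L : 'M[R]_(p, q)) i j :
  f t @[t --> G] --> L -> f t i j @[t --> G] --> L i j.
Proof.
by move=> h; apply: (cvg_comp f (fun M : 'M[R]_(p, q) => M i j) h); exact: coord_continuous.
Qed.

Lemma is_cvg_mx (T : Type) (G : set_system T) (FG : ProperFilter G) p q
    (f : T -> 'M[R]_(p, q)) :
  (forall i j, cvg (f t i j @[t --> G])) -> cvg (f t @[t --> G]).
Proof.
move=> h; apply/cvg_ex; exists (\matrix_(i, j) lim (f t i j @[t --> G])).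
by apply: cvg_mx => i j; rewrite mxE; exact: h.
Qed.

Lemma opnorm_series_cvg n (M : nat -> 'M[R]_n) (c : R) :
  (forall k, \sum_(1 <= i < k) opnorm (M i) <= c) ->
  cvg (\sum_(1 <= i < k) M i @[k --> \oo]).
Proof.
move=> hc; apply: is_cvg_mx => a b.
(* [series] starts at index 0 and the Gramian sum at 1, so a zero term is placed in front. *)
pose u i : R := if i is 0%N then 0 else M i a b.
have E k : (\sum_(1 <= i < k) M i) a b = series u k.
  rewrite summxE /series/=; case: k => [|k]; first by rewrite !big_geq.
  rewrite [RHS]big_ltn// add0r big_nat_cond [RHS]big_nat_cond.
  by apply: eq_bigr => -[|i].
rewrite (_ : (fun k => _) = series u); last by apply/funext => k; rewrite E.
apply: normed_cvg; apply: nondecreasing_is_cvgn.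
  by apply: nondecreasing_series => i _ _; exact: normr_ge0.
exists c => _ [k _ <-]; apply: le_trans (hc k).
change (\sum_(0 <= i < k) `|u i| <= \sum_(1 <= i < k) opnorm (M i)).
case: k => [|k]; first by rewrite !big_geq.
rewrite big_ltn// normr0 add0r big_nat_cond [leRHS]big_nat_cond.
by apply: ler_sum => -[|i]// _; exact: entry_le_opnorm.
Qed.

End matrix_limits.

(** * The Gramians *)

(** [F] will be an expectation whose measurability in time is not established, so [c] cannot be
    pulled out of its integral. It is divided out on the side of [|g|], and the integrals are
    compared by [ge0_le_integral_any]. *)
Lemma le_abs_Rintegral_scaled (R : realType) (d : measure_display)
    (T : measurableType d) (mu : {measure set T -> \bar R}) (D : set T)
    (g : T -> R) (F : T -> \bar R) (c : R) : measurable D ->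
  mu.-integrable D (EFin \o g) -> 0 <= c -> (forall x, D x -> 0 <= F x)%E ->
  (forall x, D x -> `|g x|%:E <= F x * c%:E)%E ->
  (`|\int[mu]_(x in D) g x|%R%:E <= (\int[mu]_(x in D) F x) * c%:E)%E.
Proof.
move=> mD ig c0 F0 gF.
apply: (@le_trans _ _ (\int[mu]_(x in D) (`|g x|)%:E)%E).
  have fi : (\int[mu]_(x in D) (`|g x|)%:E < +oo)%E.
    by have /integrableP[_] := ig.
  have := le_normr_Rintegral mD ig; rewrite /Rintegral -lee_fin fineK//.
  by rewrite ge0_fin_numE//; apply: integral_ge0 => x _; rewrite lee_fin.
have mg : measurable_fun D (fun x => (`|g x|)%:E).
  have /measurable_EFinP mg := measurable_int mu ig.
  by apply/measurable_EFinP; exact: measurableT_comp.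
(* Division fails for [c = 0]; then 0 times a possibly infinite [F x] is 0 and forces [g] to vanish
   on [D]. *)
have [c_0|cn0] := eqVneq c 0.
  rewrite c_0 mule0 integral0_eq// => x Dx; apply/eqP.
  by have := gF x Dx; rewrite c_0 mule0 lee_fin normr_le0 => /eqP ->; rewrite normr0.
have cp : 0 < c by rewrite lt_def cn0.
rewrite muleC -lee_pdivrMl// -ge0_integralZl_EFin ?invr_ge0//; last first.
apply: ge0_le_integral_any => x Dx; first by rewrite mule_ge0// lee_fin invr_ge0.
by rewrite lee_pdivrMl// muleC; exact: gF.
Qed.

Lemma opnorm_le_ereal (R : realType) (p q : nat) (M : 'M[R]_(p, q)) (c : \bar R) :
  (0 <= c)%E ->
  (forall y x, `|(y^T *m M *m x) 0 0|%:E <= c * (enorm y * enorm x)%:E)%E ->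
  ((opnorm M)%:E <= c)%E.
Proof.
case: c => [c| |] // c0 h; last by rewrite leey.
by rewrite lee_fin; apply: opnorm_le_bilin => // y x; have := h y x; rewrite -EFinM lee_fin.
Qed.

Lemma bilin_entries (R : realType) (p q : nat) (y : 'cV[R]_p) (x : 'cV[R]_q)
    (M : 'M[R]_(p, q)) :
  (y^T *m M *m x) 0 0 = \sum_k (y k.1 0 * x k.2 0) * M k.1 k.2.
Proof.
rewrite -(pair_bigA _ (fun a b => (y a 0 * x b 0) * M a b))/= mxE exchange_big/=.
apply: eq_bigr => b _; rewrite mxE mulr_suml; apply: eq_bigr => a _.
by rewrite mxE mulrAC.
Qed.

(* Since 0 * +oo = 0, the bound on 4 f g also allows f = +oo with g = 0 (then
   every G i vanishes) and f = 0 with g = +oo. *)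
Lemma convolution_bounded_ereal (R : realType) (G : nat -> R) (f g : \bar R) :
  (forall i, 0 <= G i) -> (0 <= f)%E -> ((G 1%N)%:E <= g)%E ->
  (forall i, (2 <= i)%N ->
    (G i)%:E <= f * (\sum_(1 <= j < i) G j * G (i - j)%N)%:E)%E ->
  (4%:E * f * g <= 1)%E ->
  forall k, \sum_(1 <= i < k) G i <= 2 * G 1%N.
Proof.
move=> G0 f0 Gg hG fg.
have g0 : (0 <= g)%E by apply: le_trans Gg; rewrite lee_fin.
case: f f0 hG fg => [f| |]// f0 hG fg k.
- apply: (@convolution_bounded _ G f) => [|//|i i2|]; first exact: G0.
    by rewrite -lee_fin EFinM; exact: hG.
  rewrite -lee_fin !EFinM; apply: le_trans fg.
  by apply: lee_wpmul2l Gg; rewrite -EFinM lee_fin mulr_ge0.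
- have g_0 : g = 0%E.
    apply/eqP; rewrite eq_le g0 andbT leNgt; apply/negP => gp.
    by move: fg; rewrite gt0_muley ?lte_fin// gt0_mulye.
  have G1 : G 1%N = 0.
    by apply/le_anti; rewrite G0 andbT -lee_fin; move: Gg; rewrite g_0.
  have GE i : (1 <= i)%N -> G i = 0.
    elim/ltn_ind: i => -[//|[//|i]] ih _; apply/le_anti; rewrite G0 andbT.
    have := hG i.+2 isT; rewrite big_nat_cond big1 ?mule0 ?lee_fin//.
    by move=> j /andP[/andP[j1 ji] _]; rewrite ih// mul0r.
  rewrite G1 mulr0 big_nat_cond big1// => i /andP[/andP[i1 _] _]; exact: GE.
Qed.

(** * Operator norm bounds for time integrals *)

Section time_integrals.
Context (R : realType) (n : nat) (Z : R -> 'M[R]_n) (F : R -> \bar R) (c : R).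
Hypotheses (F_ge0 : forall t, (0 <= F t)%E) (c_ge0 : 0 <= c).
Hypothesis Z_int : forall a b t,
  lebesgue_measure.-integrable `[0, t] (EFin \o (fun s => Z s a b)).
Hypothesis Z_le : forall t y x, 0 <= t ->
  (`|(y^T *m Z t *m x) 0 0|%:E <= F t * (c * (enorm y * enorm x))%:E)%E.
Local Notation la := (@lebesgue_measure R).

(** Two instances are used: [F] the norm of the first solution with [c = 1], and [F] the second
    moment of Phi_t H with [c] the norm of the middle factor of the initial value. *)
Lemma mxint_bilin_le t y x :
  (`|(y^T *m mxint t Z *m x) 0 0|%:E <=
   (\int[la]_(s in `[0%R, t]) F s) * (c * (enorm y * enorm x))%:E)%E.
Proof.
have mt : @measurable _ (measurableTypeR R) `[0,t]%classic by exact: measurable_itv.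
rewrite bilin_entries.
have [iZ EZ] := @Rintegral_lincomb _ _ _ la `[0,t]%classic _ (index_enum ('I_n * 'I_n)%type)
  (fun k => y k.1 0 * x k.2 0) (fun k s => Z s k.1 k.2) mt (fun k => Z_int k.1 k.2 t).
have -> : \sum_k (y k.1 0 * x k.2 0) * mxint t Z k.1 k.2 =
    \int[la]_(s in `[0, t]) (\sum_k (y k.1 0 * x k.2 0) * Z s k.1 k.2).
  rewrite EZ; apply: eq_bigr => k _; by rewrite mxE.
apply: le_abs_Rintegral_scaled => //.
- by rewrite mulr_ge0// mulr_ge0 ?enorm_ge0.
- move=> s; rewrite /= in_itv/= => /andP[s0 _].
  by rewrite -bilin_entries; exact: Z_le.
Qed.

Lemma opnorm_mxint_le t :
  ((opnorm (mxint t Z))%:E <= (\int[la]_(s in `[0%R, t]) F s) * c%:E)%E.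
Proof.
apply: opnorm_le_ereal => [|y x]; first by rewrite mule_ge0 ?integral_ge0.
by rewrite -muleA -EFinM; exact: mxint_bilin_le.
Qed.

Lemma opnorm_mxint_oo_le : cvg (mxint t Z @[t --> +oo]) ->
  ((opnorm (mxint_oo Z))%:E <= (\int[la]_(s in `[0%R, +oo[) F s) * c%:E)%E.
Proof.
move=> cZ; have I0 : (0 <= \int[la]_(s in `[0%R, +oo[) F s)%E by exact: integral_ge0.
apply: opnorm_le_ereal => [|y x]; first by rewrite mule_ge0.
rewrite -muleA -EFinM; set k := c * _.
have k0 : 0 <= k by rewrite mulr_ge0// mulr_ge0 ?enorm_ge0.
have le_t t : (`|(y^T *m mxint t Z *m x) 0 0|%:E <=
    (\int[la]_(s in `[0%R, +oo[) F s) * k%:E)%E.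
  apply: (le_trans (mxint_bilin_le t y x)); rewrite -/k lee_wpmul2r ?lee_fin//.
  rewrite integral_mkcond [leRHS]integral_mkcond.
  apply: ge0_le_integral_any => s _; rewrite !patchE.
    by case: ifPn.
  case: ifPn => [|_]; last by case: ifPn.
  rewrite !mem_setE /= !in_itv/= andbT => /andP[-> _]//.
have cl : `|(y^T *m mxint t Z *m x) 0 0| @[t --> +oo] -->
    `|(y^T *m mxint_oo Z *m x) 0 0|.
  apply: cvg_norm; rewrite bilin_entries.
  rewrite (_ : (fun t => _) = fun t =>
    \sum_k (y k.1 0 * x k.2 0) * mxint t Z k.1 k.2); last first.
    by apply/funext => t; exact: bilin_entries.
  by apply: cvg_finsum => i; apply: cvgMr; exact: cvg_mx_entry.
(* A finite bound, being uniform in [t], passes to the limit; the value [+oo] is trivial and [-oo]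
   is excluded at t = 0. *)
move: le_t; case: (_ * _)%E => [r| |] le_t; rewrite ?leey//.
  rewrite lee_fin -(cvg_lim _ cl)//; apply: limr_le; first by apply/cvg_ex; eexists; exact: cl.
  by apply: nearW => t; have := le_t t; rewrite lee_fin.
by have := le_t 0; rewrite leeNy_eq.
Qed.

End time_integrals.

(** * Lyapunov solutions as covariances of the stochastic flow *)

Section covariance.
Context (R : realType) (n m : nat).
Context (d : measure_display) (Omega : measurableType d) (P : probability Omega R).
Context (F : R -> set (set Omega)) (w : 'I_m -> R -> Omega -> R).
Context (A : 'M[R]_n) (N : 'I_m -> 'M[R]_n) (Phi : R -> Omega -> 'M[R]_n).
Hypotheses (HF : filtration F) (Hw : wiener_process P F w)
  (HPhi : fundamental_solution P F w A N Phi).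

Lemma solves_lyap_second_moment b c :
  solves_lyap A N (delta_mx b c) (second_moment P Phi b c).
Proof.
by apply: integral_solves_lyap => a e t t0; exact: (second_moment_eq HF Hw HPhi).
Qed.

(** [K] is expanded in elementary matrices. The same combination of the second moments solves the
    Lyapunov equation with initial value [K], so uniqueness identifies it with [Z]. *)
Lemma solves_lyap_mean (K : 'M[R]_n) Z : solves_lyap A N K Z ->
  forall t (y x : 'cV[R]_n), 0 <= t ->
  P.-integrable setT (EFin \o (fun o => (y^T *m (Phi t o *m K *m (Phi t o)^T) *m x) 0 0)) /\
  (y^T *m Z t *m x) 0 0 =
  \int[P]_o (y^T *m (Phi t o *m K *m (Phi t o)^T) *m x) 0 0.
Proof.
move=> hZ t y x t0.
pose h (k : ('I_n * 'I_n) * ('I_n * 'I_n)) o := Phi t o k.1.1 k.2.1 * Phi t o k.1.2 k.2.2.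
pose cf (k : ('I_n * 'I_n) * ('I_n * 'I_n)) := y k.1.1 0 * x k.1.2 0 * K k.2.1 k.2.2.
have ih k : P.-integrable setT (EFin \o h k).
  by apply: sqint_int; exact: (sqint_fundamental HF Hw HPhi).
have [iL EL] := @Rintegral_lincomb _ _ _ P setT _
  (index_enum (('I_n * 'I_n) * ('I_n * 'I_n))%type)
  cf h measurableT ih.
have E o : (y^T *m (Phi t o *m K *m (Phi t o)^T) *m x) 0 0 = \sum_k cf k * h k o.
  rewrite bilin_entries -(pair_bigA _ (fun p q => cf (p, q) * h (p, q) o))/=.
  apply: eq_bigr => -[a e] _ /=.
  transitivity (y a 0 * x e 0 * \sum_q
      K q.1 q.2 * (Phi t o a q.1 * Phi t o e q.2)); last first.
    by rewrite mulr_sumr; apply: eq_bigr => -[b c] _; rewrite /cf /h/= mulrA.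
  congr (_ * _); rewrite -(pair_bigA _ (fun b c => K b c * (Phi t o a b * Phi t o e c)))/=.
  rewrite mxE exchange_big/=; apply: eq_bigr => c _; rewrite !mxE mulr_suml.
  by apply: eq_bigr => b _; ring.
have -> : (fun o => (y^T *m (Phi t o *m K *m (Phi t o)^T) *m x) 0 0) =
    fun o => \sum_k cf k * h k o by apply/funext.
split=> //; rewrite EL.
have hK := solves_lyap_lincomb (index_enum ('I_n * 'I_n)%type) (fun q => K q.1 q.2)
  (fun q => solves_lyap_second_moment q.1 q.2).
have KE : \sum_q K q.1 q.2 *: delta_mx q.1 q.2 = K.
  by rewrite [RHS]matrix_sum_delta pair_bigA.
rewrite KE in hK; rewrite (solves_lyap_unique hZ hK t0) bilin_entries.
rewrite -(pair_bigA _ (fun p q => cf (p, q) * \int[P]_o h (p, q) o))/=.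
apply: eq_bigr => -[a e] _ /=; rewrite summxE mulr_sumr; apply: eq_bigr => -[b c] _.
by rewrite !mxE /cf /= mulrA.
Qed.

(** With Psi = Phi_t H the integrand is (Psi^T y)^T M (Psi^T x). Keeping [H] attached to Phi_t
    produces the norm of the product Phi_t H rather than a product of norms. *)
Lemma solves_lyap_le q (H : 'M[R]_(n, q)) (M : 'M[R]_q) Z :
  solves_lyap A N (H *m M *m H^T) Z ->
  forall t y x, 0 <= t ->
  (`|(y^T *m Z t *m x) 0 0|%:E <=
   'E_P[fun omega => (opnorm (Phi t omega *m H) ^+ 2)%R] *
   (opnorm M * (enorm y * enorm x))%:E)%E.
Proof.
move=> hZ t y x t0; have [iZ ->] := solves_lyap_mean hZ y x t0.
rewrite unlock; apply: le_abs_Rintegral_scaled => //.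
- by rewrite mulr_ge0 ?opnorm_ge0// mulr_ge0 ?enorm_ge0.
- by move=> o _; rewrite lee_fin sqr_ge0.
move=> o _; rewrite -EFinM lee_fin; set Psi := Phi t o *m H.
have -> : y^T *m (Phi t o *m (H *m M *m H^T) *m (Phi t o)^T) *m x =
    (Psi^T *m y)^T *m M *m (Psi^T *m x).
  by rewrite trmx_mul trmxK /Psi trmx_mul !mulmxA.
apply: (le_trans (bilin_le _ _ _)).
rewrite [leRHS]mulrCA ler_wpM2l ?opnorm_ge0//.
have le1 (z : 'cV[R]_n) : enorm (Psi^T *m z) <= opnorm Psi * enorm z.
  apply: (le_trans (enorm_mulmx_le _ _)).
  by rewrite ler_wpM2r ?enorm_ge0// opnorm_tr_le.
rewrite expr2 mulrACA; apply: ler_pM; rewrite ?enorm_ge0//; exact: le1.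
Qed.

(* The two cases are J = mxint T with D = [0, T], and J = mxint_oo with
   D = [0, +oo). *)
Lemma gramian_sum_bounded (B : 'M[R]_(n, m)) (H : 'M[R]_(n, n * n))
    (J : (R -> 'M[R]_n) -> 'M[R]_n) (D : set R) (Z : nat -> R -> 'M[R]_n) :
  gramian_family A B N H J Z ->
  (forall i Z0 (Q : R -> \bar R) (c : R), (1 <= i)%N -> solves_lyap A N Z0 (Z i) ->
    (forall t, 0 <= Q t)%E -> 0 <= c ->
    (forall (t : R) y x, 0 <= t ->
      (`|(y^T *m Z i t *m x) 0 0|%:E <= Q t * (c * (enorm y * enorm x))%:E)%E) ->
    ((opnorm (J (Z i)))%:E <= (\int[lebesgue_measure]_(t in D) Q t) * c%:E)%E) ->
  (4%:E
   * (\int[lebesgue_measure]_(t in D)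
        'E_P[fun omega => (opnorm (Phi t omega *m H) ^+ 2)%R])
   * (\int[lebesgue_measure]_(t in D) (opnorm (Z 1%N t))%:E) <= 1)%E ->
  forall k, \sum_(1 <= i < k) opnorm (J (Z i)) <= 2 * opnorm (J (Z 1%N)).
Proof.
move=> [hZ1 hZ] hJ h4.
have E0 t : (0 <= 'E_P[fun omega => (opnorm (Phi t omega *m H) ^+ 2)%R])%E.
  by rewrite unlock; apply: integral_ge0 => o _; rewrite lee_fin sqr_ge0.
apply: (convolution_bounded_ereal (G := fun i => opnorm (J (Z i))) _ _ _ _ h4).
- by move=> i; exact: opnorm_ge0.
- exact: integral_ge0.
(* For the first term [Q] is the norm of the solution itself, with constant 1; for later terms it is
   the expectation, with constant [opnorm M]. *)
- rewrite -[leRHS]mule1; apply: (hJ _ _ _ _ _ hZ1) => // [t|t y x _].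
    by rewrite lee_fin opnorm_ge0.
  by rewrite mul1r -EFinM lee_fin; exact: bilin_le.
- move=> i i2; have hi := hZ i i2; set M := \sum_(1 <= k < i) _ in hi.
  apply: (@le_trans _ _ ((\int[lebesgue_measure]_(t in D)
    'E_P[fun omega => (opnorm (Phi t omega *m H) ^+ 2)%R]) * (opnorm M)%:E)%E).
    apply: (hJ _ _ _ _ _ hi) => //; first exact: ltnW.
      exact: opnorm_ge0.
    exact: solves_lyap_le hi.
  rewrite lee_wpmul2l ?integral_ge0// lee_fin.
  apply: (le_trans (opnorm_sum _ _ _)); apply: ler_sum => k _; exact: opnorm_tens.
Qed.

End covariance.

Theorem proposition2p17 (R : realType) (n m : nat) (T : R) (T_gt0 : 0 < T)
    (A : 'M[R]_n) (B : 'M[R]_(n, m)) (N : 'I_m -> 'M[R]_n)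
    (H : 'M[R]_(n, n * n))
    (d : measure_display) (Omega : measurableType d) (P : probability Omega R)
    (F : R -> set (set Omega)) (w : 'I_m -> R -> Omega -> R)
    (Phi : R -> Omega -> 'M[R]_n)
    (HF : filtration F) (Hw : wiener_process P F w)
    (HPhi : fundamental_solution P F w A N Phi) :
  (forall Z : nat -> R -> 'M[R]_n,
     gramian_family A B N H (mxint T) Z ->
     (4%:E
      * (\int[lebesgue_measure]_(t in `[0%R, T])
           'E_P[fun omega => (opnorm (Phi t omega *m H) ^+ 2)%R])
      * (\int[lebesgue_measure]_(t in `[0%R, T]) (opnorm (Z 1%N t))%:E)
      <= 1)%E ->
     gramian_T_exists T Z)
  /\
  (spectrum_in_Cminus (A *t 1%:M + 1%:M *t A + \sum_k (N k *t N k)) ->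
   forall Z : nat -> R -> 'M[R]_n,
     gramian_family A B N H (@mxint_oo R n n) Z ->
     (4%:E
      * (\int[lebesgue_measure]_(t in `[0%R, +oo[)
           'E_P[fun omega => (opnorm (Phi t omega *m H) ^+ 2)%R])
      * (\int[lebesgue_measure]_(t in `[0%R, +oo[) (opnorm (Z 1%N t))%:E)
      <= 1)%E ->
     gramian_exists Z).
Proof.
split=> [Z hZ h4|HK Z hZ h4].
  apply: opnorm_series_cvg; apply: (gramian_sum_bounded HF Hw HPhi hZ _ h4).
  move=> i Z0 Q c _ hi Q0 c0 hQ; apply: opnorm_mxint_le => // a b t.
  exact: solves_lyap_integrable hi.
have cZ i : (1 <= i)%N -> cvg (mxint t (Z i) @[t --> +oo]).
  (* Convergence holds for every initial value, so no induction on [i] is needed, although [Z i]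
     starts from limits of the earlier integrals. *)
  move=> i1; have [Z0 hi] : exists Z0, solves_lyap A N Z0 (Z i).
    case: hZ => hZ1 hZ; case: i i1 => [//|[|i]] _; first by eexists; exact: hZ1.
    by eexists; exact: hZ.
  by apply: is_cvg_mx => a b; exact: (solves_lyap_mxint_cvg HK hi).
split=> //; apply: opnorm_series_cvg; apply: (gramian_sum_bounded HF Hw HPhi hZ _ h4).
move=> i Z0 Q c i1 hi Q0 c0 hQ; apply: opnorm_mxint_oo_le => //; last exact: cZ.
by move=> a b t; exact: solves_lyap_integrable hi.
Qed.
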